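(* Let $\mathcal{R}_n=\mathbb{C}[x_1,\dots,x_n]/\langle e_1,\dots,e_n\rangle$ be the coinvariant algebra with its natural $\mathfrak{S}_n$-action, let $\mathcal{A}_n$ be its basis of sub-staircase monomials, and let $\le_r$ be the lexicographic order on $\mathcal{A}_n$. Then $(\mathcal{R}_n,\mathcal{A}_n,\le_r)$ is weakly quasisymmetric characteristic compatible.
   Context: $e_k$ are elementary symmetric polynomials; $\mathfrak{S}_n$ acts by permuting variables, so $s_i(x^\alpha)$ is the normal form of $x^{s_i(\alpha)}$ ($\alpha_i,\alpha_{i+1}$ swapped) expressed in the basis $\mathcal{A}_n=\{x_1^{\alpha_1}\cdots x_n^{\alpha_n}:0\le\alpha_j<j\}$. Lexicographic order uses $x_1>x_2>\cdots>x_n$. WQCC: let $M$ be a finite-dimensional $\mathfrak{S}_n$-module with basis $\mathcal{B}$ totally ordered by $\le$. For $w=\sum c_jv_j\ne0$, $\mathrm{lt}(w)=c_jv_j$ for the $\le$-largest $v_j$ with $c_j\ne0$ (its leading basis element being that $v_j$), and $\mathrm{tt}(w)=c_jv_j$ for the $\le$-smallest such $v_j$. Define linear operators $\overline{\pi}_i$ on basis elements by: $\overline{\pi}_i(v_k)=0$ if $\mathrm{tt}(s_iv_k)=v_k$; $\overline{\pi}_i(v_k)=-v_k$ if the leading basis element of $s_iv_k$ is some $v_j>v_k$ or $\mathrm{lt}(s_iv_k)=-v_k$; $\overline{\pi}_i(v_k)=s_iv_k$ if $\mathrm{lt}(s_iv_k)=v_j$ for some $v_j<v_k$, where it is assumed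 every basis element falls into one of these cases. If these satisfy $\overline{\pi}_i^2=-\overline{\pi}_i$, $\overline{\pi}_i\overline{\pi}_j=\overline{\pi}_j\overline{\pi}_i$ ($|i-j|\ge2$), $\overline{\pi}_i\overline{\pi}_{i+1}\overline{\pi}_i=\overline{\pi}_{i+1}\overline{\pi}_i\overline{\pi}_{i+1}$, call the resulting 0-Hecke module $\widehat M$; $(M,\mathcal{B},\le)$ is WQCC if this holds and $F^Q_{char}(\widehat M)=F_{char}(M)$. Here $F^Q_{char}(N)=\sum_jF_{I_j}$ for an $\mathcal{H}_n(0)$-module $N$ with composition factors $C_{I_1},\dots,C_{I_m}$, $C_I$ the one-dimensional module with $\overline{\pi}_i$ acting by $-1$ if $i\in I$, $0$ otherwise, and $F_I=\sum x_{i_1}\cdots x_{i_n}$ over $1\le i_1\le\cdots\le i_n$ with $i_j<i_{j+1}$ for $j\in I$; $F_{char}$ sends Specht modules $S^\mu$ to Schur functions $s_\mu$. *)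

(* Defs.v *)
From HB Require Import structures.
From mathcomp Require Import all_boot all_order all_fingroup all_algebra.
From mathcomp Require Import complex boolp reals mpoly.

Set Implicit Arguments.
Unset Strict Implicit.
Unset Printing Implicit Defensive.

Import Order.TTheory GRing.Theory Num.Theory.
Local Open Scope ring_scope.

(* Everything is 0-indexed: the variables are 'X_0, ..., 'X_(n-1) and the
   simple reflections, as well as the generators of the 0-Hecke algebra, are
   indexed by 'I_n.-1, the i-th one exchanging i and i+1. *)

Definition left_pos (n : nat) (i : 'I_n.-1) : 'I_n := widen_ord (leq_pred n) i.

Lemma right_pos_subproof (n : nat) (i : 'I_n.-1) : (i.+1 < n)%N.
Proof. by case: n i => [[]//|n] i; rewrite ltnS. Qed.

Definition right_pos (n : nat) (i : 'I_n.-1) : 'I_n :=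
  Ordinal (right_pos_subproof i).

Definition simple_refl (n : nat) (i : 'I_n.-1) : 'S_n := 
  tperm (left_pos i) (right_pos i).

(* A formal power series of bounded degree in x_1, x_2, ... is given by its
   truncations x_(N+1) = x_(N+2) = ... = 0, one for each N. *)
Definition series_trunc : Type := forall N : nat, {mpoly int[N]}.

Definition fund_qsym (n : nat) (I : {set 'I_n.-1}) : series_trunc := fun N =>
  \sum_(t : {ffun 'I_n -> 'I_N} |
        [forall j, t (left_pos j) <= t (right_pos j)]%N
        && [forall j in I, t (left_pos j) < t (right_pos j)]%N)
     \prod_(k < n) 'X_(t k).

Definition is_partition (n : nat) (mu : seq nat) : bool :=
  [&& sorted geq mu, 0%N \notin mu & sumn mu == n].

(* The box of a partition of n fits in an n x n square. *)
Definition diagram (n : nat) (mu : seq nat) : {set 'I_n * 'I_n} :=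
  [set c : 'I_n * 'I_n | c.2 < nth 0%N mu c.1]%N.

Definition cell (n : nat) (mu : seq nat) : finType :=
  {c : 'I_n * 'I_n | c \in diagram n mu}.

Definition semistandard (n : nat) (mu : seq nat) (N : nat)
    (T : {ffun cell n mu -> 'I_N}) : bool :=
  [forall c : cell n mu, forall d : cell n mu,
     (((val c).1 == (val d).1) && ((val c).2 < (val d).2)%N ==> (T c <= T d)%N)
     && (((val c).2 == (val d).2) && ((val c).1 < (val d).1)%N
          ==> (T c < T d)%N)].

Definition schur (n : nat) (mu : seq nat) : series_trunc := fun N =>
  \sum_(T : {ffun cell n mu -> 'I_N} | semistandard T) \prod_c 'X_(T c).

Section Specht.
Variables (C : numClosedFieldType) (n : nat).

(* A tableau of shape mu is recorded by the position of each entry; an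
   injection of 'I_n into the n cells of mu is a bijection. *)
Definition is_tableau (mu : seq nat) (T : {ffun 'I_n -> 'I_n * 'I_n}) : bool :=
  injectiveb T && [forall k, T k \in diagram n mu].

(* A tabloid is recorded by the row of each entry. *)
Definition tabloid : finType := {ffun 'I_n -> 'I_n}.

Definition tabloid_of (T : {ffun 'I_n -> 'I_n * 'I_n}) : tabloid :=
  [ffun k => (T k).1].

(* The tableau s T has the entry s k where T has the entry k. *)
Definition tableau_perm (s : 'S_n) (T : {ffun 'I_n -> 'I_n * 'I_n}) :
    {ffun 'I_n -> 'I_n * 'I_n} :=
  [ffun k => T ((s^-1)%g k)].

Definition col_stab (T : {ffun 'I_n -> 'I_n * 'I_n}) : {set 'S_n} :=
  [set s : 'S_n | [forall k, (T (s k)).2 == (T k).2]].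

(* The space spanned by the tabloids of all shapes. *)
Definition tabloid_space : vectType C := {ffun tabloid -> C^o}.

Definition tabloid_vec (t : tabloid) : tabloid_space :=
  [ffun u => (u == t)%:R].

(* The permutation action: tabloid_act s maps {T} to {s T}. *)
Definition tabloid_act (s : 'S_n) (f : tabloid_space) : tabloid_space :=
  [ffun t : tabloid => f [ffun k => t (s k)]].

Definition polytabloid (T : {ffun 'I_n -> 'I_n * 'I_n}) : tabloid_space :=
  \sum_(s in col_stab T) (-1) ^+ s *: tabloid_vec (tabloid_of (tableau_perm s T)).

Definition Specht (mu : seq nat) : {vspace tabloid_space} :=
  <<[seq polytabloid T | T <- enum (is_tableau mu)]>>%VS.

End Specht.

Section WeaklyQuasisymmetric.
Variables (C : numClosedFieldType) (n : nat) (M : lmodType C).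

(* Left modules: (s * t)%g is "first s, then t". *)
Definition is_Sn_module (act : 'S_n -> M -> M) : Prop :=
  [/\ forall s, linear (act s),
      forall x, act 1%g x = x
    & forall s t x, act (s * t)%g x = act t (act s x)].

(* M is isomorphic to the external direct sum of the Specht modules of mus. *)
Definition Specht_decomposition (act : 'S_n -> M -> M) (mus : seq (seq nat)) :
    Prop :=
  exists Phi : M -> {ffun 'I_(size mus) -> tabloid_space C n},
    [/\ linear Phi, injective Phi,
        forall f, (exists x, Phi x = f) <->
                  (forall j, f j \in Specht C n (nth [::] mus j))
      & forall s x, Phi (act s x) = [ffun j => tabloid_act s (Phi x j)]].

Definition Fchar (act : 'S_n -> M -> M) (f : series_trunc) : Prop :=
  exists mus : seq (seq nat),
    [/\ all (is_partition n) mus, Specht_decomposition act mus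
      & forall N, f N = \sum_(mu <- mus) schur n mu N].

Section Hecke.
Variable pib : 'I_n.-1 -> M -> M.

Definition zero_Hecke_module : Prop :=
  [/\ forall i, linear (pib i),
      forall i x, pib i (pib i x) = - pib i x,
      forall (i j : 'I_n.-1) x, (i.+1 < j)%N -> pib i (pib j x) = pib j (pib i x)
    & forall (i j : 'I_n.-1) x, j = i.+1 :> nat ->
        pib i (pib j (pib i x)) = pib j (pib i (pib j x))].

Definition submodule (N : M -> Prop) : Prop :=
  [/\ N 0, forall a x y, N x -> N y -> N (a *: x + y)
    & forall i x, N x -> N (pib i x)].

Definition simple_act (I : {set 'I_n.-1}) (i : 'I_n.-1) (c : C) : C :=
  if i \in I then - c else 0.

(* N / N' is isomorphic to C_I: there is a surjective morphism from N to C_I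
   with kernel N'. Only the restriction of phi to N is relevant. *)
Definition factor_iso (N N' : M -> Prop) (I : {set 'I_n.-1}) : Prop :=
  exists phi : M -> C,
    [/\ forall a x y, N x -> N y -> phi (a *: x + y) = a * phi x + phi y,
        forall c, exists2 x, N x & phi x = c,
        forall x, N' x <-> N x /\ phi x = 0
      & forall i x, N x -> phi (pib i x) = simple_act I i (phi x)].

Definition composition_factors (Is : seq {set 'I_n.-1}) : Prop :=
  exists N : nat -> M -> Prop,
    [/\ forall j, (j <= size Is)%N -> submodule (N j),
        forall x, N 0%N x <-> x = 0,
        forall x, N (size Is) x
      & forall j, (j < size Is)%N -> factor_iso (N j.+1) (N j) (nth set0 Is j)].

Definition FQchar (f : series_trunc) : Prop :=
  exists Is : seq {set 'I_n.-1},
    composition_factors Is /\ forall N, f N = \sum_(I <- Is) fund_qsym I N.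

End Hecke.

Variables (J : finType) (b : J -> M) (le : rel J).

Definition is_basis : Prop :=
  forall x, exists! c : {ffun J -> C}, x = \sum_j c j *: b j.

Definition total_order : Prop :=
  [/\ reflexive le, antisymmetric le, transitive le & total le].

(* lt(x) = a b_j *)
Definition is_lt (x : M) (a : C) (j : J) : Prop :=
  exists c : {ffun J -> C},
    [/\ x = \sum_k c k *: b k, c j = a, a != 0
      & forall k, c k != 0 -> le k j].

(* tt(x) = a b_j *)
Definition is_tt (x : M) (a : C) (j : J) : Prop :=
  exists c : {ffun J -> C},
    [/\ x = \sum_k c k *: b k, c j = a, a != 0
      & forall k, c k != 0 -> le j k].

Definition pib_zero_case (act : 'S_n -> M -> M) (i : 'I_n.-1) (k : J) : Prop :=
  is_tt (act (simple_refl i) (b k)) 1 k.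

Definition pib_opp_case (act : 'S_n -> M -> M) (i : 'I_n.-1) (k : J) : Prop :=
  (exists a j, is_lt (act (simple_refl i) (b k)) a j /\ (le k j /\ k != j))
  \/ is_lt (act (simple_refl i) (b k)) (-1) k.

Definition pib_refl_case (act : 'S_n -> M -> M) (i : 'I_n.-1) (k : J) : Prop :=
  exists j, is_lt (act (simple_refl i) (b k)) 1 j /\ (le j k /\ j != k).

(* Some case applies to every basis element; as the rule of every case that
   applies is imposed, the cases must moreover not conflict. *)
Definition pib_rules (act : 'S_n -> M -> M) (pib : 'I_n.-1 -> M -> M) : Prop :=
  forall i k,
    [/\ [\/ pib_zero_case act i k, pib_opp_case act i k | pib_refl_case act i k],
        pib_zero_case act i k -> pib i (b k) = 0,
        pib_opp_case act i k -> pib i (b k) = - b k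
      & pib_refl_case act i k -> pib i (b k) = act (simple_refl i) (b k)].

(* By Jordan-Hoelder and Krull-Schmidt, Fchar and FQchar hold of at most one
   series; the operators pib are determined by linearity and pib_rules. *)
Definition WQCC (act : 'S_n -> M -> M) : Prop :=
  [/\ is_Sn_module act, is_basis, total_order
    & exists pib : 'I_n.-1 -> M -> M,
        [/\ pib_rules act pib, zero_Hecke_module pib
          & exists f, FQchar pib f /\ Fchar act f]].

End WeaklyQuasisymmetric.

Section Coinvariant.
Variables (C : numClosedFieldType) (n : nat).

(* <e_1, ..., e_n> *)
Definition coinv_ideal : {pred {mpoly C[n]}} := fun p =>
  `[< exists q : 'I_n -> {mpoly C[n]}, p = \sum_(k < n) q k * mesym n C k.+1 >].

Lemma coinv_idealP (p : {mpoly C[n]}) :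
  p \in coinv_ideal <->
  exists q : 'I_n -> {mpoly C[n]}, p = \sum_(k < n) q k * mesym n C k.+1.
Proof. by rewrite unfold_in; split=> /asboolP. Qed.

Lemma coinv_ideal_closed : idealr_closed coinv_ideal.
Proof.
split.
- by apply/coinv_idealP; exists (fun _ => 0); rewrite big1 // => k _; rewrite mul0r.
- apply/negP => /coinv_idealP[q /(congr1 (meval (fun=> 0)))].
  rewrite meval1 raddf_sum /= big1 => [/eqP|k _]; first by rewrite oner_eq0.
  rewrite mevalM /mesym raddf_sum /= big1 ?mulr0 // => h /eqP hk.
  have /set0Pn[i ih] : h != set0 by rewrite -card_gt0 hk.
  by rewrite rmorph_prod (bigD1 i) //= mevalXU mul0r.
- move=> a u v /coinv_idealP[q ->] /coinv_idealP[r ->].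
  apply/coinv_idealP; exists (fun k => a * q k + r k).
  by rewrite mulr_sumr -big_split; apply: eq_bigr => k _; rewrite mulrDl mulrA.
Qed.

HB.instance Definition _ := isIdealr.Build _ coinv_ideal coinv_ideal_closed.

Definition coinvariant : Type := {ideal_quot coinv_ideal}.
HB.instance Definition _ := GRing.ComNzRing.on coinvariant.

Definition coinv_proj (p : {mpoly C[n]}) : coinvariant :=
  \pi_({ideal_quot coinv_ideal})%qT p.

Definition coinv_repr (x : coinvariant) : {mpoly C[n]} :=
  generic_quotient.repr (x : {ideal_quot coinv_ideal}).

Lemma coinv_reprK : cancel coinv_repr coinv_proj.
Proof. exact: reprK. Qed.

Lemma coinv_projP p q : coinv_proj p = coinv_proj q <-> p - q \in coinv_ideal.
Proof. by rewrite Quotient.idealrBE; split=> /eqP. Qed.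

Lemma coinv_projB p q : coinv_proj (p - q) = coinv_proj p - coinv_proj q.
Proof. exact: (rmorphB \pi_({ideal_quot coinv_ideal})%qT). Qed.

Lemma coinv_projD p q : coinv_proj (p + q) = coinv_proj p + coinv_proj q.
Proof. exact: (rmorphD \pi_({ideal_quot coinv_ideal})%qT). Qed.

Lemma coinv_projM p q : coinv_proj (p * q) = coinv_proj p * coinv_proj q.
Proof. exact: (rmorphM \pi_({ideal_quot coinv_ideal})%qT). Qed.

Lemma coinv_proj1 : coinv_proj 1 = 1.
Proof. exact: (rmorph1 \pi_({ideal_quot coinv_ideal})%qT). Qed.

Definition coinv_scale (c : C) (x : coinvariant) : coinvariant :=
  coinv_proj c%:MP * x.

Lemma coinv_scaleA a b x :
  coinv_scale a (coinv_scale b x) = coinv_scale (a * b) x.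
Proof. by rewrite /coinv_scale mulrA -coinv_projM -mpolyCM. Qed.

Lemma coinv_scale1 : left_id 1 coinv_scale.
Proof. by move=> x; rewrite /coinv_scale coinv_proj1 mul1r. Qed.

Lemma coinv_scaleDr : right_distributive coinv_scale +%R.
Proof. by move=> a x y; rewrite /coinv_scale mulrDr. Qed.

Lemma coinv_scaleDl x : {morph coinv_scale^~ x : a b / a + b}.
Proof. by move=> a b; rewrite /coinv_scale mpolyCD coinv_projD mulrDl. Qed.

HB.instance Definition _ := GRing.Zmodule_isLmodule.Build C coinvariant
  coinv_scaleA coinv_scale1 coinv_scaleDr coinv_scaleDl.

Lemma coinv_projZ a p : coinv_proj (a *: p) = a *: coinv_proj p.
Proof. by rewrite -mul_mpolyC coinv_projM. Qed.

Definition coinv_act (s : 'S_n) (x : coinvariant) : coinvariant :=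
  coinv_proj (msym s (coinv_repr x)).

Lemma coinv_act_proj s p : coinv_act s (coinv_proj p) = coinv_proj (msym s p).
Proof.
apply/coinv_projP; rewrite -msymB.
have /coinv_projP/coinv_idealP[q ->] := coinv_reprK (coinv_proj p).
apply/coinv_idealP; exists (fun k => msym s (q k)).
rewrite raddf_sum; apply: eq_bigr => k _ /=.
by rewrite msymM; congr (_ * _); apply/issymP/mesym_sym.
Qed.

(* The exponents of the sub-staircase monomials; alpha_j < j in 1-indexed
   notation. *)
Definition staircase : finType := {dffun forall j : 'I_n, 'I_j.+1}.

Definition staircase_mnm (a : staircase) : 'X_{1..n} :=
  [multinom (a j : nat) | j < n].

Definition staircase_basis (a : staircase) : coinvariant :=
  coinv_proj 'X_[staircase_mnm a].

(* Lexicographic comparison of the exponents of 'X_0, 'X_1, ..., so that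
   'X_0 > 'X_1 > ... *)
Definition staircase_lex : rel staircase := fun a a' =>
  ((staircase_mnm a : seqlexi nat) <= (staircase_mnm a' : seqlexi nat))%O.

End Coinvariant.

(* Main.v *)
Require Import Defs.
From HB Require Import structures.
From mathcomp Require Import all_boot all_order all_fingroup all_algebra.
From mathcomp Require Import complex boolp reals mpoly.
From mathcomp Require Import ring zify.

Set Implicit Arguments.
Unset Strict Implicit.
Unset Printing Implicit Defensive.

Import Order.TTheory GRing.Theory Num.Theory.
Local Open Scope ring_scope.

(* Both characteristics are p_1^n = (x_1 + x_2 + ...)^n.

   Since h_(j+1)(x_j, x_(j+1), ...) = 0 in the coinvariant algebra (indices from
   0), every monomial reduces to sub-staircase monomials with the same prefix
   and degree. Evaluation at the orbit of (0, 1, ..., n - 1) is onto the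
   functions on S_n, and it factors through the sub-staircase monomials, because
   on the orbit the e_k are constants of lower degree; as there are n! of both,
   these monomials form a basis, and an averaged section identifies the
   coinvariant algebra with the regular representation.

   The relation above gives the leading term of s_i x^a when a_(i+1) is maximal,
   so that pib_i maps x^a to 0, - x^a or the monomial with a_i and a_(i+1)
   exchanged, according to the order of a_i and a_(i+1). Hence the relations, and
   the lexicographic filtration has the factors C_I with I the set of ascents of
   a. The sum of the F_I is p_1^n, by induction on n, refined by the last entries
   of a and of the word indexing the monomials of F_I.

   The sum over ballot words of length n of the Schur functions of their shapes
   is p_1^n by the Pieri rule, which follows from a count of the shapes that
   interlace with two given ones. The same count shows that there are n! pairs
   of ballot words with the same shape. James' argument embeds the
   direct sum of the Specht modules indexed by ballot words into the regular
   representation, and the polytabloids of standard tableaux show that its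
   dimension is at least n!. *)

(** * The 0-Hecke characteristic *)

(** Three facts shape the argument. The rules for [pib] must not conflict, so in the case a_(i+1) =
    i + 1 the leading term of s_i x^a is not enough: the coefficient of x^a itself is also needed,
    and its value -1 is what excludes the other two rules. Both coefficients come from one expansion
    with a free parameter k0.

    The coinvariant algebra is a quotient by homogeneous relations, whereas the functions on the
    orbit form a quotient by inhomogeneous ones. Degrees tie the two together: an element of the
    ideal agrees on the orbit with a polynomial of smaller degree, so the comparisons go by
    induction on the degree.

    The multiplicity of a Specht module in the regular representation is its number of standard
    tableaux, so indexing the summands by ballot words lists each of them with the right
    multiplicity. An injective map into the n!-dimensional space of functions on S_n and n!
    independent vectors at its source then suffice for an isomorphism. *)

Section Snoc.
Variables (K : finType) (m : nat).

Definition snoc (f : {ffun 'I_m -> K}) (z : K) : {ffun 'I_m.+1 -> K} :=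
  [ffun i => if unlift ord_max i is Some j then f j else z].

Lemma snoc_max f z : snoc f z ord_max = z.
Proof. by rewrite ffunE unlift_none. Qed.

Lemma snoc_lift f z j : snoc f z (lift ord_max j) = f j.
Proof. by rewrite ffunE liftK. Qed.

Lemma snoc_widen f z (i : 'I_m.+1) (j : 'I_m) : i = j :> nat ->
  snoc f z i = f j.
Proof.
move=> ij; rewrite -(snoc_lift f z); congr (snoc _ _ _).
by apply: ord_inj; rewrite ij lift_max.
Qed.

Lemma big_snoc (A : nmodType) (F : {ffun 'I_m.+1 -> K} -> A) :
  \sum_f F f = \sum_(f : {ffun 'I_m -> K}) \sum_z F (snoc f z).
Proof.
rewrite pair_big /= (reindex (fun p : {ffun 'I_m -> K} * K => snoc p.1 p.2))
  //=.
exists (fun f => ([ffun j => f (lift ord_max j)], f ord_max)) => [[f z] _|f _].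
  congr (_, _); last exact: snoc_max.
  by apply/ffunP=> j; rewrite ffunE snoc_lift.
apply/ffunP=> i; case: (unliftP ord_max i) => [j|] ->.
  by rewrite snoc_lift ffunE.
by rewrite snoc_max.
Qed.

Lemma prod_snoc (A : comPzRingType) (y : K -> A) f z :
  \prod_i y (snoc f z i) = (\prod_i y (f i)) * y z.
Proof.
rewrite big_ord_recr /= snoc_max; congr (_ * _).
by apply: eq_bigr => j _; rewrite (@snoc_widen _ _ _ j).
Qed.

End Snoc.

Section StaircaseSeries.
Variables (A : comNzRingType) (N : nat) (y : 'I_N -> A).

(** The words t index the monomials of F_I, for I the ascent set of the staircase code a. The values
    of a lie in a fixed ['I_K] instead of the dependent type [staircase n], so that codes can be
    shortened in an induction on n. *)
Definition code_compat (K n : nat) (a : {ffun 'I_n -> 'I_K})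
    (t : {ffun 'I_n -> 'I_N}) : bool :=
  [forall j, a j <= j]%N &&
  [forall j : 'I_n.-1, (t (left_pos j) <= t (right_pos j)) &&
    ((a (left_pos j) < a (right_pos j)) ==>
      (t (left_pos j) < t (right_pos j)))]%N.

Lemma code_compat_snoc K m (a : {ffun 'I_m.+1 -> 'I_K}) t k z :
  code_compat (snoc a k) (snoc t z) =
  [&& code_compat a t, k <= m.+1, t ord_max <= z
    & (a ord_max < k) ==> (t ord_max < z)]%N.
Proof.
apply/andP/and4P.
- case=> /forallP ha /forallP hc; split.
  + apply/andP; split; apply/forallP=> j.
      by have := ha (lift ord_max j); rewrite snoc_lift lift_max.
    have := hc (widen_ord (leqnSn _) j).
    rewrite (@snoc_widen _ _ t _ _ (left_pos j)) //
      (@snoc_widen _ _ t _ _ (right_pos j)) //.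
    by rewrite (@snoc_widen _ _ a _ _ (left_pos j)) //
      (@snoc_widen _ _ a _ _ (right_pos j)).
  + by have := ha ord_max; rewrite snoc_max.
  + have /andP[+ _] := hc ord_max.
    by rewrite (@snoc_widen _ _ t _ _ ord_max) // (_
      : right_pos _ = ord_max) ?snoc_max //; apply: val_inj.
  + have /andP[_] := hc ord_max.
    have -> : right_pos (ord_max : 'I_m.+2.-1) = ord_max by apply: val_inj.
    by rewrite !snoc_max (@snoc_widen _ _ t _ _ ord_max) //
      (@snoc_widen _ _ a _ _ ord_max).
- case=> /andP[/forallP ha /forallP hc] km tz az; split; apply/forallP=> j.
    case: (unliftP ord_max j) => [i|] ->; last by rewrite snoc_max.
    by rewrite snoc_lift lift_max.
  case: (ltnP j m) => jm; last first.
    have jE : j = m :> nat by apply/eqP; rewrite eqn_leq jm -ltnS (ltn_ord j).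
    have -> : right_pos (j : 'I_m.+2.-1) = ord_max by apply: val_inj;
      rewrite /= jE.
    by rewrite !snoc_max (@snoc_widen _ _ t _ _ ord_max) //
      (@snoc_widen _ _ a _ _ ord_max) // tz az.
  have := hc (Ordinal jm).
  rewrite (@snoc_widen _ _ t _ _ (left_pos (Ordinal jm : 'I_m.+1.-1))) //.
  rewrite (@snoc_widen _ _ t _ _ (right_pos (Ordinal jm : 'I_m.+1.-1))) //.
  rewrite (@snoc_widen _ _ a _ _ (left_pos (Ordinal jm : 'I_m.+1.-1))) //.
  by rewrite (@snoc_widen _ _ a _ _ (right_pos (Ordinal jm : 'I_m.+1.-1))).
Qed.

Definition code_sum (K n : nat) (Q : {ffun 'I_n -> 'I_K} ->
  {ffun 'I_n -> 'I_N} -> bool) : A :=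
  \sum_a \sum_(t | code_compat a t && Q a t) \prod_i y (t i).

Definition psum_lt (z : nat) : A := \sum_(i < N | (i < z)%N) y i.

Lemma psum_ltS (z : 'I_N) : psum_lt z.+1 = psum_lt z + y z.
Proof.
rewrite /psum_lt (bigD1 z) ?leqnn //= addrC; congr (_ + _).
by apply: eq_bigl => i; rewrite ltnS ltn_neqAle andbC.
Qed.

(** Used with p = [psum_lt z] and x = [y z], so that p + x = [psum_lt z.+1]: it sums the formula of
    [code_sum_last] over k. *)
Lemma geom_sum (x p : A) (m : nat) : 
  x * \sum_(i < m) (p + x) ^+ (m.-1 - i) * p ^+ i = (p + x) ^+ m - p ^+ m.
Proof. by rewrite subrXX [p + x]addrC addrK. Qed.

Lemma geom_sum_lt (x p : A) (m K : nat) : (m <= K)%N ->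
  x * \sum_(i < K | (i < m)%N) (p + x) ^+ (m.-1 - i) * p ^+ i =
    (p + x) ^+ m - p ^+ m.
Proof. by move=> mK; rewrite -geom_sum
  (big_ord_widen K (fun i => (p + x) ^+ (m.-1 - i) * p ^+ i)). Qed.


Lemma psum_lt_telescope (z : nat) (m : nat) : (z <= N)%N ->
  \sum_(i < N | (i < z)%N) (psum_lt i.+1 ^+ m.+1 - psum_lt i ^+ m.+1) =
    psum_lt z ^+ m.+1.
Proof.
move=> zN; rewrite -(big_ord_widen N (fun i =>
  psum_lt i.+1 ^+ m.+1 - psum_lt i ^+ m.+1)) //.
rewrite -(big_mkord xpredT (fun i => psum_lt i.+1 ^+ m.+1 - psum_lt i ^+ m.+1)).
by rewrite telescope_sumr // {2}/psum_lt big_pred0 ?expr0n ?subr0.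
Qed.

Lemma code_sum_split K m (Q : 'I_K -> 'I_N -> bool) :
  code_sum (n := m.+1) (fun a t => Q (a ord_max) (t ord_max)) =
  \sum_k \sum_(z | Q k z) code_sum (n := m.+1) (fun a t =>
    (a ord_max == k) && (t ord_max == z)).
Proof.
rewrite /code_sum (partition_big (fun a : {ffun 'I_m.+1 -> 'I_K} =>
  a ord_max) xpredT) //=.
apply: eq_bigr => k _; rewrite [RHS]exchange_big /= big_mkcond;
  apply: eq_bigr => a _.
case: eqP => [->|_]; last by rewrite big1 // => z _; rewrite big1 // =>
  t /andP[].
rewrite (partition_big (fun t : {ffun 'I_m.+1 -> 'I_N} => t ord_max) (Q k)) /=;
  last by move=> t /andP[].
apply: eq_bigr => z Qz; apply: eq_bigl => t; rewrite -!andbA.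
by case: (t ord_max =P z) => [->|]; rewrite ?andbF // Qz.
Qed.

(* The right hand side enumerates the words of length m + 1 with largest letter
   z whose last z is followed by k letters. *)
Lemma code_sum_last K m (k : 'I_K) (z : 'I_N) : (m < K)%N ->
  code_sum (n := m.+1) (fun a t => (a ord_max == k) && (t ord_max == z)) =
  if (k <= m)%N then y z * (psum_lt z.+1 ^+ (m - k) * psum_lt z ^+ k) else 0.
Proof.
elim: m k z => [|m IHm] k z mK.
  rewrite /code_sum big_snoc /= (bigD1 [ffun=> k]) //= [X in _ + X]big1 ?addr0;
    last first.
    by move=> a /eqP[]; apply/ffunP=> - [].
  rewrite (bigD1 k) //= [X in _ + X]big1 ?addr0; last first.
    by move=> k' /negPf nk; rewrite big1 // => t; rewrite snoc_max nk andbF.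
  rewrite big_mkcond big_snoc /= (bigD1 [ffun=> z]) //= [X in _ + X]big1 ?addr0;
    last first.
    by move=> a /eqP[]; apply/ffunP=> - [].
  rewrite (bigD1 z) //= [X in _ + X]big1 ?addr0; last first.
    by move=> z' /negPf nz; rewrite !snoc_max nz !andbF.
  rewrite !snoc_max !eqxx !andbT big_ord1.
  have -> : code_compat (n := 1) (snoc [ffun=> k] k) (snoc [ffun=> z] z) =
    (k <= 0)%N.
    rewrite /code_compat; apply/andP/idP => [[/forallP/(_ ord_max)]|k0]; first
      by rewrite snoc_max.
    split; apply/forallP=> - [] // [] // i; set l := Ordinal i.
    by rewrite (_ : l = ord_max) ?snoc_max //; apply: val_inj.
  have -> : snoc (m := 0) [ffun=> z] z ord0 = z.
    by rewrite (_ : ord0 = ord_max) ?snoc_max //; apply: val_inj.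
  by case: ifP => //; rewrite leqn0 => /eqP ->; rewrite !expr0 !mulr1.
(* The last entries k and z are removed; what remains is a condition on the last entries of the
   shorter pair. *)
transitivity (if (k <= m.+1)%N then y z * code_sum (n := m.+1) (K :=
  K) (fun a t => (t ord_max <= z)%N &&
  ((a ord_max < k)%N ==> (t ord_max < z)%N)) else 0).
  rewrite /code_sum big_snoc /=.
  transitivity (\sum_(a : {ffun 'I_m.+1 -> 'I_K}) \sum_(t
    : {ffun 'I_m.+1 -> 'I_N} | code_compat (snoc a k) (snoc t z)) \prod_i y
    (snoc t z i)).
    apply: eq_bigr => a _; rewrite (bigD1 k) //= [X in _ + X]big1 ?addr0;
      last first.
      by move=> k' /negPf nk; rewrite big1 // => t; rewrite snoc_max nk andbF.
    rewrite big_mkcond big_snoc [RHS]big_mkcond /=; apply: eq_bigr => t _.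
    rewrite (bigD1 z) //= [X in _ + X]big1 ?addr0; last first.
      by move=> z' /negPf nz; rewrite !snoc_max nz !andbF.
    by rewrite !snoc_max !eqxx !andbT.
  case: ifP => km; last first.
    by apply: big1 => a _; apply: big1 => t; rewrite code_compat_snoc km andbF.
  rewrite big_distrr; apply: eq_bigr => a _ /=; rewrite big_distrr /=.
  apply: eq_big => [t|t _]; first by rewrite code_compat_snoc km.
  by rewrite prod_snoc mulrC.
case: ifP => // km; congr (_ * _).
rewrite (@code_sum_split K m (fun k' z' =>
  (z' <= z)%N && ((k' < k)%N ==> (z' < z)%N))).
rewrite (exchange_big_dep (fun z' : 'I_N => (z' <= z)%N)) /=; last
  by move=> ? ? _ /andP[].
pose G (k' : nat) (z' : 'I_N) :=
  y z' * (psum_lt z'.+1 ^+ (m - k') * psum_lt z' ^+ k').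
have Gsum z' j : (j <= m.+1)%N -> \sum_(k' < K | (k' < j)%N) G k' z' =
    psum_lt z'.+1 ^+ (m.+1 - j) * (psum_lt z'.+1 ^+ j - psum_lt z' ^+ j).
  move=> jm; rewrite psum_ltS -(@geom_sum_lt _ _ _ K) ?(leq_trans jm (ltnW mK))
    //.
  rewrite mulrCA !big_distrr /=; apply: eq_bigr => k' k'j; rewrite /G psum_ltS.
  by rewrite !mulrA; congr (_ * _); rewrite -mulrA -exprD; congr (_ * _ ^+ _);
    lia.
(* A last letter z' < z admits every k', whereas z' = z requires k' >= k. The differences for z' < z
   telescope, and z itself gives the full geometric sum minus its part below k. *)
rewrite (bigD1 z) ?leqnn //= addrC.
transitivity (\sum_(z' < N | (z' < z)%N)
  (psum_lt z'.+1 ^+ m.+1 - psum_lt z' ^+ m.+1) +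
   (psum_lt z.+1 ^+ (m.+1 - k) * psum_lt z ^+ k - psum_lt z ^+ m.+1)).
  congr (_ + _).
    apply: eq_big => z'; first by rewrite ltn_neqAle andbC.
    rewrite andbC => z'z; have {}z'z : (z' < z)%N by rewrite ltn_neqAle.
    rewrite -[RHS]mul1r -(expr0 (psum_lt z'.+1)) -{1}(subnn m.+1) -Gsum //.
    rewrite [RHS]big_mkcond; apply: eq_big => [k'|k' _].
      by rewrite (ltnW z'z) z'z implybT.
    by rewrite IHm ?(ltnW mK).
  have := Gsum z m.+1 (leqnn _); rewrite subnn expr0 mul1r => tot.
  have := Gsum z k km; rewrite mulrBr -exprD subnK // => lo.
  rewrite -[_ - _]/(_ + _) [in RHS]addrC.
  have -> : - psum_lt z ^+ m.+1 + psum_lt z.+1 ^+ (m.+1 - k) * psum_lt z ^+ k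
     = \sum_(k' < K | (k' < m.+1)%N) G k' z - \sum_(k' < K | (k' < k)%N) G k' z.
    by rewrite tot lo; ring.
  rewrite [X in X - _](bigID (fun k' : 'I_K => (k' < k)%N)) /=.
  have -> : \sum_(k' < K | (k' < m.+1)%N && (k' < k)%N) G k' z =
    \sum_(k' < K | (k' < k)%N) G k' z.
    by apply: eq_bigl => k'; apply/andP/idP => [[]//|k'k]; split=> //;
      apply: leq_trans km.
  rewrite [RHS]addrC addKr big_mkcond [RHS]big_mkcond; apply: eq_bigr => k' _.
  by rewrite ?leqnn ltnn /= implybF ltnS IHm ?(ltnW mK) //; case: (k' < k)%N =>
    //=; case: (k' <= m)%N.
by rewrite psum_lt_telescope 1?ltnW //; ring.
Qed.

(** By [code_sum_last] the sum over k is geometric and gives [psum_lt z.+1 ^+ n - psum_lt z ^+ n],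
    which telescopes over z. The empty word has no last letter and is treated apart. *)
Lemma code_sum_total K n : (n <= K)%N ->
  \sum_(a : {ffun 'I_n -> 'I_K}) \sum_(t | code_compat a t) \prod_i y (t i) =
    (\sum_z y z) ^+ n.
Proof.
case: n => [|m] mK.
  have e (L : finType) (f : {ffun 'I_0 -> L}) g : f = g by apply/ffunP => - [].
  have fz L : {ffun 'I_0 -> L} by apply: finfun => - [].
  rewrite (bigD1 (fz _)) //= [X in _ + X]big1 ?addr0 => [|a /eqP[]];
    last exact: e.
  rewrite (bigD1 (fz _)) ?big_ord0 /=; last by apply/andP; split;
    apply/forallP=> - [].
  by rewrite big1 ?addr0 // => t /andP[_ /eqP[]]; apply: e.
transitivity (code_sum (n := m.+1) (K := K) (fun a t => xpredT (t ord_max))).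
  by apply: eq_bigr => a _; apply: eq_bigl => t; rewrite andbT.
rewrite (@code_sum_split K m (fun _ _ => true)) exchange_big /=.
have -> : \sum_z y z = psum_lt N by apply: eq_bigl => i; rewrite ltn_ord.
rewrite -psum_lt_telescope // [RHS]big_mkcond; apply: eq_bigr => z _;
  rewrite ltn_ord.
rewrite psum_ltS -(@geom_sum_lt _ _ _ K) // big_distrr big_mkcond
  [RHS]big_mkcond /=.
by apply: eq_bigr => k _; rewrite code_sum_last // psum_ltS ltnS.
Qed.

End StaircaseSeries.

Definition ascents (n : nat) (a : staircase n) : {set 'I_n.-1} :=
  [set i | a (left_pos i) < a (right_pos i)]%N.

Lemma sum_fund_qsym_ascents n N :
  \sum_(a : staircase n) fund_qsym (ascents a) N = (\sum_(z < N) 'X_z) ^+ n.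
Proof.
rewrite -(@code_sum_total {mpoly int[N]} N (fun z => 'X_z) n n) //.
rewrite [RHS](bigID (fun a : {ffun 'I_n -> 'I_n} => [forall j, a j <= j]%N)) /=
  [X in _ + X]big1 ?addr0; last first.
  by move=> a /negPf na; apply: big1 => t; rewrite /code_compat na.
(* [h] and [h'] pass between the dependent and the uniform encoding of staircase codes; [inord] is
   exact on codes with a j <= j. *)
pose h (a : staircase n) : {ffun 'I_n -> 'I_n} :=
  [ffun j => widen_ord (ltn_ord j) (a j)].
pose h' (f : {ffun 'I_n -> 'I_n}) : staircase n :=
  [ffun j : 'I_n => (inord (f j) : 'I_j.+1)].
rewrite (reindex_onto h h') /=; last first.
  move=> a /forallP ha; apply/ffunP=> j; apply: val_inj.
  by rewrite ffunE /= ffunE inordK // ltnS.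
apply: eq_big => [a|a _].
  apply/esym/andP; split; first by apply/forallP=> j; rewrite ffunE /= -ltnS.
  by apply/eqP/ffunP=> j; apply: val_inj; rewrite ffunE /= ffunE /= inordK.
rewrite /fund_qsym; apply: eq_bigl => t.
have -> : code_compat (h a) t = [forall j : 'I_n.-1,
  (t (left_pos j) <= t (right_pos j)) &&
    ((a (left_pos j) < a (right_pos j)) ==>
      (t (left_pos j) < t (right_pos j)))]%N.
  rewrite /code_compat; have -> /= : [forall j, h a j <= j]%N.
    by apply/forallP=> j; rewrite ffunE /= -ltnS.
  by apply: eq_forallb => j;
    rewrite [h a (left_pos j)]ffunE [h a (right_pos j)]ffunE.
apply/andP/forallP => [[/forallP h1 /forallP h2] j|H].
  by rewrite h1 /=; apply/implyP=> aj; have := h2 j; rewrite inE aj.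
split; apply/forallP=> j; have /andP[//] := H j.
by move=> _; rewrite inE.
Qed.

(** * Interlacing shapes, ballot words and the Pieri rule *)

Section Interlacing.
Variable n : nat.
Implicit Types f g : 'I_n -> nat.

Definition antitone f : bool :=
  [forall i : 'I_n, forall j : 'I_n, (i <= j)%N ==> (f j <= f i)%N].

(** The skew shape g / f is a horizontal strip. Comparing all rows i < j instead of consecutive ones
    avoids successors in ['I_n]. *)
Definition interlaces f g : bool :=
  [forall i, (f i <= g i)%N] &&
  [forall i : 'I_n, forall j : 'I_n, (i < j)%N ==> (g j <= f i)%N].

Lemma antitoneP f : reflect (forall i j : 'I_n, (i <= j)%N ->
  (f j <= f i)%N) (antitone f).
Proof.
apply: (iffP forallP) => [H i j|H i]; first exact/implyP/(forallP (H i)).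
by apply/forallP => j; apply/implyP/H.
Qed.

Lemma interlacesP f g :
  reflect ((forall i, (f i <= g i)%N) /\
           (forall i j : 'I_n, (i < j)%N -> (g j <= f i)%N)) (interlaces f g).
Proof.
apply: (iffP andP) => [[/forallP h1 /forallP h2]|[h1 h2]]; split => //.
- by move=> i j; apply/implyP/(forallP (h2 i)).
- exact/forallP.
- by apply/forallP=> i; apply/forallP=> j; apply/implyP/h2.
Qed.

Lemma eq_interlaces f f' g g' : f =1 f' -> g =1 g' ->
  interlaces f g = interlaces f' g'.
Proof.
move=> ff gg; apply/interlacesP/interlacesP => -[h1 h2]; split=> *.
- by rewrite -ff -gg.
- by rewrite -ff -gg h2.
- by rewrite ff gg.
- by rewrite ff gg h2.
Qed.

Lemma interlaces_antitone f g : interlaces f g -> antitone f /\ antitone g.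
Proof.
case/interlacesP=> h1 h2; split; apply/antitoneP => i j; rewrite leq_eqVlt =>
  /orP[/eqP/val_inj->//|ij].
  exact: leq_trans (h1 j) (h2 _ _ ij).
exact: leq_trans (h2 _ _ ij) (h1 i).
Qed.

End Interlacing.

(* If nu interlaces mu, adding a box to row i + 1 of mu is allowed exactly when
   removing one from row i of nu is, and row 0 accounts for the extra term;
   otherwise both operations are allowed for the same row. *)
Lemma count_interlacing n (nu mu : 'I_n -> nat) :
  antitone nu -> antitone mu -> (\sum_i mu i < n)%N ->
  (\sum_i interlaces nu (fun j => mu j + (j == i)) =
   interlaces nu mu + \sum_i ((0 < nu i)
     && interlaces (fun j => nu j - (j == i)) mu))%N.
Proof.
case: n nu mu => // n nu mu /antitoneP anu /antitoneP amu wmu.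
(* Fewer boxes than rows leave the last row empty. Hence an interlacing nu has no box in its last
   row, and the rows i + 1 of mu and i of nu match exactly. *)
have mumax : mu ord_max = 0%N.
  apply/eqP; rewrite -leqn0 -ltnS -(ltn_pmul2l (ltn0Sn n)) muln1.
  apply: leq_ltn_trans wmu; rewrite -{1}(card_ord n.+1) -sum_nat_const.
  by apply: leq_sum => i _; apply: amu; rewrite -ltnS.
case: (boolP (interlaces nu mu)) => [/interlacesP[h1 h2]|ni].
  rewrite big_ord_recl [in RHS]big_ord_recr /=.
  have -> : interlaces nu (fun j => mu j + (j == ord0))%N.
    apply/interlacesP; split=> [i|i j ij];
      first exact: leq_trans (leq_addr _ _).
    by rewrite (_ : j == ord0 = false) ?addn0 ?h2 //; apply/negP => /eqP jE;
      rewrite jE in ij.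
  have -> : (0 < nu ord_max)%N = false.
    by apply/negP => lt0; have := leq_trans lt0 (h1 _); rewrite mumax.
  rewrite addn0; congr (_ + _)%N; apply: eq_bigr => i _; congr nat_of_bool.
  set k := lift ord0 i; set l := widen_ord (leqnSn n) i.
  have lk : (l < k)%N by rewrite /= /bump /=.
  have leqk (a : 'I_n.+1) : (a < k)%N -> (a <= l)%N by rewrite /= /bump /=.
  apply/interlacesP/andP => [[g1 g2]|[nul /interlacesP[g1 g2]]].
    have mk : (mu k < nu l)%N by have := g2 l k lk; rewrite eqxx addn1.
    split; first exact: leq_ltn_trans mk.
    apply/interlacesP; split=> [j|a b ab];
      first exact: leq_trans (leq_subr _ _) _.
    case: eqP => [aE|_]; last by rewrite subn0 h2.
    have kb : (k <= b)%N by move: ab; rewrite aE /= /bump /=.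
    by rewrite aE; have := amu _ _ kb; lia.
  have mk : (mu k < nu l)%N by have := g2 l k lk; rewrite eqxx; lia.
  split=> [j|a b ab]; first exact: leq_trans (leq_addr _ _).
  case: eqP => [bE|_]; last by rewrite addn0 h2.
  have al : (a <= l)%N by apply: leqk; rewrite -bE.
  by rewrite bE addn1; apply: leq_trans (anu _ _ al).
rewrite add0n; apply: eq_bigr => i _; congr nat_of_bool.
apply/interlacesP/andP => [[g1 g2]|[nul /interlacesP[g1 g2]]].
  (* The condition nu_i <= mu_i is the only one that a box in row i can repair; if it held, nu would
     already interlace mu. *)
  have nui : nu i = (mu i).+1.
    apply/eqP; rewrite eqn_leq -{1}addn1 -{1}[1%N]/(nat_of_bool true)
      -{1}(eqxx i) g1 /= ltnNge.
    apply/negP => nui; case/negP: ni; apply/interlacesP; split=> [j|a b ab].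
      by have := g1 j; case: eqP => [->//|_]; rewrite addn0.
    exact: leq_trans (leq_addr _ _) (g2 _ _ ab).
  rewrite nui; split=> //; apply/interlacesP; split=> [j|a b ab].
    by have := g1 j; case: eqP => [->|_]; lia.
  case: eqP => [aE|_]; first by rewrite aE nui subn1 amu // -aE ltnW.
  by rewrite subn0; apply: leq_trans (leq_addr _ _) (g2 _ _ ab).
have nui : nu i = (mu i).+1.
  apply/eqP; rewrite eqn_leq; have := g1 i; rewrite eqxx => g1i; apply/andP;
    split; first lia.
  rewrite ltnNge; apply/negP => nui; case/negP: ni; apply/interlacesP;
    split=> [j|a b ab].
    by have := g1 j; case: eqP => [->//|_]; rewrite subn0.
  exact: leq_trans (g2 _ _ ab) (leq_subr _ _).
split=> [j|a b ab].
  by have := g1 j; case: eqP => [->|_]; lia.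
case: eqP => [bE|_]; first by rewrite bE addn1 -nui anu // -bE ltnW.
by rewrite addn0; apply: leq_trans (g2 _ _ ab) (leq_subr _ _).
Qed.

(** * Partitions as functions and chains of horizontal strips *)

Section Shapes.
Variable n : nat.

Local Notation shape := {ffun 'I_n -> 'I_n.+1}.
Implicit Types (la mu nu rho : shape) (i j : 'I_n).

Definition size_shape la : nat := \sum_i la i.

(** For shapes of size less than n no row overflows [inord]. *)
Definition add_box la i : shape := [ffun j => inord (la j + (j == i))].

Definition partn la : bool := antitone (fun i => la i : nat).

Definition strip nu la : bool := interlaces (fun i => nu i : nat) (fun i => la i
  : nat).

Lemma size_shape_ge la i : (la i <= size_shape la)%N.
Proof. by rewrite /size_shape (bigD1 i) //= leq_addr. Qed.

Lemma add_boxE la i j : (size_shape la < n)%N ->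
  add_box la i j = (la j + (j == i))%N :> nat.
Proof.
move=> lan; rewrite ffunE inordK // ltnS.
by have := size_shape_ge la j; case: eqP => _; lia.
Qed.

Lemma size_add_box la i : (size_shape la < n)%N ->
  size_shape (add_box la i) = (size_shape la).+1.
Proof.
move=> lan; rewrite /size_shape (eq_bigr _ (fun j _ => add_boxE i j lan))
  big_split /=.
have -> : (\sum_(j < n) (j == i) = 1)%N by rewrite (bigD1 i) //= eqxx big1 // =>
  j /negPf ->.
by rewrite addn1.
Qed.

Lemma strip_size nu la : strip nu la -> (size_shape nu <= size_shape la)%N.
Proof. by case/interlacesP=> h _; apply: leq_sum. Qed.

(** The weighted form of [count_interlacing], that is, the commutation relation between adding a box
    and removing a horizontal strip; F records the inner shape and the size of the strip. The shapes
    nu from which a box can be removed are reindexed by rho, nu being rho plus that box. *)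
Lemma sum_strip_add (A : comNzRingType) mu (F : shape -> nat -> A) :
  partn mu -> (size_shape mu < n)%N ->
  \sum_i \sum_(nu | strip nu (add_box mu i)) F nu
    ((size_shape mu).+1 - size_shape nu)%N =
  \sum_(nu | strip nu mu) F nu (size_shape mu - size_shape nu).+1 +
  \sum_(rho | strip rho mu) \sum_(j | partn (add_box rho j))
     F (add_box rho j) (size_shape mu - size_shape rho)%N.
Proof.
move=> pmu wmu.
pose G nu := F nu ((size_shape mu).+1 - size_shape nu)%N.
pose rem nu j := fun k => (nu k - (k == j))%N.
transitivity (\sum_(nu | partn nu) G nu *+
  (\sum_i interlaces (fun j => nu j : nat) (fun j => mu j + (j == i)))%N).
  rewrite (exchange_big_dep partn) /=; last first.
    by move=> i nu _ /interlaces_antitone[].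
  apply: eq_bigr => nu pnu; rewrite big_mkcond /= -sumrMnr; apply: eq_bigr =>
    i _.
  rewrite /strip (@eq_interlaces _ _ (fun j => nu j) _ (fun j =>
    mu j + (j == i)))%N //; last first.
    by move=> j; rewrite add_boxE.
  by case: interlaces.
transitivity (\sum_(nu | partn nu) (G nu *+ (strip nu mu) +
   \sum_j G nu *+ ((0 < nu j)%N && interlaces (rem nu j) (fun k => mu k
     : nat)))).
  by apply: eq_bigr => nu pnu; rewrite count_interlacing // mulrnDr sumrMnr.
rewrite big_split /=; congr (_ + _).
  rewrite big_mkcond [RHS]big_mkcond; apply: eq_bigr => nu _; rewrite /strip.
  case: (boolP (interlaces (fun i => nu i : nat) (fun i => mu i : nat))) =>
    [h|_]; last by rewrite mulr0n if_same.
  by have [pn _] := interlaces_antitone h;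
    rewrite /partn pn /G subSn ?strip_size.
rewrite exchange_big [RHS](exchange_big_dep xpredT) //=; apply: eq_bigr => j _.
pose rem_box nu : shape := [ffun k => inord (rem nu j k)].
have rem_boxE nu k : rem_box nu k = rem nu j k :> nat.
  by rewrite ffunE inordK // /rem; have := ltn_ord (nu k); lia.
transitivity (\sum_(nu | partn nu && ((0 < nu j)%N
  && interlaces (rem nu j) (fun k => mu k : nat))) G nu).
  by rewrite big_mkcondr; apply: eq_bigr => nu _; case: ifP.
rewrite (reindex_onto (fun rho => add_box rho j) rem_box) /=; last first.
  move=> nu /and3P[pnu nuj h]; apply/ffunP=> k; apply: val_inj.
  rewrite /= ffunE rem_boxE /rem inordK; first by case: eqP => [->|_]; lia.
  by have := ltn_ord (nu k); case: eqP => [->|_]; lia.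
have small rho : strip rho mu -> (size_shape rho < n)%N.
  by move=> h; apply: leq_ltn_trans (strip_size h) wmu.
have remK rho : strip rho mu -> rem (add_box rho j) j =1 (fun k => rho k).
  by move=> h k; rewrite /rem add_boxE ?small // addnK.
apply: eq_big => [rho|rho].
  apply/andP/andP => [[/and3P[pr r0 h] /eqP e]|[h pr]].
    split=> //; rewrite /strip (eq_interlaces (f' :=
      rem (add_box rho j) j) (g' := fun k => mu k)) // => k.
    by rewrite -rem_boxE e.
  split; last by apply/eqP/ffunP=> k; apply: val_inj; rewrite /= rem_boxE remK.
  rewrite pr add_boxE ?small // eqxx addn1 /=.
  by rewrite (eq_interlaces (remK _ h) (fun k => erefl (mu k : nat))).
case/andP=> /and3P[pr r0 h] /eqP e.
have hs : strip rho mu.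
  rewrite /strip (eq_interlaces (f' := rem (add_box rho j) j) (g' := fun k =>
    mu k)) // => k.
  by rewrite -rem_boxE e.
by rewrite /G size_add_box ?small // subSS.
Qed.

Section ChainSums.
Variables (A : comNzRingType) (wt : nat -> nat -> A).

(* Sums over the chains of N horizontal strips from the empty shape to la: with
   wt k d = y_k ^+ d they are Schur polynomials, with wt k d = (d == 1) they
   count standard tableaux. *)
Fixpoint chain_sum (N : nat) (la : shape) : A :=
  if N is N'.+1 then
    \sum_(nu | strip nu la) chain_sum N' nu * wt N'
      (size_shape la - size_shape nu)%N
  else (size_shape la == 0)%:R.

Lemma sum_chain_sum_add N mu : partn mu -> (size_shape mu < n)%N ->
  \sum_(i | partn (add_box mu i)) chain_sum N.+1 (add_box mu i) =
  \sum_(nu | strip nu mu) chain_sum N nu * wt N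
    (size_shape mu - size_shape nu).+1 +
  \sum_(rho | strip rho mu) (\sum_(j | partn (add_box rho j)) chain_sum N
    (add_box rho j)) *
     wt N (size_shape mu - size_shape rho).
Proof.
move=> pmu wmu.
have := sum_strip_add (fun nu d => chain_sum N nu * wt N d) pmu wmu.
under [X in _ = _ + X -> _]eq_bigr => rho _ do rewrite -mulr_suml.
move <-; rewrite big_mkcond; apply: eq_bigr => i _;
  rewrite [chain_sum _ _]/= size_add_box //.
case: ifP => // /negP np; rewrite big1 // => nu h; case: np.
by have [] := interlaces_antitone h.
Qed.

Lemma sum_chain_sum0 mu : (size_shape mu < n)%N ->
  \sum_(i | partn (add_box mu i)) chain_sum 0 (add_box mu i) = 0.
Proof. by move=> wmu; apply: big1 => i _; rewrite /chain_sum size_add_box. Qed.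

End ChainSums.

Lemma strip_partn nu la : strip nu la -> partn nu.
Proof. by case/interlaces_antitone. Qed.

(** In [sum_chain_sum_add] the strips of the first sum are one box longer, which gives the factor
    y_N; the second sum contains the same problem with one variable less. *)
Lemma pieri (A : comNzRingType) (y : nat -> A) N mu : partn mu ->
  (size_shape mu < n)%N ->
  \sum_(i | partn (add_box mu i)) chain_sum (fun k d =>
    y k ^+ d) N (add_box mu i) =
  (\sum_(k < N) y k) * chain_sum (fun k d => y k ^+ d) N mu.
Proof.
elim: N mu => [|N IHN] mu pmu wmu; first
  by rewrite sum_chain_sum0 // big_ord0 mul0r.
rewrite sum_chain_sum_add // big_ord_recr /= mulrDl addrC !big_distrr /=.
congr (_ + _); apply: eq_bigr => nu h; last by rewrite exprS mulrCA.
rewrite IHN ?mulrA //; first exact: strip_partn h.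
exact: leq_ltn_trans (strip_size h) wmu.
Qed.

Definition box_wt (A : comNzRingType) (_ d : nat) : A := (d == 1)%:R.

Lemma strip_eq_size nu mu : strip nu mu -> size_shape mu = size_shape nu ->
  nu = mu.
Proof.
case/interlacesP=> h1 _ /eqP; rewrite eq_sym.
have [_ ->] := leqif_sum (fun i (_ : predT i) => leqif_eq (h1 i)).
by move=> /forallP e; apply/ffunP=> i; apply/val_inj/eqP/e.
Qed.

(** For N = |mu| this is the relation (N + 1) f^mu = sum of f^la over the shapes la covering mu,
    between numbers of standard tableaux. The weights [box_wt] reduce the first sum of
    [sum_chain_sum_add] to nu = mu, so that each step of the induction adds 1 to the factor. *)
Lemma sum_box_chains_add (A : comNzRingType) N mu : partn mu ->
  (size_shape mu < n)%N ->
  \sum_(i | partn (add_box mu i)) chain_sum (@box_wt A) N.+1 (add_box mu i) =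
  N.+1%:R * chain_sum (@box_wt A) N mu.
Proof.
have refl mu' : partn mu' -> strip mu' mu'.
  by move=> /antitoneP pm; apply/interlacesP; split=> // i j ij;
    rewrite pm // ltnW.
have diag N' mu' : partn mu' ->
  \sum_(nu | strip nu mu') chain_sum (@box_wt A) N' nu *
   box_wt A N' (size_shape mu' - size_shape nu).+1 =
     chain_sum (@box_wt A) N' mu'.
  move=> pm; rewrite (bigD1 mu') ?refl //= subnn mulr1 big1 ?addr0 // =>
    nu /andP[h nm].
  rewrite /box_wt eqSS subn_eq0; case: leqP => h2; last by rewrite mulr0.
  case/eqP: nm; by apply: (strip_eq_size h); apply/eqP;
    rewrite eqn_leq h2 strip_size.
elim: N mu => [|N IHN] mu pmu wmu; rewrite sum_chain_sum_add // diag //.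
  rewrite big1 ?addr0 ?mul1r // => nu h; rewrite sum_chain_sum0 ?mul0r //.
  exact: leq_ltn_trans (strip_size h) wmu.
rewrite -[N.+2%:R]natr1 mulrDl mul1r addrC; congr (_ + _);
  rewrite /= big_distrr /=.
apply: eq_bigr => nu h; rewrite IHN ?mulrA //; first exact: strip_partn h.
exact: leq_ltn_trans (strip_size h) wmu.
Qed.

(** * Ballot words as standard tableaux *)

Section Ballot.
Implicit Types (m : nat).

Definition count_lt m (w : {ffun 'I_m -> 'I_n}) (k : nat) (i : 'I_n) : nat :=
  \sum_(l < m | (l < k)%N) (w l == i).

Definition ballot m (w : {ffun 'I_m -> 'I_n}) : bool :=
  [forall k : 'I_m.+1, antitone (count_lt w k)].

Definition content m (w : {ffun 'I_m -> 'I_n}) : shape :=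
  [ffun i => inord (count_lt w m i)].

Lemma count_lt_le m (w : {ffun 'I_m -> 'I_n}) k i : (count_lt w k i <= m)%N.
Proof.
rewrite /count_lt big_mkcond /= -[X in (_ <= X)%N](card_ord m) -sum1_card;
  apply: leq_sum => l _.
by case: ifP => // _; case: (_ == _).
Qed.

Lemma contentE m (w : {ffun 'I_m -> 'I_n}) i : (m <= n)%N ->
  content w i = count_lt w m i :> nat.
Proof. by move=> mn; rewrite ffunE inordK // ltnS (leq_trans _ mn) ?count_lt_le.
  Qed.

Lemma size_content m (w : {ffun 'I_m -> 'I_n}) : (m <= n)%N ->
  size_shape (content w) = m.
Proof.
move=> mn; rewrite /size_shape (eq_bigr (count_lt w m)) => [|i _];
  last exact: contentE.
rewrite /count_lt exchange_big /= -[RHS](card_ord m) -sum1_card.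
apply: eq_big => l; first by rewrite ltn_ord.
by move=> _; rewrite (bigD1 (w l)) //= eqxx big1 // => i; rewrite eq_sym =>
  /negPf ->.
Qed.

Lemma count_lt_snoc m (w : {ffun 'I_m -> 'I_n}) z k i : (k <= m)%N ->
  count_lt (snoc w z) k i = count_lt w k i.
Proof.
move=> km; rewrite /count_lt big_mkcond big_ord_recr /= [(m < k)%N]ltnNge km
  addn0 -big_mkcond /=.
by apply: eq_bigr => l _; rewrite (@snoc_widen _ _ _ _ _ l).
Qed.

Lemma count_lt_snoc_max m (w : {ffun 'I_m -> 'I_n}) z i :
  count_lt (snoc w z) m.+1 i = (count_lt w m i + (i == z))%N.
Proof.
rewrite /count_lt big_mkcond big_ord_recr /= snoc_max ltnSn eq_sym;
  congr (_ + _)%N.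
rewrite [RHS]big_mkcond; apply: eq_bigr => l _.
by rewrite ltn_ord ltnS ltnW // (@snoc_widen _ _ _ _ _ l).
Qed.

Lemma content_snoc m (w : {ffun 'I_m -> 'I_n}) z : (m < n)%N ->
  content (snoc w z) = add_box (content w) z.
Proof.
move=> mn; apply/ffunP=> i; apply: val_inj.
rewrite /= contentE // add_boxE ?size_content ?(ltnW mn) // contentE ?(ltnW mn)
  //.
by rewrite count_lt_snoc_max.
Qed.

Lemma ballot_partn m (w : {ffun 'I_m -> 'I_n}) : (m <= n)%N -> ballot w ->
  partn (content w).
Proof.
move=> mn /forallP/(_ ord_max)/antitoneP h; apply/antitoneP => i j ij.
by rewrite !contentE // h.
Qed.

Lemma ballot_snoc m (w : {ffun 'I_m -> 'I_n}) z : (m < n)%N ->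
  ballot (snoc w z) = ballot w && partn (add_box (content w) z).
Proof.
move=> mn; rewrite -content_snoc //; apply/idP/andP => [b|[/forallP b p]].
  split; last exact: ballot_partn b.
  apply/forallP=> k; apply/antitoneP=> i j ij.
  have /forallP/(_ (widen_ord (leqnSn _) k))/antitoneP/(_ i j ij) := b.
  have km : (k <= m)%N by rewrite -ltnS.
  by rewrite !(count_lt_snoc w z _ km).
apply/forallP=> k; apply/antitoneP=> i j ij.
have [km|km] := leqP k m.
  rewrite !count_lt_snoc //; have := b (Ordinal (km : (k < m.+1)%N)).
  by move/antitoneP/(_ i j ij).
have -> : k = m.+1 :> nat by apply/eqP; rewrite eqn_leq km -ltnS ltn_ord.
by have /antitoneP/(_ i j ij) := p; rewrite !contentE.
Qed.

Lemma sum_ballot_snoc (A : nmodType) m (F : shape -> A) : (m < n)%N ->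
  \sum_(w : {ffun 'I_m.+1 -> 'I_n} | ballot w) F (content w) =
  \sum_(w : {ffun 'I_m -> 'I_n} | ballot w)
    \sum_(z | partn (add_box (content w) z)) F (add_box (content w) z).
Proof.
move=> mn; rewrite big_mkcond big_snoc [RHS]big_mkcond; apply: eq_bigr =>
  w _ /=.
case: (boolP (ballot w)) => bw; last first.
  by apply: big1 => z _; rewrite ballot_snoc // (negPf bw).
rewrite [RHS]big_mkcond; apply: eq_bigr => z _.
by rewrite ballot_snoc // bw content_snoc.
Qed.

Lemma ballot0 (w : {ffun 'I_0 -> 'I_n}) : ballot w.
Proof. by apply/forallP=> k; apply/antitoneP => i j _;
  rewrite /count_lt !big_ord0. Qed.

Lemma sum_ballot0 (A : nmodType) (F : shape -> A) :
  \sum_(w : {ffun 'I_0 -> 'I_n} | ballot w) F (content w) = F [ffun=> ord0].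
Proof.
have fz : {ffun 'I_0 -> 'I_n} by apply: finfun => - [].
rewrite (bigD1 fz) ?ballot0 //= big1 ?addr0 => [|w /andP[_ /eqP[]]]; last
  by apply/ffunP=> - [].
by congr (F _); apply/ffunP=> i; apply: val_inj;
  rewrite /= contentE // ffunE /count_lt big_ord0.
Qed.

Lemma size_shape0 : size_shape [ffun=> ord0] = 0%N.
Proof. by rewrite /size_shape big1 // => i _; rewrite ffunE. Qed.

Lemma chain_sum_empty (A : comNzRingType) (y : nat -> A) N :
  chain_sum (fun k d => y k ^+ d) N [ffun=> ord0] = 1.
Proof.
elim: N => [|N IHN] /=; first by rewrite size_shape0.
have refl : strip [ffun=> ord0] [ffun=> ord0].
  by apply/interlacesP; split=> *; rewrite !ffunE.
rewrite (bigD1 [ffun=> ord0]) //= IHN subnn mul1r big1 ?addr0 // => nu /andP[h].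
case/eqP; apply: (strip_eq_size h).
by have := strip_size h; rewrite size_shape0; case: size_shape.
Qed.

(** Every letter of a ballot word adds a box, hence a factor p_1 by [pieri]. This is the identity
    p_1^m = sum of f^la s_la, with the standard tableaux listed as ballot words. *)
Lemma sum_ballot_chain_sum (A : comNzRingType) (y : nat -> A) N m
  : (m <= n)%N ->
  \sum_(w : {ffun 'I_m -> 'I_n} | ballot w) chain_sum (fun k d =>
    y k ^+ d) N (content w) =
  (\sum_(k < N) y k) ^+ m.
Proof.
elim: m => [|m IHm] mn; first by rewrite sum_ballot0 chain_sum_empty.
rewrite sum_ballot_snoc // exprS -IHm ?(ltnW mn) // big_distrr /=;
  apply: eq_bigr => w bw.
by rewrite pieri ?ballot_partn ?size_content // ltnW.
Qed.

(** The identity m! = sum of (f^la)^2: one factor f^la is the number of ballot words of shape la,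
    the other is the chain sum. By [sum_box_chains_add] the letter in position m multiplies the
    total by m + 1. *)
Lemma sum_ballot_box_chains (A : comNzRingType) m : (m <= n)%N ->
  \sum_(w : {ffun 'I_m -> 'I_n} | ballot w) chain_sum (@box_wt A) m (content w)
    = (m`!)%:R.
Proof.
elim: m => [|m IHm] mn; first by rewrite sum_ballot0 /= size_shape0.
rewrite sum_ballot_snoc // factS natrM -IHm ?(ltnW mn) // big_distrr /=;
  apply: eq_bigr => w bw.
by rewrite -sum_box_chains_add ?ballot_partn ?size_content // ltnW.
Qed.

Lemma add_box_inj nu : (size_shape nu < n)%N -> injective (add_box nu).
Proof.
move=> hn i j /ffunP/(_ i)/(congr1 val) /=; rewrite !add_boxE // eqxx.
by case: eqP => [->//|_]; lia.
Qed.

Lemma add_box_strip nu la : partn nu -> (size_shape nu < n)%N ->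
  [exists z, partn (add_box nu z) && (add_box nu z == la)] =
  strip nu la && ((size_shape la - size_shape nu)%N == 1).
Proof.
move=> pn hn; apply/existsP/andP => [[z /andP[p /eqP <-]]|[h /eqP s]].
  split; last by rewrite size_add_box // subSnn.
  move/antitoneP: pn => pn; move/antitoneP: p => p.
  apply/interlacesP; split=> [i|i j ij]; first by rewrite add_boxE // leq_addr.
  have := p i j (ltnW ij); rewrite !add_boxE //; have := pn i j (ltnW ij).
  case: (i =P z) => [iz|_]; last by rewrite addn0.
  rewrite addn1; case: eqP => [jz|_]; last by rewrite addn0.
  by move: ij; rewrite iz jz ltnn.
have [h1 h2] := interlacesP _ _ h.
have ex : exists z, (nu z < la z)%N.
  apply/existsP; apply: contraT => /existsPn hc.
  have: (size_shape la <= size_shape nu)%N by apply: leq_sum => i _;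
    rewrite leqNgt hc.
  lia.
case: ex => z hz; exists z.
have e : add_box nu z = la.
  apply: strip_eq_size; last by rewrite size_add_box //; lia.
  apply/interlacesP; split=> [i|i j ij]; rewrite add_boxE //.
    by case: eqP => [->|_]; rewrite ?addn1 ?addn0.
  by apply: leq_trans (h2 _ _ ij) (leq_addr _ _).
by rewrite e eqxx andbT; have [] := interlaces_antitone h.
Qed.

(** Both sides grow by one box at a time: the last box of a chain corresponds to the last letter of
    a word by [add_box_strip], and [add_box_inj] makes this letter unique. *)
Lemma box_chains_count (A : comNzRingType) m la : (m <= n)%N ->
  chain_sum (@box_wt A) m la = #|[set w
    : {ffun 'I_m -> 'I_n} | ballot w && (content w == la)]|%:R.
Proof.
have card_sum m' la' : #|[set w : {ffun 'I_m' -> 'I_n} | ballot w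
  && (content w == la')]|%:R =
    \sum_(w : {ffun 'I_m' -> 'I_n} | ballot w) (content w == la')%:R :> A.
  rewrite -sum1_card natr_sum (eq_bigl (fun w =>
    ballot w && (content w == la'))) => [|w]; last by rewrite inE.
  by rewrite big_mkcondr /=; apply: eq_bigr => w _; case: eqP.
elim: m la => [|m IHm] la mn; rewrite card_sum.
  rewrite (sum_ballot0 (fun c => (c == la)%:R)) /=; congr (nat_of_bool _)%:R;
    apply/eqP/eqP => [e|<-]; last exact: size_shape0.
  apply/ffunP=> i; apply: val_inj; rewrite ffunE /=.
  by have := size_shape_ge la i; rewrite e; case: (nat_of_ord _).
rewrite (sum_ballot_snoc (fun c => (c == la)%:R)) //=.
transitivity (\sum_(nu | strip nu la) \sum_(w : {ffun 'I_m -> 'I_n} | ballot w)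
   (if (content w == nu) && ((size_shape la - size_shape nu)%N == 1) then 1 else
     0 : A)).
  apply: eq_bigr => nu h; rewrite IHm ?(ltnW mn) // card_sum big_distrl /=;
    apply: eq_bigr => w _.
  by rewrite /box_wt -natrM mulnb; case: ifP.
rewrite exchange_big /=; apply: eq_bigr => w bw.
have pc := ballot_partn (ltnW mn) bw; have sc : (size_shape (content w) < n)%N
  by rewrite size_content // ltnW.
have := add_box_strip la pc sc; case: existsP =>
  [[z /andP[pz /eqP zE]]|nz] /esym.
  case/andP=> h s; rewrite (bigD1 (content w)) //= eqxx s big1 ?addr0;
    last first.
    by move=> nu /andP[_]; rewrite eq_sym => /negPf ->.
  rewrite (bigD1 z) //= zE eqxx big1 ?addr0 // => z' /andP[_ nz'].
  by rewrite -zE (inj_eq (add_box_inj sc)) (negPf nz').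
move=> hF; rewrite big1 => [|nu h].
  rewrite big1 // => z pz; case: eqP => // zE; case: nz; exists z.
  by rewrite pz zE eqxx.
case: eqP => // e; rewrite -e in h *; by move: hF; rewrite h /= => ->.
Qed.

End Ballot.

End Shapes.

Lemma card_ord_lt n k : (k <= n)%N -> #|[pred i : 'I_n | (i < k)%N]| = k.
Proof.
by move=> kn; rewrite -sum1_card -(big_ord_widen n (fun=> 1%N)) // sum1_card
  card_ord.
Qed.

(** A downward closed set contains {0, ..., j} if it contains j, and is contained in {0, ..., j - 1}
    otherwise. This reads the lengths of rows and columns off a filling. *)
Lemma initial_segment n (P : pred 'I_n) :
  (forall i j : 'I_n, (i <= j)%N -> P j -> P i) -> forall j : 'I_n,
    P j = (j < #|P|)%N.
Proof.
move=> dP j; apply/idP/idP => [Pj|].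
  rewrite -{1}(@card_ord_lt n j.+1) //; apply: subset_leq_card.
  by apply/subsetP => i; rewrite inE ltnS => /dP; apply.
apply: contraTT => nP; rewrite -leqNgt.
apply: (@leq_trans #|[pred i : 'I_n | (i < j)%N]|); last
  by rewrite card_ord_lt // ltnW.
apply: subset_leq_card; apply/subsetP => i Pi; rewrite inE ltnNge.
by apply: contra nP => ji; apply: dP Pi.
Qed.

(** * Semistandard tableaux on a fixed grid *)

Section Grid.
Variable n : nat.
Local Notation shape := {ffun 'I_n -> 'I_n.+1}.
Local Notation grid N := {ffun 'I_n * 'I_n -> 'I_N.+1}.

Definition in_shape (la : shape) (c : 'I_n * 'I_n) : bool := (c.2 < la c.1)%N.

(* A semistandard filling of la by numbers less than N, extended by the value N
   to the cells outside of la. *)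
Definition grid_ssyt N (la : shape) (T : grid N) : bool :=
  [&& [forall c, (T c < N)%N == in_shape la c],
      [forall c : 'I_n * 'I_n, forall d : 'I_n * 'I_n,
        (c.1 == d.1) && (c.2 < d.2)%N ==> (T c <= T d)%N]
    & [forall c : 'I_n * 'I_n, forall d : 'I_n * 'I_n,
      (c.2 == d.2) && (c.1 < d.1)%N ==>
         (T c < T d)%N || (T d == N :> nat)]].

Lemma grid_ssytP N la (T : grid N) : reflect
  [/\ forall c, (T c < N)%N = in_shape la c,
      forall i (j k : 'I_n), (j < k)%N -> (T (i, j) <= T (i, k))%N
    & forall (i j k : 'I_n), (i < j)%N -> (T (j, k) < N)%N ->
      (T (i, k) < T (j, k))%N]
  (grid_ssyt la T).
Proof.
apply: (iffP and3P) => -[h1 h2 h3]; split.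
- by move=> c; have /eqP := forallP h1 c.
- by move=> i j k jk; have /forallP/(_ (i, k)) := forallP h2 (i, j);
    rewrite eqxx jk.
- move=> i j k ij lt; have /forallP/(_ (j, k)) := forallP h3 (i, k).
  by rewrite eqxx ij /= (ltn_eqF lt) orbF.
- by apply/forallP=> c; rewrite h1.
- apply/forallP=> -[i j]; apply/forallP=> -[i' k] /=;
    apply/implyP=> /andP[/eqP <-]; exact: h2.
- apply/forallP=> -[i k]; apply/forallP=> -[j k'] /=;
    apply/implyP=> /andP[/eqP <- ij].
  case: (ltnP (T (j, k)) N) => lt; first by rewrite h3.
  by rewrite [X in _ || X]eqn_leq lt leq_ord orbT.
Qed.

Lemma card_in_shape la : #|in_shape la| = size_shape la.
Proof.
rewrite -sum1_card -(pair_big_dep xpredT (fun i j : 'I_n =>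
  (j < la i)%N) (fun _ _ => 1%N)) /=.
by apply: eq_bigr => i _; rewrite sum1_card card_ord_lt // -ltnS.
Qed.

Section GridSum.
Variables (A : comNzRingType) (y : nat -> A).

Definition grid_sum N la : A :=
  \sum_(T : grid N | grid_ssyt la T) \prod_(c | in_shape la c) y (T c).

(** The cells with the largest value N of a semistandard filling form a horizontal strip, which
    contributes [y N] to the power of its size; taking it off leaves a filling by smaller values. As
    all fillings live on the same grid, this changes the values and not the domain. *)
Lemma grid_sumE N la : grid_sum N la = chain_sum (fun k d => y k ^+ d) N la.
Proof.
elim: N la => [|N IHN] la.
  rewrite /grid_sum /=; have e (T : grid 0) : T = [ffun=> ord0].
    by apply/ffunP=> c; rewrite ffunE; apply: ord1.
  have -> : (size_shape la == 0)%N = grid_ssyt la ([ffun=> ord0] : grid 0).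
    rewrite -card_in_shape; apply/idP/grid_ssytP => [/eqP/card0_eq h|[h _ _]].
      by split=> [c|i j k|i j k]; rewrite !ffunE // ltn0; apply/esym/(h c).
    by apply/eqP/eq_card0 => c; rewrite -[LHS]/(in_shape la c) -h ltn0.
  rewrite big_mkcond (bigD1 [ffun=> ord0]) //= [X in _ + X]big1 ?addr0 =>
    [|T /eqP[]]; last exact: e.
  case: (boolP (grid_ssyt _ _)) => // /grid_ssytP[h _ _].
  by rewrite big1 // => c; rewrite -h ltn0.
rewrite /grid_sum /=.
pose small (T : grid N.+1) i : pred 'I_n := fun j => (T (i, j) < N)%N.
pose shape_lt (T : grid N.+1) : shape := [ffun i => inord #|small T i|].
have shape_ltE T i : shape_lt T i = #|small T i| :> nat.
  by rewrite ffunE inordK // ltnS -[X in (_ <= X)%N](card_ord n) max_card.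
have shape_ltP la' T i j : grid_ssyt la' T ->
  (T (i, j) < N)%N = in_shape (shape_lt T) (i, j).
  case/grid_ssytP=> _ h _; rewrite /in_shape shape_ltE /=;
    apply: (initial_segment (P := small T i)).
  move=> k l; rewrite leq_eqVlt => /orP[/eqP/val_inj->//|kl] lt.
  exact: leq_ltn_trans (h _ _ _ kl) lt.
have in_shape_le (nu la' : shape) : (forall c, in_shape nu c ->
  in_shape la' c) -> forall i, (nu i <= la' i)%N.
  move=> h i; rewrite leqNgt; apply/negP => lt.
  have ln : (la' i < n)%N by rewrite (leq_trans lt) // -ltnS.
  by have := h (i, Ordinal ln); rewrite /in_shape /= lt ltnn => /(_ isT).
rewrite (partition_big shape_lt (fun nu => strip nu la)) /=; last first.
  move=> T hT; have [h1 h2 h3] := grid_ssytP _ _ hT; apply/interlacesP.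
  split=> [|i j ij].
    by apply: in_shape_le => -[i j]; rewrite -(shape_ltP _ _ _ _ hT) -h1;
      apply: leq_trans.
  rewrite leqNgt; apply/negP => lt.
  have ln : (shape_lt T i < n)%N by rewrite (leq_trans lt) // -ltnS.
  have : (T (i, Ordinal ln) < N)%N = false
    by rewrite (shape_ltP _ _ _ _ hT) /in_shape ltnn.
  have hj : (T (j, Ordinal ln) < N.+1)%N by rewrite h1 /in_shape.
  by rewrite (leq_trans (h3 _ _ _ ij hj)).
apply: eq_bigr => nu hs; have [s1 s2] := interlacesP _ _ hs.
have sub c : in_shape nu c -> in_shape la c by move=> h;
  apply: leq_trans h (s1 _).
(* [down] caps every entry at N, which is the outer value of the smaller grid, and so discards the
   strip la / nu; [up] restores N on the strip and N + 1 outside of la. *)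
pose up (T : grid N) : grid N.+1 := [ffun c => inord
  (if in_shape nu c then nat_of_ord (T c) else if in_shape la c then N else
    N.+1)].
pose down (T : grid N.+1) : grid N := [ffun c => inord (minn (T c) N)].
have downE T c : down T c = minn (T c) N :> nat
  by rewrite ffunE inordK // ltnS geq_minr.
have upE T c : up T c =
  (if in_shape nu c then nat_of_ord (T c) else if in_shape la c then N else
  N.+1) :> nat.
  by rewrite ffunE inordK //; have := ltn_ord (T c); do 2?case: ifP => _; lia.
have updown T : grid_ssyt la T -> shape_lt T = nu -> up (down T) = T.
  move=> hT e; have [h1 h2 h3] := grid_ssytP _ _ hT.
  apply/ffunP=> -[i j]; apply: val_inj; rewrite /= upE downE.
  rewrite -e -(shape_ltP _ _ _ _ hT) -h1.
  move: (leq_ord (T (i, j))); move: (nat_of_ord (T (i, j))) => t;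
    do 2!case: ltnP; lia.
rewrite (reindex_onto up down) /=; last by move=> T /andP[hT /eqP];
  apply: updown.
rewrite -IHN /grid_sum big_distrl /=; apply: eq_big => [T|T].
  apply/andP/grid_ssytP => [[/andP[hT /eqP e] /eqP e2]|[h1 h2 h3]].
    have [h1 h2 h3] := grid_ssytP _ _ hT; rewrite -e2;
      split=> [[i j]|i j k jk|i j k ij].
    - by rewrite downE gtn_min ltnn orbF (shape_ltP _ _ _ _ hT) e.
    - by rewrite !downE; have := h2 i j k jk; lia.
    - rewrite !downE gtn_min ltnn orbF => lt.
      by have := h3 i j k ij (ltnW lt); lia.
  have upE' c : in_shape nu c -> up T c = T c :> nat by move=> h; rewrite upE h.
  have hup : grid_ssyt la (up T).
    apply/grid_ssytP; split=> [c|i j k jk|i j k ij].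
    - rewrite upE; case: ifP => [h|_]; last by case: ifP => _;
        rewrite ?ltnn ?ltnSn.
      by rewrite sub // ltn_ord.
    - rewrite !upE; case: (boolP (in_shape nu (i, k))) => hk.
        have hj : in_shape nu (i, j) by apply: ltn_trans jk hk.
        by rewrite hj h2.
      case: (boolP (in_shape la (i, k))) => lk.
        have lj : in_shape la (i, j) by apply: ltn_trans jk lk.
        by rewrite lj; case: ifP => //; rewrite -ltnS.
      by case: ifP => _; [have := ltn_ord (T (i, j)); lia | case: ifP].
    - rewrite !upE; case: (boolP (in_shape nu (j, k))) => hj lt.
        have hi : in_shape nu (i, k) by apply: leq_trans hj _;
          apply: leq_trans (s1 j) (s2 i j ij).
        by rewrite hi h3 // h1.
      move: lt; case: (boolP (in_shape la (j, k))) => lj; last by rewrite ltnn.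
      move=> _; have hi : in_shape nu (i, k) by apply: leq_trans lj (s2 i j ij).
      by rewrite hi h1.
  rewrite hup; split; last first.
    apply/eqP/ffunP=> c; apply: val_inj; rewrite /= downE upE.
    case: (boolP (in_shape nu c)) => h; first by have := h1 c; rewrite h; lia.
    have := h1 c; rewrite (negPf h) => /negbT; rewrite -leqNgt => le.
    by have := ltn_ord (T c); case: ifP => _; lia.
  rewrite /=; apply/eqP/ffunP=> i; apply: val_inj; apply/eqP; rewrite eqn_leq.
  have same c : in_shape (shape_lt (up T)) c = in_shape nu c.
    case: c => a b; rewrite -(shape_ltP _ _ _ _ hup) upE; case: ifP => h; first
      by rewrite h1.
    by case: ifP => _; rewrite ?ltnn // ltnNge leqnSn.
  by rewrite !in_shape_le // => c; rewrite same.
case/andP=> /andP[hT _] _.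
rewrite (bigID (in_shape nu)) /=; congr (_ * _).
  apply: eq_big => [c|c /andP[_ h]]; last by rewrite upE h.
  by apply/andP/idP => [[]//|h]; split=> //; apply: sub.
rewrite (eq_bigr (fun=> y N)) => [|c /andP[lc /negPf nc]]; last
  by rewrite upE nc lc.
rewrite prodr_const -!card_in_shape; congr (_ ^+ _).
rewrite -(cardID (in_shape nu) (in_shape la)).
have -> : #|[predI in_shape la & in_shape nu]| = #|in_shape nu|.
  by apply: eq_card => c; rewrite !inE; apply/andP/idP => [[]//|h]; split=> //;
    apply: sub.
by rewrite addKn; apply: eq_card => c; rewrite !inE andbC.
Qed.

End GridSum.

(** [ext] gives the value N to the cells outside of the diagram, which turns the fillings of
    [cell n mu] into those of [grid_ssyt]. The default 0 is never reached, as only the weights with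
    k < N occur. *)
Lemma schurE mu la N : partn la -> (forall i : 'I_n, nth 0%N mu i = la i) ->
  schur n mu N = chain_sum (fun k d =>
    (if insub k is Some i then 'X_i else 0 : {mpoly int[N]}) ^+ d) N la.
Proof.
move=> /antitoneP pla mu_la; rewrite -grid_sumE /grid_sum /schur.
have dE c : (c \in diagram n mu) = in_shape la c by rewrite inE mu_la.
pose ext (F : {ffun cell n mu -> 'I_N}) : grid N :=
  [ffun c => if insub c is Some d then widen_ord (leqnSn N) (F d) else ord_max].
have extE F (d : cell n mu) : ext F (val d) = F d :> nat by rewrite ffunE valK.
have ext_out F c : ~~ in_shape la c -> ext F c = N :> nat.
  by move=> h; rewrite ffunE insubN ?dE.
have ext_inj : injective ext.
  move=> F G e; apply/ffunP=> d; apply: val_inj; rewrite /= -!extE;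
    by rewrite e.
rewrite [RHS](reindex_omap ext (fun T => [pick F | ext F == T])) /=; last first.
  move=> T /grid_ssytP[h1 _ _]; case: pickP => [F /eqP /= ->//|/=].
  have hc (d : cell n mu) : (T (val d) < N)%N by rewrite h1 -dE; apply: valP.
  move/(_ [ffun d => Ordinal (hc d)])/eqP; case; apply/ffunP=> c;
    apply: val_inj => /=.
  case: (boolP (c \in diagram n mu)) => cd.
    by rewrite -[c](SubK (cell n mu) cd) extE ffunE.
  rewrite ext_out -?dE //; apply/esym/eqP;
    rewrite eqn_leq -ltnS ltn_ord /= leqNgt h1 -dE //.
apply: eq_big => [F|F _]; last first.
  rewrite (reindex_omap (val : cell n mu -> _) insub) /=; last first.
    by move=> c; rewrite -dE => h; rewrite insubT.
  apply: eq_big => [d|d _]; first by rewrite valK eqxx andbT -dE (valP d).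
  by rewrite extE valK.
have -> : ([pick F' | ext F' == ext F] == Some F) = true.
  case: pickP => [G /eqP/ext_inj->//|/(_ F)]; by rewrite eqxx.
rewrite andbT; apply/idP/grid_ssytP => [/forallP h|[h1 h2 h3]].
  split=> [c|i j k jk|i j k ij].
  - case: (boolP (in_shape la c)) => hc; last by rewrite ext_out // ltnn.
    by rewrite -dE in hc; rewrite -[c](SubK (cell n mu) hc) extE ltn_ord.
  - case: (boolP (in_shape la (i, k))) => hk; last
      by rewrite (ext_out _ _ hk) -ltnS.
    have hj : in_shape la (i, j) by apply: ltn_trans jk hk.
    rewrite -!dE in hk hj.
    have /forallP/(_ (Sub (i, k) hk))/andP[/implyP + _] := h (Sub (i, j) hj).
    by rewrite -!extE !SubK eqxx jk; apply.
  - case: (boolP (in_shape la (j, k))) => hj; last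
      by rewrite (ext_out _ _ hj) ltnn.
    move=> _; case: (boolP (in_shape la (i, k))) => hi.
      rewrite -!dE in hj hi.
      have /forallP/(_ (Sub (j, k) hj))/andP[_ /implyP] := h (Sub (i, k) hi).
      by rewrite -!extE !SubK eqxx ij; apply.
    by case/negP: hi; apply: leq_trans hj (pla _ _ (ltnW ij)).
apply/forallP=> -[[i j] hc]; apply/forallP=> -[[i' j'] hd] /=.
rewrite -!extE /=; apply/andP; split; apply/implyP=> /andP[/eqP e lt].
  by rewrite -e h2.
by rewrite -e h3 // h1 -dE e.
Qed.


(** In a weakly decreasing sequence the zeros come last, so dropping them shifts no other entry. *)
Lemma nth_filter_neq0 (s : seq nat) i : sorted geq s ->
  nth 0%N [seq x <- s | x != 0%N] i = nth 0%N s i.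
Proof.
elim: s i => // x s IHs i; rewrite /= (path_sortedE (rev_trans leq_trans)) =>
  /andP[xs ss].
case: eqP => [x0|_]; last by case: i => //= i; apply: IHs.
rewrite x0 in xs; rewrite (IHs i ss); have s0 j : nth 0%N s j = 0%N.
  case: (ltnP j (size s)) => js; last by rewrite nth_default.
  by have := allP xs _ (mem_nth 0%N js); rewrite /geq /= leqn0 => /eqP.
by rewrite s0 x0; case: i => //= i; rewrite s0.
Qed.

Definition seq_of_shape (la : shape) : seq nat :=
  [seq x <- [seq nat_of_ord (la i) | i <- enum 'I_n] | x != 0%N].

Lemma sorted_shape la : partn la ->
  sorted geq [seq nat_of_ord (la i) | i <- enum 'I_n].
Proof.
move=> /antitoneP pla; rewrite sorted_map.
apply: (sub_sorted (e := fun i j : 'I_n => (i <= j)%N)); first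
  by move=> i j /pla.
by rewrite -(sorted_map (f := @nat_of_ord n) (e' := leq)) val_enum_ord
  iota_sorted.
Qed.

Lemma nth_seq_of_shape la (i : 'I_n) : partn la ->
  nth 0%N (seq_of_shape la) i = la i.
Proof.
move=> pla; rewrite nth_filter_neq0 ?sorted_shape //.
by rewrite (nth_map i) ?size_enum_ord // nth_ord_enum.
Qed.

Lemma sumn_filter_neq0 (s : seq nat) : sumn [seq x <- s | x != 0%N] = sumn s.
Proof. by elim: s => //= x s <-; case: eqP => [->|]. Qed.

Lemma seq_of_shape_partition la : partn la ->
  is_partition (size_shape la) (seq_of_shape la).
Proof.
move=> pla; apply/and3P; split.
- exact: sorted_filter (rev_trans leq_trans) _ _ (sorted_shape pla).
- by rewrite mem_filter.
- by rewrite sumn_filter_neq0 sumnE big_map big_enum.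
Qed.

Lemma sum_ballot_schur N :
  \sum_(w : {ffun 'I_n -> 'I_n} | ballot w) schur n (seq_of_shape (content w)) N
    =
  (\sum_(i < N) 'X_i) ^+ n.
Proof.
pose y k : {mpoly int[N]} := if insub k is Some i then 'X_i else 0.
have -> : \sum_(i < N) 'X_i = \sum_(i < N) y i by apply: eq_bigr => i _;
  rewrite /y valK.
rewrite -(@sum_ballot_chain_sum n _ y N n) //; apply: eq_bigr => w bw.
have pw := ballot_partn (leqnn n) bw.
by apply: schurE => // i; apply: nth_seq_of_shape.
Qed.

End Grid.

(** * Independence and spanning for as many functions as points *)

Section SquareSystem.
Variables (F : fieldType) (J S : finType) (phi : J -> S -> F).
Hypothesis cardJS : #|J| = #|S|.

Let M : 'M[F]_(#|J|, #|S|) := \matrix_(i, k) phi (enum_val i) (enum_val k).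

Let mulM (c : J -> F) k :
  ((\row_i c (enum_val i)) *m M) 0 k = \sum_j c j * phi j (enum_val k).
Proof.
rewrite mxE [RHS](reindex_onto (enum_val (A := J)) enum_rank) /=; last
  by move=> j _; rewrite enum_rankK.
by apply: eq_big => [i|i _]; rewrite ?enum_valK ?eqxx // !mxE.
Qed.

(** The matrix [M] is square up to [cardJS], so its rank makes it row free exactly when it is row
    full. *)
Lemma independent_spans :
  (forall c : J -> F, (forall s, \sum_j c j * phi j s = 0) -> forall j,
    c j = 0) ->
  forall g : S -> F, exists c : J -> F, forall s, g s = \sum_j c j * phi j s.
Proof.
move=> ind g.
have : row_free M.
  rewrite -kermx_eq0; apply/rowV0P => u /sub_kermxP uM.
  have uE : u = \row_i u 0 (enum_rank (enum_val i)) by apply/rowP=> i;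
    rewrite mxE enum_valK.
  have c0 := ind (fun j => u 0 (enum_rank j)).
  rewrite uE; apply/rowP=> i; rewrite !mxE; apply: c0 => s.
  by rewrite -[s]enum_rankK -mulM -uE uM mxE.
move=> /eqP rk; have full : row_full M by rewrite /row_full rk cardJS.
have /submxP[u gE] : (\row_k g (enum_val k) <= M)%MS by apply: submx_full.
exists (fun j => u 0 (enum_rank j)) => s.
have -> : g s = (\row_k g (enum_val k)) 0 (enum_rank s)
  by rewrite mxE enum_rankK.
rewrite gE -[in RHS](enum_rankK s) -mulM; congr ((_ *m M) 0 _).
by apply/rowP=> i; rewrite mxE enum_valK.
Qed.

Lemma spans_independent :
  (forall g : S -> F, exists c : J -> F, forall s,
    g s = \sum_j c j * phi j s) ->
  forall c : J -> F, (forall s, \sum_j c j * phi j s = 0) -> forall j, c j = 0.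
Proof.
move=> sp c hc.
have full : row_full M.
  rewrite -sub1mx; apply/row_subP=> k; apply/submxP.
  have [d hd] := sp (fun s => (row k 1%:M) 0 (enum_rank s) : F).
  exists (\row_i d (enum_val i)); apply/rowP=> l.
  by rewrite mulM -hd enum_valK.
have : kermx M == 0 by rewrite kermx_eq0 /row_free (eqP full) cardJS.
move/eqP => k0 j.
have : (\row_i c (enum_val i) <= kermx M)%MS.
  by apply/sub_kermxP/rowP=> k; rewrite mulM hc mxE.
rewrite k0 submx0 => /eqP/rowP/(_ (enum_rank j)); by rewrite !mxE enum_rankK.
Qed.
End SquareSystem.

(** * Specht modules *)

Section Tabloids.
Variables (C : numClosedFieldType) (n : nat).
Local Notation V := (tabloid_space C n).
Local Notation tableau := {ffun 'I_n -> 'I_n * 'I_n}.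
Local Notation shape := {ffun 'I_n -> 'I_n.+1}.
Implicit Types (s t : 'S_n) (f g v : V) (T : tableau) (u : tabloid n).

Lemma tabloid_act_is_linear s : linear (@tabloid_act C n s).
Proof. by move=> a f g; apply/ffunP=> u; rewrite !ffunE. Qed.
HB.instance Definition _ s :=
  GRing.isLinear.Build C V V _ (@tabloid_act C n s) (tabloid_act_is_linear s).

Lemma tabloid_actM s t f : tabloid_act (s * t)%g f =
  tabloid_act t (tabloid_act s f).
Proof.
by apply/ffunP=> u; rewrite !ffunE; congr (f _); apply/ffunP=> k;
  rewrite !ffunE permM.
Qed.

Definition tabloid_perm s u : tabloid n := [ffun k => u (s k)].

Lemma tabloid_act_vec s u : tabloid_act s (tabloid_vec C u) =
  tabloid_vec C (tabloid_perm s^-1%g u).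
Proof.
apply/ffunP=> u'; rewrite !ffunE; congr (nat_of_bool _)%:R; apply/eqP/eqP =>
  [<-|->].
  by apply/ffunP=> k; rewrite !ffunE permKV.
by apply/ffunP=> k; rewrite !ffunE permK.
Qed.

(** The form for which the tabloids are orthonormal. It is bilinear rather than Hermitian, so that
    both arguments are linear; positivity is recovered in [Specht_nondegenerate], because
    polytabloids have real coefficients. *)
Definition form f g : C := \sum_u f u * g u.

Lemma form_is_linear f : linear_for *%R (form f).
Proof.
move=> a g h; rewrite /form mulr_sumr -big_split; apply: eq_bigr => u _.
by rewrite !ffunE mulrDr mulrCA.
Qed.
HB.instance Definition _ f :=
  GRing.isLinear.Build C V C _ (form f) (form_is_linear f).

Lemma formC f g : form f g = form g f.
Proof. by apply: eq_bigr => u _; rewrite mulrC. Qed.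

Lemma formDl f g h : form (f + g) h = form f h + form g h.
Proof. by rewrite !(formC _ h) linearD. Qed.

Lemma formZl a f h : form (a *: f) h = a * form f h.
Proof. by rewrite !(formC _ h) linearZ. Qed.

Lemma form_suml I (r : seq I) (P : pred I) (F : I -> V) h :
  form (\sum_(i <- r | P i) F i) h = \sum_(i <- r | P i) form (F i) h.
Proof. by rewrite formC raddf_sum; apply: eq_bigr => i _; rewrite formC. Qed.

Lemma form_act s f g : form (tabloid_act s f) g = form f (tabloid_act s^-1%g g).
Proof.
rewrite /form [RHS](reindex (tabloid_perm s)) /=; last first.
  exists (tabloid_perm s^-1%g) => u _; apply/ffunP=> k;
    rewrite !ffunE ?permK ?permKV //.
apply: eq_bigr => u _; rewrite !ffunE; congr (_ * g _).
by apply/ffunP=> k; rewrite !ffunE permKV.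
Qed.

Lemma form_vec f u : form f (tabloid_vec C u) = f u.
Proof.
rewrite /form (bigD1 u) //= ffunE eqxx mulr1 big1 ?addr0 // => u' /negPf nu.
by rewrite ffunE nu mulr0.
Qed.

Lemma tabloid_decomp v : v = \sum_u v u *: tabloid_vec C u.
Proof.
apply/ffunP=> u; rewrite sum_ffunE (bigD1 u) //= !ffunE eqxx [_ *: _]mulr1 big1
  ?addr0 // => u' nu.
by rewrite !ffunE eq_sym (negPf nu) [_ *: _]mulr0.
Qed.

Lemma col_stabP T s : reflect (forall k,
  (T (s k)).2 = (T k).2) (s \in col_stab T).
Proof. by rewrite inE; apply: (iffP forallP) => h k; apply/eqP/h. Qed.

Lemma col_stab1 T : 1%g \in col_stab T.
Proof. by apply/col_stabP => k; rewrite perm1. Qed.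

Lemma col_stabM T s t : s \in col_stab T -> t \in col_stab T ->
  (s * t)%g \in col_stab T.
Proof. by move=> /col_stabP hs /col_stabP ht; apply/col_stabP => k;
  rewrite permM ht hs. Qed.

Lemma col_stabV T s : s \in col_stab T -> s^-1%g \in col_stab T.
Proof. by move=> /col_stabP hs; apply/col_stabP => k;
  rewrite -{2}(permKV s k) hs. Qed.

Lemma col_stabMl T s t : s \in col_stab T ->
  ((s * t)%g \in col_stab T) = (t \in col_stab T).
Proof.
move=> hs; apply/idP/idP => [h|]; last exact: col_stabM.
by rewrite -(mulKg s t) col_stabM // col_stabV.
Qed.

(** The signed column sum of T, denoted kappa_T by James. *)
Definition col_antisym T v : V :=
  \sum_(s in col_stab T) (-1) ^+ s *: tabloid_act s v.

Lemma col_antisym_is_linear T : linear (col_antisym T).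
Proof.
move=> a f g; rewrite /col_antisym scaler_sumr -big_split; apply: eq_bigr =>
  s _ /=.
by rewrite linearP scalerDr !scalerA mulrC.
Qed.
HB.instance Definition _ T :=
  GRing.isLinear.Build C V V _ (col_antisym T) (col_antisym_is_linear T).

Lemma tableau_perm_act T s :
  tabloid_vec C (tabloid_of (tableau_perm s T)) =
    tabloid_act s (tabloid_vec C (tabloid_of T)).
Proof. by rewrite tabloid_act_vec; congr (tabloid_vec _ _); apply/ffunP=> k;
  rewrite !ffunE. Qed.

Lemma polytabloidE T : polytabloid C T =
  col_antisym T (tabloid_vec C (tabloid_of T)).
Proof. by apply: eq_bigr => s _; rewrite tableau_perm_act. Qed.

(** The form is invariant, and inversion preserves both the column stabilizer and the sign. *)
Lemma form_col_antisym T f g : form (col_antisym T f) g =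
  form f (col_antisym T g).
Proof.
rewrite form_suml raddf_sum /= (reindex_inj invg_inj) /=; apply: eq_big =>
  [s|s hs].
  by apply/idP/idP => h; [rewrite -(invgK s)|]; apply: col_stabV.
by rewrite formZl linearZ form_act invgK odd_permV.
Qed.

Lemma col_antisym_act T s v : s \in col_stab T ->
  col_antisym T (tabloid_act s v) = (-1) ^+ s *: col_antisym T v.
Proof.
move=> hs; rewrite [in RHS]/col_antisym (reindex_inj (mulgI s)) /= scaler_sumr.
apply: eq_big => [t|t ht]; first by rewrite col_stabMl.
by rewrite scalerA odd_permM signr_addb mulrA -expr2 sqrr_sign mul1r
  tabloid_actM.
Qed.

(** The transposition of k and l lies in the column stabilizer and fixes u, but it changes the sign
    of the antisymmetrized vector, which is thus its own opposite. *)
Lemma col_antisym_vec0 T u k l : k != l -> (T k).2 = (T l).2 -> u k = u l ->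
  col_antisym T (tabloid_vec C u) = 0.
Proof.
move=> kl cT uT; have hs : tperm k l \in col_stab T.
  by apply/col_stabP => j; case: tpermP => [->|->|].
have := col_antisym_act (tabloid_vec C u) hs.
have -> : tabloid_act (tperm k l) (tabloid_vec C u) = tabloid_vec C u.
  rewrite tabloid_act_vec tpermV; congr (tabloid_vec _ _); apply/ffunP => j;
    rewrite ffunE.
  by case: tpermP => [->|->|].
rewrite odd_tperm kl expr1 scaleN1r => /eqP;
  rewrite -addr_eq0 -mulr2n -scaler_nat scaler_eq0.
by rewrite pnatr_eq0 => /eqP.
Qed.

Definition col_injective T u : bool :=
  [forall k, forall l, ((T k).2 == (T l).2) && (u k == u l) ==> (k == l)].

Lemma col_injectiveP T u : reflect (forall k l, (T k).2 = (T l).2 ->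
  u k = u l -> k = l)
  (col_injective T u).
Proof.
apply: (iffP forallP) => h k.
  by move=> l e1 e2; have /forallP/(_ l) := h k; rewrite e1 e2 !eqxx => /eqP.
by apply/forallP=> l; apply/implyP => /andP[/eqP e1 /eqP e2]; rewrite (h k l).
Qed.

Lemma col_antisym_nonzero T u : col_antisym T (tabloid_vec C u) != 0 ->
  col_injective T u.
Proof.
move=> nz; apply/col_injectiveP => k l cT uT; apply/eqP; apply: contraNT nz =>
  kl.
by rewrite (col_antisym_vec0 kl cT uT).
Qed.

End Tabloids.

(** Induction on the size of D, removing a point where f is largest; there f is at least |D| - 1. It
    will be applied to the rows of the entries of one column. *)
Lemma sum_injective_ge (I : finType) (D : {set I}) (f : I -> nat)
  : {in D &, injective f} ->
  (\sum_(i < #|D|) i <= \sum_(k in D) f k)%N /\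
  ((\sum_(k in D) f k <= \sum_(i < #|D|) i)%N -> forall k, k \in D ->
    (f k < #|D|)%N).
Proof.
move: {2}#|D| (erefl #|D|) => m; elim: m D => [|m IHm] D cD injf.
  rewrite cD big_ord0; split=> // _ k; by rewrite (cards0_eq cD) inE.
have /card_gt0P[k1 k1D] : (0 < #|D|)%N by rewrite cD.
pose k0 := [arg max_(k > k1 in D) f k].
have [k0D k0max] : k0 \in D /\ forall k, k \in D -> (f k <= f k0)%N.
  by rewrite /k0; case: arg_maxnP.
have cD' : #|D :\ k0| = m by have := cardsD1 k0 D; rewrite k0D cD => -[].
have injf' : {in D :\ k0 &, injective f}.
  by move=> a b /setD1P[_ aD] /setD1P[_ bD]; apply: injf.
have [ge eq] := IHm _ cD' injf'.
have mk0 : (m <= f k0)%N.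
  rewrite -ltnS -cD -(card_in_imset (f := fun k => inord (f k) : 'I_(f k0).+1)).
    by rewrite -[leqRHS]card_ord max_card.
  move=> a b aD bD /(congr1 (@nat_of_ord _)); rewrite !inordK ?ltnS ?k0max //.
  exact: injf.
rewrite (big_setD1 k0) //= cD big_ord_recr /= addnC; rewrite cD' in ge eq;
  split; first exact: leq_add.
move=> le k kD; rewrite ltnS; apply: leq_trans (k0max k kD) _.
rewrite -(leq_add2r (\sum_(i < m) i));
  exact: leq_trans (leq_add (leqnn _) ge) le.
Qed.

(** * James' lemmas for a tableau of fixed shape *)

Section TableauxOfShape.
Variables (C : numClosedFieldType) (n : nat).
Local Notation tableau := {ffun 'I_n -> 'I_n * 'I_n}.
Local Notation shape := {ffun 'I_n -> 'I_n.+1}.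
Implicit Types (T : tableau) (u : tabloid n) (la : shape).

(* Replaces the dominance order in James' argument. *)
Definition row_sum u : nat := \sum_k u k.

Lemma contentnE u i : content u i = #|[set k | u k == i]| :> nat.
Proof.
rewrite contentE // -sum1_card /count_lt [RHS]big_mkcond; apply: eq_big => k;
  first by rewrite ltn_ord.
by rewrite inE; case: eqP.
Qed.

Lemma row_sum_content u : row_sum u = (\sum_(i < n) i * content u i)%N.
Proof.
rewrite /row_sum (partition_big u xpredT) //=; apply: eq_bigr => i _.
rewrite contentnE (eq_bigr (fun=> i : nat)) => [|k /eqP -> //].
by rewrite sum_nat_const mulnC -sum1dep_card sum1_card.
Qed.

Section Fixed.
Variables (la : shape) (T : tableau).
Hypotheses (pla : partn la) (sla : size_shape la = n).
Hypotheses (Tinj : injective T) (Tla : forall k, in_shape la (T k)).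

Lemma tableau_onto c : in_shape la c -> exists k, T k = c.
Proof.
move=> hc; have : [set T k | k in 'I_n] = [set c | in_shape la c].
  apply/eqP; rewrite eqEcard card_imset // cardsE card_in_shape sla card_ord
    leqnn andbT.
  by apply/subsetP => _ /imsetP[k _ ->]; rewrite inE Tla.
by move=> /setP/(_ c); rewrite inE hc => /imsetP[k _ ->]; exists k.
Qed.

Let h (c : 'I_n) : nat := #|[pred i : 'I_n | in_shape la (i, c)]|.
Let D (c : 'I_n) : {set 'I_n} := [set k | (T k).2 == c].

Let in_shapeE (i c : 'I_n) : in_shape la (i, c) = (i < h c)%N.
Proof.
apply: (initial_segment (P := fun i : 'I_n => in_shape la (i, c))) => j k jk.
by rewrite /in_shape /= => lt; apply: leq_trans lt (antitoneP _ pla _ _ jk).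
Qed.

Let row_inj c : {in D c &, injective (fun k => (T k).1)}.
Proof.
move=> k l; rewrite !inE => /eqP ck /eqP cl e; apply: Tinj.
by rewrite [T k]surjective_pairing [T l]surjective_pairing e ck cl.
Qed.

Let row_im c : [set (T k).1 | k in D c] = [set i : 'I_n | (i < h c)%N].
Proof.
apply/setP=> i; rewrite [RHS]inE -in_shapeE; apply/imsetP/idP =>
  [[k kD ->]|/tableau_onto[k Tk]].
  by move: kD; rewrite inE => /eqP <-; rewrite -surjective_pairing.
by exists k; rewrite ?inE Tk.
Qed.

Let h_le c : (h c <= n)%N.
Proof. by rewrite -[leqRHS]card_ord max_card. Qed.

Let card_D c : #|D c| = h c.
Proof. by rewrite -(card_in_imset (@row_inj c)) row_im cardsE card_ord_lt. Qed.

Let sum_D c : (\sum_(k in D c) (T k).1 = \sum_(i < #|D c|) i)%N.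
Proof.
rewrite -(big_imset (h := fun k => (T k).1) (fun i : 'I_n =>
  (i : nat)) (@row_inj c)) row_im card_D /=.
by rewrite (big_ord_widen n (fun i => i)) //; apply: eq_bigl => i; rewrite inE.
Qed.

Let sum_by_col (F : 'I_n -> nat) : (\sum_k F k = \sum_c \sum_(k in D c) F k)%N.
Proof.
rewrite (partition_big (fun k => (T k).2) xpredT) //=; apply: eq_bigr => c _.
by apply: eq_bigl => k; rewrite inE.
Qed.

(** The entries in a column of T of height h have distinct rows in u, whose sum is at least 0 + ...
    + (h - 1), the value attained by T. Equality in total forces equality in every column, hence
    rows below h. *)
Lemma col_injective_row_sum u : col_injective T u ->
  (row_sum (tabloid_of T) <= row_sum u)%N /\
  ((row_sum u <= row_sum (tabloid_of T))%N -> forall k,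
    in_shape la (u k, (T k).2)).
Proof.
move=> /col_injectiveP inju.
have injD c : {in D c &, injective (fun k => nat_of_ord (u k))}.
  by move=> k l; rewrite !inE => /eqP ck /eqP cl /val_inj; apply: inju;
    rewrite ck cl.
have rT : row_sum (tabloid_of T) = (\sum_c \sum_(k in D c) (T k).1)%N.
  by rewrite -sum_by_col; apply: eq_bigr => k _; rewrite ffunE.
have le c : (\sum_(k in D c) (T k).1 <= \sum_(k in D c) u k)%N.
  by rewrite sum_D; have [] := sum_injective_ge (injD c).
rewrite rT /row_sum (sum_by_col (fun k => u k)); split; first exact: leq_sum.
have [le_sum eq_sum] := leqif_sum (fun c (_ : predT c) => leqif_eq (le c)).
move=> ge k; have : (\sum_c \sum_(k in D c) (T k).1 == \sum_c \sum_(k in D c) u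
  k)%N.
  by rewrite eqn_leq ge le_sum.
rewrite eq_sum => /forallP/(_ (T k).2)/eqP e.
have [_ small] := sum_injective_ge (injD (T k).2).
rewrite in_shapeE -card_D; apply: small; last by rewrite inE.
by rewrite -e sum_D.
Qed.

Lemma col_injective_col_stab u : col_injective T u ->
  (row_sum u <= row_sum (tabloid_of T))%N ->
  exists2 s, s \in col_stab T & u = tabloid_perm s (tabloid_of T).
Proof.
move=> iu le; have [_ /(_ le) hu] := col_injective_row_sum iu.
pose s0 k := odflt k [pick l | T l == (u k, (T k).2)].
have s0E k : T (s0 k) = (u k, (T k).2).
  rewrite /s0; case: pickP => [l /eqP //|no]; have [l Tl] :=
    tableau_onto (hu k).
  by have := no l; rewrite Tl eqxx.
have s0_inj : injective s0.
  move=> k l e; have := s0E k; rewrite e s0E => -[e1 e2].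
  exact: (col_injectiveP _ _ iu).
exists (perm s0_inj); first by apply/col_stabP=> k; rewrite permE s0E.
by apply/ffunP=> k; rewrite !ffunE permE s0E.
Qed.

Lemma content_tableau : content (tabloid_of T) = la.
Proof.
apply/ffunP=> i; apply: val_inj; rewrite /= contentnE.
rewrite -[RHS](@card_ord_lt n (la i)) ?leq_ord // -[RHS]cardsE.
rewrite -(card_in_imset (f := fun k => (T k).2) (D :=
  [set k | tabloid_of T k == i])); last first.
  move=> k l; rewrite !inE !ffunE => /eqP rk /eqP rl e; apply: Tinj.
  by rewrite [T k]surjective_pairing [T l]surjective_pairing e rk rl.
apply: eq_card => c; rewrite inE; apply/imsetP/idP => [[k]|lt].
  by rewrite !inE !ffunE => /eqP <- ->; apply: Tla.
have [k Tk] := tableau_onto (lt : in_shape la (i, c)).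
by exists k; rewrite ?inE ?ffunE Tk.
Qed.

Lemma row_sum_tabloid_of : row_sum (tabloid_of T) = (\sum_(i < n) i * la i)%N.
Proof. by rewrite row_sum_content content_tableau. Qed.

Lemma content_perm (s : 'S_n) u : content (tabloid_perm s u) = content u.
Proof.
apply/ffunP=> i; apply: val_inj;
  rewrite /= !contentnE -(card_imset _ (@perm_inj _ s)).
apply: eq_card => k; rewrite !inE; apply/imsetP/idP => [[l + ->]|uk]; first
  by rewrite inE ffunE.
by exists (s^-1 k)%g; rewrite ?inE ?ffunE permKV.
Qed.

(** A tabloid that survives antisymmetrization and has no larger row sum is a column permutation of
    that of T, and so has the same content. *)
Lemma col_antisym_other_content u : content u != la ->
  (row_sum u <= \sum_(i < n) i * la i)%N -> col_antisym T (tabloid_vec C u) = 0.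
Proof.
rewrite -row_sum_tabloid_of => nc le; apply/eqP; apply: contraNT nc =>
  /col_antisym_nonzero iu.
have [s _ ->] := col_injective_col_stab iu le.
by rewrite content_perm content_tableau.
Qed.

Lemma col_antisym_same_content u : content u = la ->
  exists c, col_antisym T (tabloid_vec C u) = c *: polytabloid C T.
Proof.
move=> cu; have [->|/col_antisym_nonzero iu] :=
  eqVneq (col_antisym T (tabloid_vec C u)) 0.
  by exists 0; rewrite scale0r.
have le : (row_sum u <= row_sum (tabloid_of T))%N
  by rewrite row_sum_tabloid_of row_sum_content cu.
have [s hs ->] := col_injective_col_stab iu le.
exists ((-1) ^+ s); rewrite -[s in LHS]invgK -tabloid_act_vec col_antisym_act
  ?col_stabV //.
by rewrite odd_permV polytabloidE.
Qed.

(** A permutation that preserves both the rows and the columns of T is trivial, so only the identity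
    contributes. *)
Lemma polytabloid_tabloid_of : polytabloid C T (tabloid_of T) = 1.
Proof.
rewrite /polytabloid sum_ffunE (bigD1 1%g) ?col_stab1 //= odd_perm1 scale1r big1
  ?addr0.
  rewrite ffunE; case: eqP => // - []; apply/ffunP=> k;
    rewrite !ffunE invg1 perm1 //.
move=> s /andP[/col_stabV/col_stabP hs s1]; rewrite !ffunE; case: eqP => [e|_];
  last by rewrite [_ *: _]mulr0.
case/eqP: s1; apply: invg_inj; apply/permP => k; rewrite invg1 perm1;
  apply: Tinj.
rewrite [LHS]surjective_pairing [RHS]surjective_pairing hs; congr (_, _).
by have /ffunP/(_ k) := e; rewrite !ffunE.
Qed.

(** By linearity the image is a multiple of e_T. The factor is found by pairing with the tabloid of
    T, whose coefficient in e_T is 1, and moving the self-adjoint antisymmetrizer to the other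
    side. *)
Lemma col_antisym_multiple (v : tabloid_space C n)
  : (forall u, v u != 0 -> content u = la) ->
  col_antisym T v = form v (polytabloid C T) *: polytabloid C T.
Proof.
move=> hv; have [c e] : exists c, col_antisym T v = c *: polytabloid C T.
  rewrite [v]tabloid_decomp raddf_sum /=; elim/big_ind: _ =>
    [|x y [a ->] [b ->]|u _].
  - by exists 0; rewrite scale0r.
  - by exists (a + b); rewrite scalerDl.
  rewrite linearZ /=; have [->|/hv/col_antisym_same_content[c ->]] :=
    eqVneq (v u) 0.
    by exists 0; rewrite !scale0r.
  by exists (v u * c); rewrite scalerA.
rewrite e; congr (_ *: _).
have : form (col_antisym T v) (tabloid_vec C (tabloid_of T)) =
  form v (polytabloid C T).
  by rewrite form_col_antisym polytabloidE.
by rewrite e form_vec ffunE polytabloid_tabloid_of => <-; rewrite [RHS]mulr1.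
Qed.

End Fixed.
End TableauxOfShape.

(** * Nondegeneracy and independence of standard polytabloids *)

Section SpechtModules.
Variables (C : numClosedFieldType) (n : nat).
Local Notation V := (tabloid_space C n).
Local Notation tableau := {ffun 'I_n -> 'I_n * 'I_n}.
Local Notation shape := {ffun 'I_n -> 'I_n.+1}.
Implicit Types (T : tableau) (u w : tabloid n) (la : shape) (s : 'S_n).

Lemma is_tableauP la T : partn la ->
  reflect (injective T /\ forall k, in_shape la (T k))
    (is_tableau (seq_of_shape la) T).
Proof.
move=> pla; have dE c : (c \in diagram n (seq_of_shape la)) = in_shape la c.
  by rewrite inE nth_seq_of_shape.
apply: (iffP andP) => [[/injectiveP iT /forallP h]|[iT h]].
  by split=> // k; rewrite -dE.
by split; [apply/injectiveP | apply/forallP=> k; rewrite dE].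
Qed.

Lemma Specht_ind mu (P : V -> Prop) :
  P 0 -> (forall a f g, P f -> P g -> P (a *: f + g)) ->
  (forall T, is_tableau mu T -> P (polytabloid C T)) ->
  forall v, v \in Specht C n mu -> P v.
Proof.
set X := [seq polytabloid C T | T <- enum (is_tableau mu)].
move=> P0 PD PT v; rewrite /Specht -/X => /(@coord_span _ _ _ (in_tuple X)) ->;
  elim/big_ind: _ => // [f g Pf Pg|i _].
  by rewrite -[f]scale1r; apply: PD.
rewrite -[_ *: _]addr0; apply: PD => //.
have : X`_i \in X by apply: mem_nth.
by case/mapP=> T; rewrite mem_enum => hT ->; apply: PT.
Qed.

Lemma polytabloid_Specht mu T : is_tableau mu T ->
  polytabloid C T \in Specht C n mu.
Proof. by move=> hT; apply: memv_span; apply: map_f; rewrite mem_enum. Qed.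

Lemma polytabloid_support T u : polytabloid C T u != 0 ->
  exists2 s, s \in col_stab T & u = tabloid_perm s (tabloid_of T).
Proof.
rewrite /polytabloid sum_ffunE => /eqP nz.
have [s hs nzs] : exists2 s, s \in col_stab T &
    ((-1) ^+ s *: tabloid_vec C (tabloid_of (tableau_perm s T))) u != 0.
  apply: contrapT => no; apply: nz; rewrite big1 // => s hs;
    apply/eqP/negPn/negP => h.
  by apply: no; exists s.
exists s^-1%g; first exact: col_stabV.
move: nzs; rewrite tableau_perm_act tabloid_act_vec !ffunE.
by case: (u =P _) => [->//|_]; rewrite scaler0 eqxx.
Qed.

Lemma Specht_content la v u : partn la -> size_shape la = n ->
  v \in Specht C n (seq_of_shape la) -> v u != 0 -> content u = la.
Proof.
move=> pla sla; elim/Specht_ind: v / =>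
  [|a f g Pf Pg|T /(is_tableauP _ pla)[iT hT]].
- by rewrite ffunE eqxx.
- rewrite !ffunE; have [->|/Pf //] := eqVneq (f u) 0;
    rewrite [_ *: _]mulr0 add0r; exact: Pg.
by move=> /polytabloid_support[s _ ->];
  rewrite content_perm (content_tableau sla iT hT).
Qed.

Lemma tabloid_act_polytabloid s T :
  tabloid_act s (polytabloid C T) = polytabloid C (tableau_perm s T).
Proof.
rewrite !polytabloidE /col_antisym raddf_sum /= tableau_perm_act.
rewrite [RHS](reindex_inj (conjg_inj s)) /=; apply: eq_big => [t|t ht].
  apply/col_stabP/col_stabP => ht k.
    by rewrite !ffunE conjgE !permM permK ht.
  by have := ht (s k); rewrite !ffunE conjgE !permM !permK.
rewrite linearZ /= odd_permJ -!tabloid_actM; congr (_ *: tabloid_act _ _).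
by rewrite conjgE mulgA mulgA mulgV mul1g.
Qed.

Lemma tableau_transitive la T T' : partn la -> size_shape la = n ->
  is_tableau (seq_of_shape la) T -> is_tableau (seq_of_shape la) T' ->
  exists s, T' = tableau_perm s T.
Proof.
move=> pla sla /(is_tableauP _ pla)[iT hT] /(is_tableauP _ pla)[iT' hT'].
pose f k := odflt k [pick l | T l == T' k].
have fE k : T (f k) = T' k.
  rewrite /f; case: pickP => [l /eqP //|no].
  have [l Tl] := tableau_onto sla iT hT (hT' k).
  by have := no l; rewrite Tl eqxx.
have f_inj : injective f by move=> k l e; apply: iT'; rewrite -!fE e.
by exists (perm f_inj)^-1%g; apply/ffunP=> k; rewrite ffunE invgK permE fE.
Qed.

Lemma conj_polytabloid T u : (polytabloid C T u)^* = polytabloid C T u.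
Proof.
rewrite /polytabloid sum_ffunE rmorph_sum; apply: eq_bigr => s _.
by rewrite !ffunE rmorphM rmorph_sign /= conjC_nat.
Qed.

(** Polytabloids equal their conjugates, so v is orthogonal to the conjugate of every vector of the
    module. For v itself this says that the sum of the |v u|^2 vanishes. *)
Lemma Specht_nondegenerate mu v : v \in Specht C n mu ->
  (forall T, is_tableau mu T -> form v (polytabloid C T) = 0) -> v = 0.
Proof.
move=> hv h0; pose cj (f : V) : V := [ffun u => (f u)^*].
have : form v (cj v) = 0.
  apply: (@Specht_ind mu (fun f => form v (cj f) = 0)) hv =>
    [|a f g Pf Pg|T hT].
  - by rewrite /form big1 // => u _; rewrite !ffunE rmorph0 mulr0.
  - have -> : cj (a *: f + g) = a^* *: cj f + cj g by apply/ffunP=> u;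
      rewrite !ffunE rmorphD rmorphM.
    by rewrite linearP /= Pf Pg mulr0 addr0.
  - rewrite -[RHS](h0 T hT); congr form; apply/ffunP=> u; rewrite ffunE;
      exact: conj_polytabloid.
rewrite /form => /eqP; rewrite psumr_eq0 => [|u _]; last
  by rewrite ffunE -normCK exprn_ge0.
move/allP => h; apply/ffunP=> u; have := h u (mem_index_enum _).
by rewrite ffunE -normCK expf_eq0 normr_eq0 => /eqP ->; rewrite ffunE.
Qed.

(* The standard tableau whose entry k lies in row w k; the default value of
   insubd is never used, see ballot_tableauE. *)
Definition ballot_tableau w : tableau :=
  [ffun k => (w k, insubd k (count_lt w k (w k)))].

Lemma count_lt_leq w k i : (count_lt w k i <= k)%N.
Proof.
have [kn|kn] := leqP n k; first exact: leq_trans (count_lt_le _ _ _) kn.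
apply: (@leq_trans (\sum_(l < n | (l < k)%N) 1)); last
  by rewrite sum1_card card_ord_lt // ltnW.
by apply: leq_sum => l _; case: (_ == _).
Qed.

Lemma ballot_tableauE w k : (ballot_tableau w k).2 = count_lt w k (w k) :> nat.
Proof. by rewrite ffunE val_insubd (leq_ltn_trans (count_lt_leq _ _ _)). Qed.

Lemma count_lt_mono w k l i : (k <= l)%N ->
  (count_lt w k i <= count_lt w l i)%N.
Proof.
move=> kl; rewrite /count_lt big_mkcond [leqRHS]big_mkcond; apply: leq_sum =>
  j _.
by case: (ltnP j k) => // jk; rewrite (leq_trans jk kl).
Qed.

Lemma count_ltS w (k : 'I_n) i : count_lt w k.+1 i =
  (count_lt w k i + (w k == i))%N.
Proof.
rewrite /count_lt (bigD1 k) //= addnC; congr (_ + _)%N.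
by apply: eq_bigl => l; rewrite ltnS ltn_neqAle andbC.
Qed.

Lemma ballot_tableau_inj w : injective (ballot_tableau w).
Proof.
move=> k l e; apply: contrapT => /eqP kl.
wlog lt : k l e kl / (k < l)%N.
  move=> H; case: (ltngtP k l) => [| |/val_inj/eqP]; [exact: H| |exact/negP].
  by apply: H; rewrite // eq_sym.
have e2 := congr1 (fun c => nat_of_ord c.2) e;
  rewrite /= !ballot_tableauE in e2.
have e1 := congr1 fst e; rewrite !ffunE /= in e1.
have := count_lt_mono w (w k) lt; by rewrite count_ltS eqxx e2 e1 addn1 ltnn.
Qed.

Lemma ballot_tableau_in_shape w k : in_shape (content w) (ballot_tableau w k).
Proof.
rewrite /in_shape ballot_tableauE contentE // ffunE /=.
apply: leq_trans (count_lt_mono w (w k) (ltn_ord k)).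
by rewrite count_ltS eqxx addn1.
Qed.

Lemma size_contentn w : size_shape (content w) = n.
Proof. exact: size_content. Qed.

Lemma ballot_tableauP w : ballot w ->
  is_tableau (seq_of_shape (content w)) (ballot_tableau w).
Proof.
move=> bw; apply/is_tableauP; first exact: ballot_partn bw.
by split; [apply: ballot_tableau_inj | apply: ballot_tableau_in_shape].
Qed.

(** Columns increase downwards: if l < k, the prefix that ends at position l would contain more
    letters w l than letters w k, although w k < w l. *)
Lemma ballot_tableau_col_mono w k l : ballot w ->
  (ballot_tableau w k).2 = (ballot_tableau w l).2 ->
  (w k < w l)%N -> (k < l)%N.
Proof.
move=> bw /(congr1 (@nat_of_ord _)); rewrite !ballot_tableauE => e lt.
rewrite ltnNge; apply/negP => lk.
have {lk} : (l < k)%N by rewrite ltn_neqAle lk andbT; apply: contraTneq lt =>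
  /val_inj ->; rewrite ltnn.
move=> /(count_lt_mono w (w k)); rewrite e.
have /forallP/(_ (Ordinal (ltn_ord l : (l.+1 < n.+1)%N)))/antitoneP/(_ _ _
  (ltnW lt)) := bw.
by rewrite /= !count_ltS eqxx; case: eqP => [->|_]; lia.
Qed.

(** Digits in base n with the last entry most significant: tabloids are compared at the largest
    entry whose rows differ. *)
Definition tabloid_code u : nat := (\sum_k u k * n ^ k)%N.

Lemma tabloid_code_lt u w (k : 'I_n)
  : (forall l : 'I_n, (k < l)%N -> u l = w l) ->
  (u k < w k)%N -> (tabloid_code u < tabloid_code w)%N.
Proof.
move=> above lt.
have split x : tabloid_code x = (\sum_(l < n | (l < k)%N) x l * n ^ l
  + x k * n ^ k + \sum_(l < n | (k < l)%N) x l * n ^ l)%N.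
  rewrite /tabloid_code (bigID (fun l : 'I_n => (l < k)%N)) /= -addnA;
    congr (_ + _)%N.
  rewrite (bigD1 k) /= ?ltnn //; congr (_ + _)%N; apply: eq_bigl => l.
  by rewrite -leqNgt ltn_neqAle eq_sym andbC.
rewrite !split (eq_bigr (fun l : 'I_n => w l * n ^ l)%N (P := fun l : 'I_n =>
  (k < l)%N)) => [|l kl]; last by rewrite above.
rewrite ltn_add2r; apply: (@leq_trans (n ^ k + u k * n ^ k)); last first.
  by rewrite -mulSn (leq_trans _ (leq_addl _ _)) // leq_mul2r lt orbT.
rewrite ltn_add2r.
apply: (@leq_ltn_trans (\sum_(l < n | (l < k)%N) n.-1 * n ^ l)%N).
  by apply: leq_sum => l _;
    rewrite leq_mul2r -ltnS prednK ?ltn_ord ?orbT //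
    (leq_ltn_trans _ (ltn_ord l)).
have n0 : (0 < n)%N by apply: leq_ltn_trans (ltn_ord k).
rewrite -(big_ord_widen n (fun l => n.-1 * n ^ l)%N (ltnW (ltn_ord k)))
  -big_distrr /= -predn_exp.
by rewrite ltn_predL expn_gt0 n0.
Qed.

(** Let k0 be the largest entry whose rows in u and w differ. If its row in u were the larger one,
    the column permutation s would send k0 to a lower cell of its column, hence to an entry greater
    than k0; but s fixes all of these. *)
Lemma polytabloid_ballot_code w u : ballot w ->
  polytabloid C (ballot_tableau w) u != 0 ->
  u != w -> (tabloid_code u < tabloid_code w)%N.
Proof.
move=> bw /polytabloid_support[s /col_stabP hs ->] nw.
set u' := tabloid_perm _ _ in nw *.
have uE k : u' k = w (s k) by rewrite !ffunE.
have /existsP[k1 hk1] : [exists k, u' k != w k].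
  rewrite -negb_forall; apply: contra nw => /forallP h; apply/eqP/ffunP=> k;
    exact/eqP.
pose k0 := [arg max_(k > k1 | u' k != w k) (k : nat)].
have [nk0 k0max] : u' k0 != w k0 /\ forall k, u' k != w k -> (k <= k0)%N.
  by rewrite /k0; case: arg_maxnP.
have above (l : 'I_n) : (k0 < l)%N -> u' l = w l.
  by move=> lt; apply/eqP; apply: contraTT lt => /k0max; rewrite -leqNgt.
apply: (tabloid_code_lt above); rewrite ltnNge; apply/negP => le.
have {le} lt : (w k0 < w (s k0))%N.
  rewrite ltn_neqAle -uE le andbT; by apply: contra nk0 => /eqP/val_inj ->.
have k0s := ballot_tableau_col_mono bw (esym (hs k0)) lt.
(* Beyond k0 the entry s l lies in the row and in the column of l, hence in the same cell. *)
have fixs (l : 'I_n) : (k0 < l)%N -> s l = l.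
  move=> kl; apply: (@ballot_tableau_inj w); have := above l kl; rewrite uE =>
    e.
  by rewrite [LHS]surjective_pairing [RHS]surjective_pairing hs !ffunE /= e.
by have /perm_inj e := fixs _ k0s; rewrite e ltnn in k0s.
Qed.

(** Triangularity for [tabloid_code]: w has coefficient 1 in its own polytabloid and is its largest
    tabloid, so a w of largest code with d w <> 0 occurs in no other term. Words of all shapes are
    treated at once. *)
Lemma ballot_polytabloid_independent (d : tabloid n -> C) :
  \sum_(w | ballot w) d w *: polytabloid C (ballot_tableau w) = 0 ->
  forall w, ballot w -> d w = 0.
Proof.
move=> d0 w1 bw1; apply: contrapT => /eqP nz.
have P1 : ballot w1 && (d w1 != 0) by rewrite bw1.
pose w0 := [arg max_(w > w1 | ballot w && (d w != 0)) tabloid_code w].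
have [/andP[bw0 nz0] w0max] : ballot w0 && (d w0 != 0) /\
    forall w, ballot w && (d w != 0) -> (tabloid_code w <= tabloid_code w0)%N.
  by rewrite /w0; case: arg_maxnP.
have /eqP := congr1 (fun f : V => f w0) d0;
  rewrite /= sum_ffunE (bigD1 w0) //= big1 => [|w /andP[bw nw]].
  rewrite addr0 !ffunE.
  have -> : polytabloid C (ballot_tableau w0) w0 = 1.
    have e : w0 = tabloid_of (ballot_tableau w0) by apply/ffunP=> k;
      rewrite !ffunE.
    rewrite {2}e; apply: (polytabloid_tabloid_of C).
    exact: ballot_tableau_inj.
  by rewrite [_ *: _]mulr1 (negPf nz0).
rewrite ffunE; have [->|dw] := eqVneq (d w) 0; first by rewrite [_ *: _]mul0r.
have [->|pw] := eqVneq (polytabloid C (ballot_tableau w) w0) 0; first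
  by rewrite [_ *: _]mulr0.
have := polytabloid_ballot_code bw pw; rewrite eq_sym => /(_ nw).
by rewrite ltnNge w0max // bw.
Qed.

End SpechtModules.

(** * Decomposition of the regular representation *)

Section RegularRepresentation.
Variables (C : numClosedFieldType) (n : nat).
Local Notation V := (tabloid_space C n).
Local Notation tableau := {ffun 'I_n -> 'I_n * 'I_n}.
Local Notation shape := {ffun 'I_n -> 'I_n.+1}.
Implicit Types (T : tableau) (u w : tabloid n) (la : shape) (s : 'S_n).

Definition ballot_vec w : V := polytabloid C (ballot_tableau w).

Definition shape_Specht w : {vspace V} := Specht C n (seq_of_shape (content w)).

(* The adjoint of the morphism from the group algebra to the sum of the Specht
   modules that sends s to the family (s e_w)_w. *)
Definition theta (v : tabloid n -> V) s : C :=
  \sum_(w | ballot w) form (tabloid_act s (v w)) (ballot_vec w).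

Lemma theta_act v s t : theta (fun w => tabloid_act s (v w)) t =
  theta v (s * t)%g.
Proof. by apply: eq_bigr => w _; rewrite tabloid_actM. Qed.

Lemma thetaP a v1 v2 s :
  theta (fun w => a *: v1 w + v2 w) s = a * theta v1 s + theta v2 s.
Proof.
rewrite /theta mulr_sumr -big_split; apply: eq_bigr => w _ /=.
by rewrite linearP formDl formZl.
Qed.

(* Apply the column antisymmetrizer of a tableau T whose shape is extremal among
   those with v w <> 0: the components of the other shapes vanish and those of
   the same shape become multiples of the polytabloid e_T. *)
Lemma theta_inj v : (forall w, ballot w -> v w \in shape_Specht w) ->
  (forall s, theta v s = 0) -> forall w, ballot w -> v w = 0.
Proof.
move=> hv h0 w1 bw1; apply: contrapT => /eqP nz.
have P1 : ballot w1 && (v w1 != 0) by rewrite bw1.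
pose w0 := [arg max_(w > w1 | ballot w && (v w != 0)) row_sum w].
have [/andP[bw0 nz0] w0max] : ballot w0 && (v w0 != 0) /\
    forall w, ballot w && (v w != 0) -> (row_sum w <= row_sum w0)%N.
  by rewrite /w0; case: arg_maxnP.
have [la [pla sla cw0 lamax]] : exists la,
  [/\ partn la, size_shape la = n, content w0 = la
   & forall w, ballot w -> v w != 0 -> (row_sum w <= \sum_(i < n) i * la i)%N].
  exists (content w0); split; rewrite ?size_contentn ?(ballot_partn _ bw0) //.
  by move=> w bw nw; rewrite -row_sum_content w0max ?bw.
case/eqP: nz0; apply: (Specht_nondegenerate (hv _ bw0)); rewrite cw0 => T hT.
have [iT Tla] := is_tableauP T pla hT.
pose d w := if content w == la then form (v w) (polytabloid C T) else 0.
have colv w : ballot w -> col_antisym T (v w) = d w *: polytabloid C T.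
  move=> bw; have pw := ballot_partn (leqnn n) bw; rewrite /d; case: eqP =>
    [cw|/eqP cw].
    apply: (col_antisym_multiple pla sla iT Tla) => u nu; rewrite -cw.
    exact: (Specht_content pw (size_contentn w) (hv w bw) nu).
  rewrite scale0r; have [->|nw] := eqVneq (v w) 0; first by rewrite linear0.
  rewrite [v w]tabloid_decomp raddf_sum big1 // => u _ /=; rewrite linearZ /=.
  have [->|nu] := eqVneq (v w u) 0; first by rewrite scale0r.
  have cu := Specht_content pw (size_contentn w) (hv w bw) nu.
  rewrite (col_antisym_other_content _ pla sla iT Tla) ?scaler0 ?cu //.
  by rewrite row_sum_content cu -row_sum_content lamax.
(* The relation theta v = 0, antisymmetrized over the columns of T, says that [z] is orthogonal to
   every s e_T. These exhaust the polytabloids of shape la, so [z], which lies in their span,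
   vanishes; the independence of the e_w then gives d w0 = 0. *)
pose z := \sum_(w | ballot w) d w *: ballot_vec w.
have z_orth s : form (tabloid_act s (polytabloid C T)) z = 0.
  transitivity (theta (fun w => col_antisym T (v w)) s).
    rewrite /z raddf_sum; apply: eq_bigr => w bw /=.
    by rewrite colv // !linearZ /= formZl.
  transitivity (\sum_(t in col_stab T) (-1) ^+ t * theta v (t * s)%g).
    under [RHS]eq_bigr => t _ do rewrite -theta_act mulr_sumr.
    rewrite [RHS]exchange_big; apply: eq_bigr => w _ /=.
    rewrite /col_antisym [tabloid_act s _]raddf_sum /= form_suml;
      apply: eq_bigr => t _ /=.
    by rewrite linearZ formZl.
  by apply: big1 => t _; rewrite h0 mulr0.
have z0 : z = 0.
  apply: (@Specht_nondegenerate C n (seq_of_shape la)).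
    apply: memv_suml => w bw; rewrite /d; case: (content w =P la) => [<-|_];
      last by rewrite scale0r mem0v.
    by apply/memvZ/polytabloid_Specht/ballot_tableauP.
  move=> T' hT'; have [s ->] := tableau_transitive pla sla hT hT'.
  by rewrite -tabloid_act_polytabloid formC.
by have := ballot_polytabloid_independent z0 bw0; rewrite /d cw0 eqxx.
Qed.

Definition same_shape_pair (p : tabloid n * tabloid n) : bool :=
  [&& ballot p.1, ballot p.2 & content p.2 == content p.1].

(** Chain sums take their values in a commutative ring, hence the passage through [int]. *)
Lemma card_same_shape_pair : #|{: {p | same_shape_pair p}}| = n`!.
Proof.
rewrite card_sig -sum1_card.
rewrite (eq_bigl (fun p => ballot p.1
  && (ballot p.2 && (content p.2 == content p.1)))) //.
rewrite -(pair_big_dep (fun w => ballot w) (fun w w' =>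
  ballot w' && (content w' == content w)) (fun _ _ => 1%N)) /=.
apply/eqP; rewrite -eqz_nat -!natz -(sum_ballot_box_chains int (leqnn n))
  natr_sum; apply/eqP.
by apply: eq_bigr => w _; rewrite box_chains_count // sum1dep_card.
Qed.

(** A pair p gives a function on S_n, p.1 choosing the summand and p.2 a standard polytabloid in it.
    These n! functions are independent by [theta_inj] and the independence of the polytabloids,
    hence they span. *)
Lemma theta_surj (g : 'S_n -> C) : exists2 v : tabloid n -> V,
  (forall w, ballot w -> v w \in shape_Specht w) & forall s, g s = theta v s.
Proof.
pose v_of (c : {p | same_shape_pair p} -> C) w : V :=
  \sum_(p | (val p).1 == w) c p *: ballot_vec (val p).2.
have v_in c w : ballot w -> v_of c w \in shape_Specht w.
  move=> bw; apply: memv_suml => p /eqP <-; have /and3P[_ b2 /eqP e] := valP p.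
  by apply: memvZ; rewrite /shape_Specht -e;
    apply/polytabloid_Specht/ballot_tableauP.
have theta_v c s : \sum_p c p * form (tabloid_act s (ballot_vec (val p).2))
  (ballot_vec (val p).1) = theta (v_of c) s.
  rewrite (partition_big (fun p : {p | same_shape_pair p} =>
    (val p).1) (@ballot n n)) /=; last first.
    by move=> p _; have /and3P[] := valP p.
  apply: eq_bigr => w bw; rewrite /v_of [tabloid_act s _]raddf_sum /= form_suml;
    apply: eq_bigr => p /eqP <- /=.
  by rewrite linearZ formZl.
have card : #|{: {p | same_shape_pair p}}| = #|'S_n|
  by rewrite card_same_shape_pair card_Sn.
have [c hc j|c hc] := independent_spans (phi := fun p s =>
  form (tabloid_act s (ballot_vec (val p).2)) (ballot_vec (val p).1)) card _ g.
  have vc0 : forall w, ballot w -> v_of c w = 0.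
    by apply: theta_inj => [w|s]; [apply: v_in | rewrite -theta_v].
  have /and3P[b1 b2 /eqP e] := valP j.
  have := vc0 _ b1.
  pose d w := \sum_(p | val p == ((val j).1, w)) c p.
  have -> : v_of c (val j).1 = \sum_(w | ballot w) d w *: ballot_vec w.
    rewrite /v_of (partition_big (fun p : {p | same_shape_pair p} =>
      (val p).2) (@ballot n n)) /=; last first.
      by move=> p _; have /and3P[] := valP p.
    apply: eq_bigr => w _; rewrite scaler_suml; apply: eq_big =>
      [p|p /andP[_ /eqP <-] //].
    by rewrite -pair_eqE.
  move/ballot_polytabloid_independent => /(_ _ b2) <-.
  rewrite /d (bigD1 j) /=; last by rewrite -surjective_pairing.
  rewrite big1 ?addr0 // => p /andP[/eqP pj]; rewrite -surjective_pairing in pj.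
  by rewrite (val_inj pj) eqxx.
by exists (v_of c) => [w|s]; [apply: v_in | rewrite hc theta_v].
Qed.

End RegularRepresentation.

(** * The coinvariant algebra *)

Section CompleteHomogeneous.
Variable A : comNzRingType.
Implicit Types (s : seq A) (x : A) (k : nat).

(** The complete homogeneous symmetric polynomial h_k at the entries of s, expanded by the exponent
    of the first one. *)
Fixpoint hsym s k : A :=
  if s is x :: s' then \sum_(i < k.+1) x ^+ i * hsym s' (k - i) else
    (k == 0)%:R.

Lemma hsym_cons0 x s : hsym (x :: s) 0 = hsym s 0.
Proof. by rewrite /= big_ord1 mul1r. Qed.

Lemma hsym_consS x s k : hsym (x :: s) k.+1 = x * hsym (x :: s) k + hsym s k.+1.
Proof.
rewrite /= big_ord_recl mul1r subn0 addrC; congr (_ + _).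
rewrite mulr_sumr; apply: eq_bigr => i _.
by rewrite subSS exprS mulrA.
Qed.

Lemma hsym0 s : hsym s 0 = 1.
Proof. by elim: s => // x s IHs; rewrite hsym_cons0. Qed.

(** The identity E(-X) H(X) = 1 of generating functions, with H truncated after degree K in order to
    stay with polynomials. *)
Lemma coef_prod_hsym s K k : (k <= K)%N ->
  ((\prod_(x <- s) (1 - x%:P * 'X)) * \poly_(m < K.+1) hsym s m)`_k =
    (k == 0)%:R.
Proof.
elim: s k => [|x s IHs] k kK; first by rewrite big_nil mul1r coef_poly ltnS kK.
rewrite big_cons mulrAC mulrC -IHs // !coefM; apply: eq_bigr => j _;
  congr (_ * _).
have : (k - j <= K)%N by apply: leq_trans kK; apply: leq_subr.
move: (k - j)%N => l lK;
  rewrite mulrBl mul1r coefB -mulrA coefCM coefXM !coef_poly ltnS lK.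
case: l lK => [|l] lK; first by rewrite mulr0 subr0 hsym_cons0.
by rewrite ltnS (ltnW lK) hsym_consS /= addrC addKr.
Qed.

Lemma hsym_eq0 s : \prod_(x <- s) (1 - x%:P * 'X) = 1 -> forall k, (0 < k)%N ->
  hsym s k = 0.
Proof.
move=> s1 k k0; have := coef_prod_hsym s (leqnn k);
  rewrite s1 mul1r coef_poly ltnSn => ->.
by rewrite eqn0Ngt k0.
Qed.

(* That is, h_k(x_j, ..., x_(n-1)) = 0 for k > j. *)
Lemma hsym_drop_eq0 s : (forall k, (0 < k)%N -> hsym s k = 0) ->
  forall j k, (j < k)%N -> hsym (drop j s) k = 0.
Proof.
move=> h0; elim=> [|j IHj] [|k] //; rewrite ?drop0 => jk; first exact: h0.
case: (ltnP j (size s)) => js; last first.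
  by rewrite drop_oversize // (leq_trans js).
have := IHj k.+1 (ltnW jk);
  rewrite (drop_nth 0 js) hsym_consS -(drop_nth 0 js) IHj //.
by rewrite mulr0 add0r.
Qed.

(** Expanding the product over the subsets of the indices and grouping them by size gives the sum of
    the (-X)^k e_k, of which only k = 0 survives. *)
Lemma prod_esym (n : nat) (x : 'I_n -> A) :
  (forall k, (0 < k)%N -> \sum_(h : {set 'I_n} | #|h| == k) \prod_(i in h) x i =
    0) ->
  \prod_i (1 - (x i)%:P * 'X) = 1.
Proof.
move=> e0; under eq_bigr => i _ do rewrite addrC.
rewrite bigA_distr (partition_big (fun h : {set 'I_n} => inord #|h|
  : 'I_n.+1) xpredT) //=.
have cE (h : {set 'I_n}) : (inord #|h| : 'I_n.+1) = #|h| :> nat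
  by rewrite inordK // ltnS (leq_trans (max_card _)) ?card_ord.
have pE (h : {set 'I_n}) : \prod_i (if i \in h then - ((x i)%:P * 'X) else 1) =
  (- 'X) ^+ #|h| * (\prod_(i in h) x i)%:P.
  rewrite -big_mkcond /= rmorph_prod -prodr_const -big_split /=;
    apply: eq_bigr => i _.
  by rewrite mulNr mulrC.
have kE (k : 'I_n.+1)
  : \sum_(h : {set 'I_n} | (inord #|h| : 'I_n.+1) == k) \prod_i
  (if i \in h then - ((x i)%:P * 'X) else 1)
   = (- 'X) ^+ k * (\sum_(h : {set 'I_n} | #|h| == k) \prod_(i in h) x i)%:P.
  rewrite rmorph_sum mulr_sumr; apply: eq_big => [h|h /eqP hk]; first
    by rewrite -val_eqE /= cE.
  by rewrite pE -hk cE.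
rewrite (bigD1 ord0) //= kE [X in _ + X]big1 => [|k /negPf k0]; last first.
  by rewrite kE e0 ?mulr0 // lt0n -[X in _ != X]/(nat_of_ord (@ord0 n)) val_eqE
    k0.
rewrite addr0 expr0 mul1r (eq_bigl (pred1 set0)) => [|h]; last
  by rewrite cards_eq0.
by rewrite big_pred1_eq big_set0.
Qed.

End CompleteHomogeneous.

(** * Straightening monomials in the coinvariant algebra *)

Section Coinv.
Variables (C : numClosedFieldType) (n : nat).
Local Notation P := {mpoly C[n]}.
Local Notation R := (coinvariant C n).
Local Notation pi := (@coinv_proj C n).
Implicit Types (m : 'X_{1..n}) (p q : P) (x y : R).

Lemma coinv_proj_is_linear : linear pi.
Proof. by move=> a p q; rewrite coinv_projD coinv_projZ. Qed.
HB.instance Definition _ :=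
  GRing.isLinear.Build C P R _ pi coinv_proj_is_linear.

Lemma coinv_proj_is_monoid_morphism : monoid_morphism pi.
Proof. by split; [apply: coinv_proj1 | apply: coinv_projM]. Qed.
HB.instance Definition _ :=
  GRing.isMonoidMorphism.Build P R pi coinv_proj_is_monoid_morphism.

Lemma coinv_proj_eq0 p : pi p = 0 <-> p \in @coinv_ideal C n.
Proof. by rewrite -[p in p \in _]subr0 -coinv_projP linear0. Qed.

Lemma coinv_proj_mesym k : (0 < k)%N -> pi (mesym n C k) = 0.
Proof.
case: k => // k _; case: (ltnP k n) => kn; last by rewrite mesym_geqnE ?linear0.
apply/coinv_proj_eq0/coinv_idealP; exists (fun i =>
  if i == Ordinal kn then 1 else 0).
rewrite (bigD1 (Ordinal kn)) //= eqxx mul1r big1 ?addr0 // => i /negPf ->.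
by rewrite mul0r.
Qed.

Definition vars : seq R := [seq pi 'X_i | i <- enum 'I_n].

Lemma drop_vars (i : 'I_n) : drop i vars = pi 'X_i :: drop i.+1 vars.
Proof.
rewrite /vars (drop_nth 0); last by rewrite size_map size_enum_ord.
by rewrite (nth_map i) ?size_enum_ord // nth_ord_enum.
Qed.

Lemma hsym_vars_eq0 j k : (j < k)%N -> hsym (drop j vars) k = 0.
Proof.
apply: hsym_drop_eq0; apply: hsym_eq0; rewrite big_map big_enum /=;
  apply: prod_esym => l l0.
transitivity (pi (mesym n C l)); last exact: coinv_proj_mesym.
rewrite /mesym raddf_sum; apply: eq_bigr => h _ /=.
by rewrite rmorph_prod.
Qed.

(** Membership in the span of a set of monomial classes, given by a predicate on exponents: bounds
    on the degree, the prefix or single exponents can thus be carried through successive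
    reductions. *)
Definition mspan (Q : 'X_{1..n} -> Prop) x : Prop :=
  exists2 p, x = pi p & forall m, m \in msupp p -> Q m.

Lemma mspan0 Q : mspan Q 0.
Proof. by exists 0; rewrite ?linear0 // => m; rewrite msupp0. Qed.

Lemma mspanX (Q : _ -> Prop) m : Q m -> mspan Q (pi 'X_[m]).
Proof. by move=> Qm; exists 'X_[m] => // m'; rewrite msuppX inE => /eqP ->. Qed.

Lemma mspanD Q x y : mspan Q x -> mspan Q y -> mspan Q (x + y).
Proof.
move=> [p -> hp] [q -> hq]; exists (p + q); first by rewrite linearD.
by move=> m /msuppD_le; rewrite mem_cat => /orP[/hp|/hq].
Qed.

Lemma mspanZ Q a x : mspan Q x -> mspan Q (a *: x).
Proof.
by move=> [p -> hp]; exists (a *: p);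
  [rewrite linearZ | move=> m /msuppZ_le/hp].
Qed.

Lemma mspanN Q x : mspan Q x -> mspan Q (- x).
Proof. by rewrite -scaleN1r; apply: mspanZ. Qed.

Lemma mspan_sum Q (I : Type) (r : seq I) (T : pred I) (F : I -> R) :
  (forall i, T i -> mspan Q (F i)) -> mspan Q (\sum_(i <- r | T i) F i).
Proof. by move=> h; elim/big_ind: _ => //; [apply: mspan0 | apply: mspanD]. Qed.

Lemma mspan_sub (Q Q' : _ -> Prop) x : (forall m, Q m -> Q' m) -> mspan Q x ->
  mspan Q' x.
Proof. by move=> h [p -> hp]; exists p => // m /hp/h. Qed.

Lemma mspan_bind (Q Q' : _ -> Prop) x :
  mspan Q x -> (forall m, Q m -> mspan Q' (pi 'X_[m])) -> mspan Q' x.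
Proof.
move=> [p -> hp] h; rewrite [p]mpolyE raddf_sum big_seq; apply: mspan_sum =>
  m mp.
by rewrite /= linearZ; apply/mspanZ/h/hp.
Qed.

Lemma mspanM (Q1 Q2 Q : _ -> Prop) x y :
  (forall m1 m2, Q1 m1 -> Q2 m2 -> Q (m1 + m2)%MM) -> mspan Q1 x ->
    mspan Q2 y -> mspan Q (x * y).
Proof.
move=> h [p -> hp] [q -> hq]; exists (p * q); first by rewrite rmorphM.
by move=> m /msuppM_le/allpairsP[[m1 m2] /= [/hp h1 /hq h2 ->]]; apply: h.
Qed.

Lemma hsym_mspan j k : mspan (fun m => mdeg m = k /\ forall l : 'I_n,
  (l < j)%N -> m l = 0%N)
  (hsym (drop j vars) k).
Proof.
move: {2}(n - j)%N (erefl (n - j)%N) => d; elim: d j k => [|d IHd] j k dE.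
  rewrite drop_oversize /=; last
    by rewrite /vars size_map size_enum_ord -subn_eq0 dE.
  case: eqP => [->|_]; last exact: mspan0.
  rewrite -coinv_proj1 -mpolyX0; apply: mspanX; rewrite mdeg0; split=> // l _;
    exact: mnm0E.
have jn : (j < n)%N by rewrite -subn_gt0 dE.
rewrite (drop_vars (Ordinal jn)) [hsym _ _]/=; apply: mspan_sum => i _.
have ik : (i <= k)%N by rewrite -ltnS.
rewrite -rmorphXn /= mpolyXn;
  apply: mspanM (mspanX (erefl (U_(Ordinal jn) *+ i)%MM)) (IHd _ _ _); last
  by rewrite subnS dE.
move=> _ m2 <- [d2 s2]; split=> [|l lj].
  by rewrite mdegD mdegMn mdeg1 mul1n d2 subnKC.
rewrite mnmDE mulmnE mnm1E s2 ?(leqW lj) // addn0.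
by rewrite (_ : _ == l = false) ?mul0n //; apply/eqP => e;
  rewrite -e ltnn in lj.
Qed.
Definition is_staircase m : Prop := forall l : 'I_n, (m l <= l)%N.

(** The relation h_(i+1)(x_i, x_(i+1), ...) = 0 solved for its top power of x_i. *)
Lemma pow_var (i : 'I_n) : pi 'X_i ^+ i.+1 =
  - \sum_(k < i.+1) pi 'X_i ^+ k * hsym (drop i.+1 vars) (i.+1 - k).
Proof.
have := hsym_vars_eq0 (ltnSn i);
  rewrite drop_vars /= big_ord_recr /= subnn hsym0 mulr1.
by move=> /eqP; rewrite addrC addr_eq0 => /eqP.
Qed.

(** Rewriting x_j^(j+1) by [pow_var] keeps the degree and the exponents before j, lowers that of x_j
    and raises only later ones. Hence a double induction, on the number of variables from j on and
    on the exponent of x_j. *)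
Lemma staircase_reduction j m : (forall l : 'I_n, (l < j)%N -> (m l <= l)%N) ->
  mspan (fun m' => [/\ is_staircase m', forall l : 'I_n, (l < j)%N ->
    m' l = m l & mdeg m' = mdeg m])
    (pi 'X_[m]).
Proof.
move: {2}(n - j)%N (erefl (n - j)%N) => d; elim: d j m => [|d IHd] j m dE hm.
  apply: mspanX; split=> // l; apply: hm; apply: leq_trans (ltn_ord l) _.
  by rewrite -subn_eq0 dE.
have jn : (j < n)%N by rewrite -subn_gt0 dE.
pose i := Ordinal jn.
have [b] := ubnP (m i); elim: b m hm => // b IHb m hm; rewrite ltnS => mb.
have [mi|mi] := leqP (m i) i.
  apply: mspan_sub (IHd j.+1 m _ _) => [m' [h1 h2 h3]||l lj].
  - by split=> // l lj; apply/h2/ltnW.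
  - by rewrite subnS dE.
  - move: lj; rewrite ltnS leq_eqVlt => /orP[/eqP lj|]; last exact: hm.
    by rewrite (_ : l = i) //; apply: val_inj.
pose m0 := (m - U_(i) *+ i.+1)%MM.
have mE : m = (m0 + U_(i) *+ i.+1)%MM.
  apply/mnmP=> l; rewrite mnmDE mnmBE mulmnE mnm1E.
  by case: eqP => [<-|_]; rewrite ?mul1n ?mul0n ?subn0 ?addn0 ?subnK.
have -> : pi 'X_[m] = pi 'X_[m0] * pi 'X_i ^+ i.+1
  by rewrite {1}mE mpolyXD -mpolyXn rmorphM rmorphXn.
rewrite pow_var mulrN; apply: mspanN.
rewrite mulr_sumr; apply: mspan_sum => k _;
  rewrite -rmorphXn /= mpolyXn mulrA -rmorphM /= -mpolyXD.
have ki : (k <= i)%N by rewrite -ltnS.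
apply: mspan_bind (mspanM (Q := fun m' => [/\ mdeg m' = mdeg m, (m' i < m i)%N &
   forall l : 'I_n, (l < j)%N -> m' l = m l]) _ (mspanX (erefl _))
     (hsym_mspan i.+1 (i.+1 - k))) _.
  move=> _ m2 <- [d2 s2]; split=> [||l lj].
  - rewrite [in RHS]mE !mdegD !mdegMn mdeg1 !mul1n d2 -addnA; congr (_ + _)%N.
    by rewrite subnKC // ltnW.
  - rewrite !mnmDE mnmBE !mulmnE mnm1E eqxx !mul1n s2 // addn0.
    by rewrite -[ltnRHS](subnK mi) ltn_add2l.
  - rewrite !mnmDE mnmBE !mulmnE mnm1E s2 ?(leqW lj) // addn0.
    by rewrite (_ : i == l = false) ?mul0n ?subn0 ?addn0 //; apply/eqP => e;
      rewrite -e ltnn in lj.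
move=> m' [dm' im' pm']; apply: mspan_sub (IHb m' _ _) =>
  [m'' [h1 h2 h3]|l lj|].
- by split=> // [l lj|]; rewrite ?h2 ?pm' // h3.
- by rewrite pm' // hm.
- exact: leq_trans im' mb.
Qed.

Section MaxExchange.
Variables (i : 'I_n.-1) (m0 : 'X_{1..n}).
Local Notation l := (left_pos i).
Local Notation r := (right_pos i).
Hypotheses (m0l : m0 l = 0%N) (m0r : m0 r = 0%N) (m0_staircase
  : is_staircase m0).

Definition two_exp (a b : nat) : 'X_{1..n} := (m0 + U_(l) *+ a + U_(r) *+ b)%MM.

Lemma left_neq_right : (l == r) = false.
Proof. by apply/eqP => /(congr1 (@nat_of_ord _)) /= /n_Sn. Qed.

Lemma two_exp_l a b : two_exp a b l = a.
Proof.
by rewrite !mnmDE !mulmnE !mnm1E eqxx eq_sym left_neq_right m0l mul1n mul0n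
  addn0.
Qed.

Lemma two_exp_r a b : two_exp a b r = b.
Proof. by rewrite !mnmDE !mulmnE !mnm1E eqxx left_neq_right m0r mul1n mul0n.
  Qed.

Lemma two_exp_other a b j : j != l -> j != r -> two_exp a b j = m0 j.
Proof.
by move=> /negPf jl /negPf jr;
  rewrite !mnmDE !mulmnE !mnm1E ![_ == j]eq_sym jl jr !mul0n !addn0.
Qed.

Lemma two_exp_prefix a b (j : 'I_n) : (j < i)%N -> two_exp a b j = m0 j.
Proof.
move=> ji; apply: two_exp_other; apply/eqP => /(congr1 (@nat_of_ord _)) /= e.
  by rewrite e ltnn in ji.
by rewrite e ltnNge leqnSn in ji.
Qed.

(* The class of x^m0 x_i^(i+1) x_(i+1)^a is expanded by h_(i+1)(x_i, ...) = 0;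
   among the terms with exponent k0 in x_i, one dominates. *)
Lemma max_exchange (a k0 : nat) : (a <= k0 <= i)%N ->
  mspan (fun m' => [/\ is_staircase m', forall j : 'I_n, (j < i)%N ->
    m' j = m0 j
     & m' l <> k0 \/ (m' r < a + (i.+1 - k0))%N])
   (pi 'X_[two_exp i.+1 a] + pi 'X_[two_exp k0 (a + (i.+1 - k0))]).
Proof.
case/andP=> ak ki; set Q := fun m' => _.
have XE k b : pi 'X_[two_exp k b] = pi 'X_[two_exp 0 b] * pi 'X_l ^+ k.
  rewrite -rmorphXn /= mpolyXn -rmorphM /= -mpolyXD; congr (pi 'X_[_]).
  by apply/mnmP=> j; rewrite /two_exp mulm0n addm0 !mnmDE addnAC.
have XrE k b c : pi 'X_[two_exp k (b + c)] = pi 'X_[two_exp k b] * pi 'X_r ^+ c.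
  rewrite -rmorphXn /= mpolyXn -rmorphM /= -mpolyXD; congr (pi 'X_[_]).
  by apply/mnmP=> j; rewrite !mnmDE !mulmnE mulnDr addnA.
have k0i : (k0 < i.+1)%N by rewrite ltnS.
rewrite XE (pow_var l) mulrN mulr_sumr (bigD1 (Ordinal k0i)) //= opprD addrAC.
apply: mspanD; last first.
  (* For k <> k0 the factor h(x_(i+1), ...) involves later variables only, and the reduction from
     index i + 1 on keeps the exponent k of x_i. *)
  apply/mspanN/mspan_sum => k nk; rewrite mulrA -XE.
  apply: mspan_bind (mspanM (Q := fun m' => forall j : 'I_n, (j <= i)%N ->
    m' j = two_exp k a j)
    _ (mspanX (erefl _)) (hsym_mspan i.+1 (i.+1 - k))) _.
    by move=> _ m2 <- [_ s2] j ji; rewrite mnmDE s2 ?addn0.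
  move=> m' hm'; apply: mspan_sub (staircase_reduction (j := i.+1) _) =>
    [m'' [h1 h2 _]|j ji].
    split=> // [j ji|]; first by rewrite h2 ?hm' ?two_exp_prefix // ltnW.
    left; rewrite h2 ?hm' ?two_exp_l //= => e; case/eqP: nk; exact: val_inj.
  rewrite hm' //; move: ji; rewrite ltnS leq_eqVlt => /orP[/eqP ji|ji].
    by rewrite (_ : j = l) ?two_exp_l -1?ltnS //; apply: val_inj.
  by rewrite two_exp_prefix.
set d := (i.+1 - k0)%N; have -> : drop i.+1 vars = pi 'X_r :: drop i.+2 vars :=
  drop_vars r.
(* The term k = k0 is split by the powers of x_(i+1). The top power d cancels the second monomial of
   the statement; a lower power b leaves the exponent a + b < a + d, which the reduction from index
   i + 2 on keeps. *)
rewrite [hsym _ _]/= big_ord_recr /= subnn hsym0 mulr1 mulrDr mulrDr opprD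
  -addrA.
rewrite XrE [pi 'X_[two_exp k0 a]]XE -mulrA addNr addr0 mulr_sumr mulr_sumr.
apply/mspanN/mspan_sum => b _; rewrite mulrA -XE mulrA -XrE.
have bd : (a + b < i.+1)%N.
  apply: (@leq_trans (a + d)); first by rewrite ltn_add2l.
  by rewrite /d (addnBA _ (leqW ki)) leq_subLR leq_add2r.
apply: mspan_bind (mspanM (Q := fun m' => forall j : 'I_n, (j <= i.+1)%N ->
  m' j = two_exp k0 (a + b) j)
    _ (mspanX (erefl _)) (hsym_mspan i.+2 (d - b))) _.
  by move=> _ m2 <- [_ s2] j ji; rewrite mnmDE s2 ?addn0.
move=> m' hm'; apply: mspan_sub (staircase_reduction (j := i.+2) _) =>
  [m'' [h1 h2 _]|j ji].
  split=> // [j ji|]; first by rewrite h2 ?hm' ?two_exp_prefix // ltnW // ltnW.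
  by right; rewrite h2 ?hm' ?two_exp_r // ltn_add2l.
rewrite hm' //; move: ji; rewrite ltnS leq_eqVlt => /orP[/eqP ji|].
  by rewrite (_ : j = r) ?two_exp_r 1?ltnW //; apply: val_inj.
rewrite ltnS leq_eqVlt => /orP[/eqP ji|ji].
  by rewrite (_ : j = l) ?two_exp_l //; apply: val_inj.
by rewrite two_exp_prefix.
Qed.

End MaxExchange.
End Coinv.

(** * Evaluation on the orbit of (0, 1, ..., n - 1) *)

Section Evaluation.
Variables (C : numClosedFieldType) (n : nat).
Local Notation P := {mpoly C[n]}.
Local Notation R := (coinvariant C n).
Local Notation pi := (@coinv_proj C n).
Implicit Types (m : 'X_{1..n}) (p q : P) (x y : R) (s w : 'S_n) (a
  : staircase n).

Definition deg_lt (d : nat) p : Prop := forall m, m \in msupp p ->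
  (mdeg m < d)%N.

Lemma deg_lt0 d : deg_lt d 0.
Proof. by move=> m; rewrite msupp0. Qed.

Lemma deg_ltD d p q : deg_lt d p -> deg_lt d q -> deg_lt d (p + q).
Proof. by move=> hp hq m /msuppD_le; rewrite mem_cat => /orP[/hp|/hq]. Qed.

Lemma deg_ltZ d c p : deg_lt d p -> deg_lt d (c *: p).
Proof. by move=> hp m /msuppZ_le/hp. Qed.

Lemma deg_ltN d p : deg_lt d p -> deg_lt d (- p).
Proof. by rewrite -scaleN1r; apply: deg_ltZ. Qed.

Lemma deg_ltX d m : (mdeg m < d)%N -> deg_lt d 'X_[m].
Proof. by move=> md m'; rewrite msuppX inE => /eqP ->. Qed.

Lemma deg_lt_sum d (I : Type) (r : seq I) (T : pred I) (F : I -> P) :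
  (forall i, T i -> deg_lt d (F i)) -> deg_lt d (\sum_(i <- r | T i) F i).
Proof. by move=> h; elim/big_ind: _ => //;
  [apply: deg_lt0 | apply: deg_ltD]. Qed.

Lemma deg_lt_msym d s p : deg_lt d p -> deg_lt d (msym s p).
Proof. by move=> hp m; rewrite mcoeff_msupp mcoeff_sym -mcoeff_msupp => /hp;
  rewrite mdeg_mperm. Qed.

Lemma deg_lt_exists p : exists d, deg_lt d p.
Proof. by exists (msize p) => m; apply: msize_mdeg_lt. Qed.

Lemma deg_lt0P p : deg_lt 0 p -> p = 0.
Proof.
move=> hp; apply: msuppnil0; case e : (msupp p) => [//|m r].
by have := hp m; rewrite e mem_head => /(_ isT).
Qed.

Lemma mdeg_mesym k m : m \in msupp (mesym n C k) -> mdeg m = k.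
Proof. by have /dhomogP h := dhomog_mesym n C k; apply: h. Qed.

(** Truncate the coefficients q_k at degree d - k. Since e_(k+1) is homogeneous, the discarded parts
    contribute only monomials of degree greater than d; their sum equals a polynomial without such
    monomials, and so is 0. *)
Lemma coinv_ideal_deg p d : p \in @coinv_ideal C n -> deg_lt d.+1 p ->
  exists2 q : 'I_n -> P, p = \sum_(k < n) q k * mesym n C k.+1 & forall k,
    deg_lt d (q k).
Proof.
move=> /coinv_idealP[q pE] hp.
pose q1 k := \sum_(m <- msupp (q k) | (mdeg m < d - k)%N) (q k)@_m *: 'X_[m].
pose q2 k := \sum_(m <- msupp (q k) | ~~ (mdeg m < d - k)%N) (q k)@_m *: 'X_[m].
have qE k : q k = q1 k + q2 k
  by rewrite {1}[q k]mpolyE (bigID (fun m => mdeg m < d - k)%N).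
have deg1 (k : 'I_n) : deg_lt (d - k) (q1 k) by apply: deg_lt_sum => m hm;
  apply/deg_ltZ/deg_ltX.
have deg2 (k : 'I_n) m : m \in msupp (q2 k) -> (d - k <= mdeg m)%N.
  move: m; rewrite /q2; elim/big_ind: _ => [m|p1 p2 h1 h2 m|m1 h m].
  - by rewrite msupp0.
  - by move=> /msuppD_le; rewrite mem_cat => /orP[/h1|/h2].
  - by move=> /msuppZ_le; rewrite msuppX inE => /eqP ->; rewrite leqNgt.
exists q1; last by move=> k m /deg1 lt; apply: leq_trans lt (leq_subr _ _).
apply/eqP; rewrite -subr_eq0; apply/eqP/msuppnil0; case e : (msupp _) =>
  [//|m r]; exfalso.
have hm : m \in msupp (p - \sum_(k < n) q1 k * mesym n C k.+1)
  by rewrite e mem_head.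
have : (mdeg m < d.+1)%N.
  apply: (deg_ltD hp _ hm); apply/deg_ltN/deg_lt_sum =>
    k _ m' /msuppM_le/allpairsP[[m1 m2] /= [/deg1 h1 /mdeg_mesym h2 ->]].
  by rewrite mdegD h2 addnS ltnS addnC -ltn_subRL.
rewrite ltnNge => /negP[]; move: hm.
have -> : p - \sum_(k < n) q1 k * mesym n C k.+1 =
  \sum_(k < n) q2 k * mesym n C k.+1.
  by rewrite pE -sumrB; apply: eq_bigr => k _; rewrite -mulrBl qE addrC addKr.
move: m {e}; elim/big_ind: _ => [m|p1 p2 h1 h2 m|k _ m].
- by rewrite msupp0.
- by move=> /msuppD_le; rewrite mem_cat => /orP[/h1|/h2].
move=> /msuppM_le/allpairsP[[m1 m2] /= [/deg2 h1 /mdeg_mesym h2 ->]].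
by rewrite mdegD h2 addnS ltnS addnC -leq_subLR.
Qed.

Definition ev w p : C := p.@[fun i => (w i)%:R].

Lemma ev_is_linear w : linear_for *%R (ev w).
Proof. by move=> c p q; rewrite /ev mevalD mevalZ. Qed.
HB.instance Definition _ w :=
  GRing.isLinear.Build C P C _ (ev w) (ev_is_linear w).

Lemma evM w p q : ev w (p * q) = ev w p * ev w q.
Proof. exact: mevalM. Qed.

Lemma ev_msym w s p : ev w (msym s p) = ev (s * w)%g p.
Proof.
rewrite /ev [in LHS](mpolyE p) [msym s _]raddf_sum /= [in RHS](mpolyE p)
  !raddf_sum.
apply: eq_bigr => m _ /=; rewrite msymZ !mevalZ msymX !mevalX; congr (_ * _).
rewrite [LHS](reindex_inj (@perm_inj _ s)) /=; apply: eq_bigr => i _.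
by rewrite mnmE permK permM.
Qed.

Lemma ev_mesym w k : ev w (mesym n C k) = ev 1%g (mesym n C k).
Proof. by rewrite -{1}(mulg1 w) -ev_msym (issymP _ (mesym_sym n C k)). Qed.

(** Lagrange interpolation: [D w] vanishes at all points of the orbit except that of w. *)
Lemma ev_surj (g : 'S_n -> C) : exists p, forall w, ev w p = g w.
Proof.
pose D w : P := \prod_(i < n) \prod_(c < n | c != w i) ('X_i - (c%:R)%:MP).
have evD w w' : ev w (D w') = \prod_(i < n) \prod_(c < n | c != w' i)
  ((w i)%:R - c%:R).
  rewrite /ev /D rmorph_prod; apply: eq_bigr => i _; rewrite rmorph_prod;
    apply: eq_bigr => c _.
  by rewrite /= mevalB mevalXU mevalC.
have evDne w w' : w != w' -> ev w (D w') = 0.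
  move=> ne; have /existsP[i hi] : [exists i, w i != w' i].
    by rewrite -negb_forall; apply: contra ne => /forallP h; apply/eqP/permP =>
      i; apply/eqP.
  by rewrite evD (bigD1 i) //= (bigD1 (w i)) //= subrr !mul0r.
have evD0 w : ev w (D w) != 0.
  rewrite evD; apply/prodf_neq0 => i _; apply/prodf_neq0 => c ci.
  by rewrite subr_eq0 eqr_nat eq_sym.
exists (\sum_w (g w / ev w (D w)) *: D w) => w.
rewrite raddf_sum (bigD1 w) //= linearZ /= divfK ?evD0 // big1 ?addr0 // =>
  w' nw.
by rewrite linearZ /= (evDne w w') ?mulr0 // eq_sym.
Qed.

Local Notation mon a := ('X_[staircase_mnm a] : P).

Lemma staircase_mnmE a i : staircase_mnm a i = a i.
Proof. exact: mnmE. Qed.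

Lemma staircase_mnm_inj : injective (@staircase_mnm n).
Proof.
move=> a b /mnmP e; apply/ffunP => i; apply: val_inj; have := e i.
by rewrite !staircase_mnmE.
Qed.

Lemma staircase_mnmP a : is_staircase (staircase_mnm a).
Proof. by move=> l; rewrite staircase_mnmE -ltnS. Qed.

Lemma is_staircaseP m : is_staircase m -> exists a, m = staircase_mnm a.
Proof.
move=> hm; exists [ffun i : 'I_n => (inord (m i) : 'I_i.+1)].
by apply/mnmP=> i; rewrite staircase_mnmE ffunE inordK // ltnS.
Qed.

Lemma mspan_staircase (Q : _ -> Prop) x : mspan Q x ->
  (forall m, Q m -> is_staircase m) ->
  exists2 c : {ffun staircase n -> C}, x = \sum_a c a *: staircase_basis C a
    & forall a, c a != 0 -> Q (staircase_mnm a).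
Proof.
move=> [p -> hp] hQ; exists [ffun a => p@_(staircase_mnm a)]; last first.
  by move=> a; rewrite ffunE -mcoeff_msupp => /hp.
rewrite {1}[p]mpolyE raddf_sum (bigID (fun m => m \in msupp p)) /= [X in _
  + X]big_seq_cond.
rewrite [X in _ + X]big1 ?addr0 => [|m /andP[->]//].
rewrite [RHS](bigID (fun a => staircase_mnm a \in msupp p)) /= [X in _ = _
  + X]big1 ?addr0; last first.
  by move=> a; rewrite ffunE -mcoeff_eq0 => /eqP ->; rewrite scale0r.
have -> : \sum_(m <- msupp p | m \in msupp p) pi (p@_m *: 'X_[m]) =
  \sum_(m <- msupp p) pi (p@_m *: 'X_[m]).
  by rewrite [RHS]big_seq.
have pm : perm_eq (msupp p) [seq staircase_mnm a
  | a <- enum [pred a | staircase_mnm a \in msupp p]].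
  apply: uniq_perm; rewrite ?msupp_uniq //.
    by rewrite map_inj_uniq ?enum_uniq //; apply: staircase_mnm_inj.
  move=> m; apply/idP/mapP => [mp|[a]]; last by rewrite mem_enum inE => h ->.
  have [a mE] := is_staircaseP (hQ _ (hp _ mp)).
  by exists a => //; rewrite mem_enum inE -mE.
rewrite (perm_big _ pm) big_map big_enum /=; apply: eq_bigr => a _.
by rewrite ffunE linearZ.
Qed.

Lemma card_staircase : #|staircase n| = #|'S_n|.
Proof.
rewrite card_Sn card_dep_ffun fact_prod big_add1 big_mkord.
rewrite foldrE big_image /=; apply: eq_bigr => i _; exact: card_ord.
Qed.

Lemma deg_lt_reduction d p : deg_lt d p ->
  mspan (fun m => is_staircase m /\ (mdeg m < d)%N) (pi p).
Proof.
move=> hp; have h : mspan (fun m => (mdeg m < d)%N) (pi p) by exists p.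
apply: (mspan_bind h) => m md.
have /(@staircase_reduction C) r : forall l : 'I_n, (l < 0)%N -> (m l <= l)%N
  by [].
by apply: (mspan_sub _ r) => m' [h1 _ ->].
Qed.

Lemma staircase_spans_deg d p : deg_lt d p ->
  exists2 c : staircase n -> C, pi p = \sum_a c a *: staircase_basis C a
    & forall a, c a != 0 -> (mdeg (staircase_mnm a) < d)%N.
Proof.
move=> /deg_lt_reduction/mspan_staircase[m []//|c pE hc].
by exists c => // a /hc[].
Qed.

Lemma sum_mon_deg d (c : staircase n -> C) :
  (forall a, c a != 0 -> (mdeg (staircase_mnm a) < d)%N) ->
    deg_lt d (\sum_a c a *: mon a).
Proof.
move=> hc; apply: deg_lt_sum => a _; have [->|/hc h] := eqVneq (c a) 0.
  by rewrite scale0r; apply: deg_lt0.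
exact/deg_ltZ/deg_ltX.
Qed.

Lemma pi_sum_mon (c : staircase n -> C)
  : pi (\sum_a c a *: mon a) = \sum_a c a *: staircase_basis C a.
Proof. by rewrite raddf_sum; apply: eq_bigr => a _ /=; rewrite linearZ. Qed.

(* Modulo the ideal of the orbit, e_k is a constant, so that q_k e_k has
   a smaller degree than in the coinvariant ideal. *)
Lemma ev_ideal_deg d p : p \in @coinv_ideal C n -> deg_lt d.+1 p ->
  exists2 q, deg_lt d q & forall w, ev w p = ev w q.
Proof.
move=> pI /(coinv_ideal_deg pI)[q -> hq].
exists (\sum_(k < n) ev 1%g (mesym n C k.+1) *: q k).
  by apply: deg_lt_sum => k _; apply: deg_ltZ.
move=> w; rewrite !raddf_sum; apply: eq_bigr => k _ /=.
by rewrite linearZ /= evM ev_mesym mulrC.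
Qed.

(** Induction on the degree: p minus its reduction in the coinvariant algebra lies in the ideal,
    hence agrees on the orbit with a polynomial of smaller degree. *)
Lemma ev_staircase d p : deg_lt d p ->
  exists2 c : staircase n -> C, forall a, c a != 0 ->
    (mdeg (staircase_mnm a) < d)%N
    & forall w, ev w p = \sum_a c a * ev w (mon a).
Proof.
elim: d p => [|d IHd] p hp.
  exists (fun=> 0) => [a|w]; first by rewrite eqxx.
  by rewrite (deg_lt0P hp) linear0 big1 // => a _; rewrite mul0r.
have [c pE hc] := staircase_spans_deg hp.
have [||q hq ev_q] := @ev_ideal_deg d (p - \sum_a c a *: mon a).
- by apply/coinv_proj_eq0; rewrite linearB /= pi_sum_mon pE subrr.
- by apply: deg_ltD hp (deg_ltN (sum_mon_deg hc)).
have [c' hc' c'E] := IHd q hq.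
exists (fun a => c a + c' a) => [a|w].
  have [->|/hc //] := eqVneq (c a) 0; rewrite add0r => /hc' h; exact: ltnW.
have := ev_q w; rewrite c'E linearB /= => /eqP; rewrite subr_eq => /eqP ->.
rewrite raddf_sum addrC -big_split; apply: eq_bigr => a _ /=.
by rewrite linearZ mulrDl.
Qed.

Lemma ev_mon_independent (c : staircase n -> C) :
  (forall w, \sum_a c a * ev w (mon a) = 0) -> forall a, c a = 0.
Proof.
apply: (spans_independent card_staircase) => g.
have [p pE] := ev_surj g; have [d hp] := deg_lt_exists p.
have [c' _ c'E] := ev_staircase hp.
by exists c' => w; rewrite -pE c'E.
Qed.

(** On the orbit, a relation whose top degree is that of a0 becomes a polynomial of smaller degree,
    hence a combination c' of monomials of smaller degree. Independence on the orbit gives c = c',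
    but c' vanishes at a0. *)
Lemma staircase_independent (c : staircase n -> C) :
  \sum_a c a *: staircase_basis C a = 0 -> forall a, c a = 0.
Proof.
move=> c0 a1; apply: contrapT => /eqP nz.
pose a0 := [arg max_(a > a1 | c a != 0) mdeg (staircase_mnm a)].
have [nz0 a0max] : c a0 != 0 /\ forall a, c a != 0 ->
  (mdeg (staircase_mnm a) <= mdeg (staircase_mnm a0))%N.
  by rewrite /a0; case: arg_maxnP.
have [||q hq ev_q] :=
  @ev_ideal_deg (mdeg (staircase_mnm a0)) (\sum_a c a *: mon a).
- by apply/coinv_proj_eq0; rewrite pi_sum_mon.
- exact: sum_mon_deg.
have [c' hc' c'E] := ev_staircase hq.
have cc : forall a, c a - c' a = 0.
  apply: ev_mon_independent => w;
    rewrite -[RHS](subrr (ev w q)) -{1}ev_q c'E raddf_sum -sumrB.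
  by apply: eq_bigr => a _; rewrite mulrBl /= linearZ.
have /eqP := cc a0; rewrite subr_eq0 => /eqP e; rewrite e in nz0.
by have := hc' _ nz0; rewrite ltnn.
Qed.

Lemma staircase_is_basis : is_basis (@staircase_basis C n).
Proof.
move=> x; have [d hd] := deg_lt_exists (coinv_repr x).
have [c] := staircase_spans_deg hd; rewrite coinv_reprK => xE _.
exists [ffun a => c a]; split.
  by rewrite xE; apply: eq_bigr => a _; rewrite ffunE.
move=> c' xE'; apply/ffunP=> a; rewrite ffunE.
apply/eqP; rewrite -subr_eq0; apply/eqP; move: a.
apply: (staircase_independent (c := fun a => c a - c' a)).
rewrite -[RHS](subrr x) {1}xE xE' -sumrB; apply: eq_bigr => a _;
  exact: scalerBl.
Qed.

Definition coord x : {ffun staircase n -> C} :=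
  projT1 (cid (staircase_is_basis x)).

Lemma coordE x : x = \sum_a coord x a *: staircase_basis C a.
Proof. by rewrite /coord; case: cid => c []. Qed.

Lemma coord_unique x (c : staircase n -> C)
  : x = \sum_a c a *: staircase_basis C a ->
  forall a, coord x a = c a.
Proof.
move=> xE a; rewrite /coord; case: cid => c' /= [_ /(_ [ffun a => c a]) ->];
  first by rewrite ffunE.
by rewrite xE; apply: eq_bigr => b _; rewrite ffunE.
Qed.

Lemma coordP k x y a : coord (k *: x + y) a = k * coord x a + coord y a.
Proof.
apply: (coord_unique (c := fun a => k * coord x a + coord y a)).
rewrite {1}[x]coordE {1}[y]coordE scaler_sumr -big_split; apply: eq_bigr =>
  b _ /=.
by rewrite scalerDl scalerA.
Qed.

Lemma coord_basis a b : coord (staircase_basis C a) b = (b == a)%:R.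
Proof.
apply: (coord_unique (c := fun b => (b == a)%:R)).
by rewrite (bigD1 a) //= eqxx scale1r big1 ?addr0 // => b' /negPf ->;
  rewrite scale0r.
Qed.

Lemma coord_inj x y : (forall a, coord x a = coord y a) -> x = y.
Proof. by move=> e; rewrite [x]coordE [y]coordE; apply: eq_bigr => a _;
  rewrite e. Qed.

Definition staircase_lift x : P := \sum_a coord x a *: mon a.

Lemma staircase_liftK x : pi (staircase_lift x) = x.
Proof. by rewrite pi_sum_mon -coordE. Qed.

Lemma staircase_lift_is_linear : linear staircase_lift.
Proof.
move=> k x y; rewrite /staircase_lift scaler_sumr -big_split; apply: eq_bigr =>
  a _ /=.
by rewrite coordP scalerDl scalerA.
Qed.
HB.instance Definition _ :=
  GRing.isLinear.Build C R P _ staircase_lift staircase_lift_is_linear.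

Lemma staircase_lift_deg d p : deg_lt d p -> deg_lt d (staircase_lift (pi p)).
Proof.
move=> /staircase_spans_deg[c pE hc]; apply: sum_mon_deg => a.
by rewrite (coord_unique pE); apply: hc.
Qed.

Lemma coinv_act_is_linear s : linear (@coinv_act C n s).
Proof.
move=> k x y; rewrite -[x]coinv_reprK -[y]coinv_reprK -linearP !coinv_act_proj
  -linearP.
by congr (pi _); rewrite msymD msymZ.
Qed.
HB.instance Definition _ s :=
  GRing.isLinear.Build C R R _ (@coinv_act C n s) (coinv_act_is_linear s).

Lemma coinv_actM s w x : coinv_act (s * w)%g x = coinv_act w (coinv_act s x).
Proof. by rewrite -[x]coinv_reprK !coinv_act_proj msymMm. Qed.

Lemma coinv_act1 x : coinv_act 1%g x = x.
Proof. by rewrite -[x]coinv_reprK coinv_act_proj msym1m. Qed.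

Lemma coinv_is_Sn_module : is_Sn_module (@coinv_act C n).
Proof. by split; [apply: coinv_act_is_linear | apply: coinv_act1
  | apply: coinv_actM]. Qed.

(* n! times an equivariant section of the projection, obtained by averaging. *)
Definition sym_lift x : P :=
  \sum_s msym s (staircase_lift (coinv_act s^-1%g x)).

Lemma sym_liftK x : pi (sym_lift x) = n`!%:R *: x.
Proof.
rewrite raddf_sum (eq_bigr (fun=> x)) => [|s _]; last first.
  by rewrite /= -coinv_act_proj staircase_liftK -coinv_actM mulVg coinv_act1.
by rewrite sumr_const card_Sn scaler_nat.
Qed.

Lemma sym_lift_is_linear : linear sym_lift.
Proof.
move=> k x y; rewrite /sym_lift scaler_sumr -big_split; apply: eq_bigr =>
  s _ /=.
by rewrite !linearP.
Qed.
HB.instance Definition _ :=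
  GRing.isLinear.Build C R P _ sym_lift sym_lift_is_linear.

Lemma sym_lift_act s x : sym_lift (coinv_act s x) = msym s (sym_lift x).
Proof.
rewrite /sym_lift raddf_sum (reindex_inj (mulIg s)); apply: eq_bigr => w _ /=.
by rewrite -coinv_actM invMg mulgA mulgV mul1g msymMm.
Qed.

Definition orbit_map x w : C := ev w (sym_lift x).

Lemma orbit_map_act s x w : orbit_map (coinv_act s x) w = orbit_map x (s * w)%g.
Proof. by rewrite /orbit_map sym_lift_act ev_msym. Qed.

Lemma orbit_mapP k x y w : orbit_map (k *: x + y) w = k * orbit_map x w
  + orbit_map y w.
Proof. by rewrite /orbit_map !linearP. Qed.

Lemma orbit_mapD x y w : orbit_map (x + y) w = orbit_map x w + orbit_map y w.
Proof. by rewrite /orbit_map !linearD. Qed.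

(** Induction on the degree: p and [sym_lift x] differ by an element of the ideal, which agrees on
    the orbit with a polynomial of smaller degree. The factor 1 / n! in x undoes that of
    [sym_liftK]. *)
Lemma orbit_map_surj_deg d p : deg_lt d p -> exists x, forall w,
  orbit_map x w = ev w p.
Proof.
elim: d p => [|d IHd] p hp.
  by exists 0 => w; rewrite /orbit_map (deg_lt0P hp) !linear0.
pose x := n`!%:R^-1 *: pi p.
have nf0 : n`!%:R != 0 :> C by rewrite pnatr_eq0 -lt0n fact_gt0.
have [||q hq ev_q] := @ev_ideal_deg d (p - sym_lift x).
- by apply/coinv_proj_eq0;
    rewrite linearB /= sym_liftK scalerA divff // scale1r subrr.
- apply: (deg_ltD hp); apply/deg_ltN/deg_lt_sum => s _; apply: deg_lt_msym.
  by rewrite /x -linearZ coinv_act_proj;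
    apply/staircase_lift_deg/deg_lt_msym/deg_ltZ.
have [y yE] := IHd q hq; exists (x + y) => w.
have := ev_q w; rewrite -yE linearB /= -/(orbit_map x w) => /eqP;
  rewrite subr_eq => /eqP ->.
rewrite orbit_mapD; exact: addrC.
Qed.

Lemma orbit_map_surj (g : 'S_n -> C) : exists x, forall w, orbit_map x w = g w.
Proof.
have [p pE] := ev_surj g; have [d hp] := deg_lt_exists p.
by have [x xE] := orbit_map_surj_deg hp; exists x => w; rewrite xE pE.
Qed.

Lemma orbit_map_sum (c : staircase n -> C) w :
  orbit_map (\sum_a c a *: staircase_basis C a) w =
    \sum_a c a * orbit_map (staircase_basis C a) w.
Proof.
rewrite /orbit_map [sym_lift _]raddf_sum [ev w _]raddf_sum; apply: eq_bigr =>
  a _ /=.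
by rewrite !linearZ.
Qed.

(** Surjectivity makes the images of the n! basis monomials span the functions on the n!
    permutations, so they are independent. *)
Lemma orbit_map_inj x : (forall w, orbit_map x w = 0) -> x = 0.
Proof.
move=> x0; have sp (g : 'S_n -> C) : exists c, forall w,
  g w = \sum_a c a * orbit_map (staircase_basis C a) w.
  have [y yE] := orbit_map_surj g; exists (coord y) => w.
  by rewrite -yE {1}[y]coordE orbit_map_sum.
rewrite [x]coordE big1 // => a _.
rewrite (spans_independent card_staircase sp (c := coord x)) ?scale0r // => w.
by rewrite -orbit_map_sum -coordE.
Qed.

Lemma coinvariant_regular : exists f : R -> 'S_n -> C,
  [/\ forall k x y w, f (k *: x + y) w = k * f x w + f y w,
      forall s x w, f (coinv_act s x) w = f x (s * w)%g,
      forall x, (forall w, f x w = 0) -> x = 0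
    & forall g, exists x, forall w, f x w = g w].
Proof.
exists orbit_map; split;
  [exact: orbit_mapP | exact: orbit_map_act | exact: orbit_map_inj |].
exact: orbit_map_surj.
Qed.

End Evaluation.

(** * The 0-Hecke action on sub-staircase monomials *)

Lemma seqlexi_first_diff (s t : seq nat) i : (i < size s)%N -> (i < size t)%N ->
  (forall j, (j < i)%N -> nth 0%N s j = nth 0%N t j) ->
    (nth 0%N s i < nth 0%N t i)%N ->
  ((s : seqlexi nat) <= (t : seqlexi nat))%O.
Proof.
elim: i s t => [|i IHi] [|x s] [|y t] //= si ti e lt.
  by rewrite lexi_cons leEnat (ltnW lt) /= leqNgt lt.
have /= xy := e 0%N isT; rewrite lexi_cons xy lexx /=; apply: (IHi s t) =>
  // j ji.
exact: (e j.+1).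
Qed.

Section StaircaseOrder.
Variable n : nat.
Implicit Types a b : staircase n.
Local Notation le := (@staircase_lex n).

Lemma nth_staircase_mnm a (i : 'I_n) : nth 0%N (staircase_mnm a) i = a i.
Proof. by rewrite -(tnth_nth 0%N) -[LHS]/(staircase_mnm a i) staircase_mnmE.
  Qed.

Lemma staircase_lex_prefix a b (i : 'I_n)
  : (forall j : 'I_n, (j < i)%N -> a j = b j :> nat) ->
  (a i < b i)%N -> le a b.
Proof.
move=> e lt; apply: (@seqlexi_first_diff _ _ i); rewrite ?size_tuple //.
  move=> j ji; have jn := ltn_trans ji (ltn_ord i).
  by rewrite !(nth_staircase_mnm _ (Ordinal jn)) e.
by rewrite !nth_staircase_mnm.
Qed.

Lemma staircase_lex_total_order : total_order le.
Proof.
split; [exact: (fun a => lexx _) | | exact: (fun b a c =>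
  @le_trans _ (seqlexi nat) (staircase_mnm b) (staircase_mnm a)
  (staircase_mnm c)) | exact: (fun a b => le_total _ _)].
move=> a b h; apply: staircase_mnm_inj; apply/val_inj/val_inj;
  exact: (le_anti h).
Qed.
End StaircaseOrder.

Section ZeroHecke.
Variables (C : numClosedFieldType) (n : nat).
Local Notation R := (coinvariant C n).
Local Notation pi := (@coinv_proj C n).
Implicit Types (i j : 'I_n.-1) (m : 'X_{1..n}) (x y : R) (a b : staircase n).
Local Notation l := (@left_pos n).
Local Notation r := (@right_pos n).
Local Notation vf m := (pi 'X_[m]).

Definition pib_basis i a : R :=
  if a (l i) == a (r i) :> nat then 0 else
  if (a (l i) < a (r i))%N then - staircase_basis C a
  else coinv_act (simple_refl i) (staircase_basis C a).

Definition pib i x : R := \sum_a coord x a *: pib_basis i a.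

Lemma pib_is_linear i : linear (pib i).
Proof.
move=> k x y; rewrite /pib scaler_sumr -big_split; apply: eq_bigr => a _ /=.
by rewrite coordP scalerDl scalerA.
Qed.
HB.instance Definition _ i :=
  GRing.isLinear.Build C R R _ (pib i) (pib_is_linear i).

Lemma pib_staircase_basis i a : pib i (staircase_basis C a) = pib_basis i a.
Proof.
rewrite /pib (bigD1 a) //= coord_basis eqxx scale1r big1 ?addr0 // =>
  b /negPf nb.
by rewrite coord_basis nb scale0r.
Qed.

Definition swap_mnm i m : 'X_{1..n} := [multinom m (simple_refl i k) | k < n].

Lemma swap_l i m : swap_mnm i m (l i) = m (r i).
Proof. by rewrite mnmE tpermL. Qed.

Lemma swap_r i m : swap_mnm i m (r i) = m (l i).
Proof. by rewrite mnmE tpermR. Qed.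

Lemma swap_other i m k : k != l i -> k != r i -> swap_mnm i m k = m k.
Proof. by move=> kl kr; rewrite mnmE tpermD // eq_sym. Qed.

Lemma swap_prefix i m (k : 'I_n) : (k < i)%N -> swap_mnm i m k = m k.
Proof.
move=> ki; apply: swap_other; apply/eqP => /(congr1 (@nat_of_ord _)) /= e.
  by rewrite e ltnn in ki.
by rewrite e ltnNge leqnSn in ki.
Qed.

Lemma swap_staircase i m : is_staircase m -> (m (r i) <= i)%N ->
  is_staircase (swap_mnm i m).
Proof.
move=> hm mr k; have [->|kl] := eqVneq k (l i); first by rewrite swap_l.
have [->|kr] := eqVneq k (r i); last by rewrite swap_other.
by rewrite swap_r (leq_trans (hm _)) //= ltnW.
Qed.

Lemma coinv_act_vf i m : coinv_act (simple_refl i) (vf m) = vf (swap_mnm i m).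
Proof. by rewrite coinv_act_proj msymX tpermV. Qed.

Lemma pib_eq i m : is_staircase m -> m (l i) = m (r i) -> pib i (vf m) = 0.
Proof.
move=> /is_staircaseP[a ->]; rewrite !staircase_mnmE => e.
by rewrite -/(staircase_basis C a) pib_staircase_basis /pib_basis e eqxx.
Qed.

Lemma pib_lt i m : is_staircase m -> (m (l i) < m (r i))%N ->
  pib i (vf m) = - vf m.
Proof.
move=> /is_staircaseP[a ->]; rewrite !staircase_mnmE => lt.
by rewrite -/(staircase_basis C a) pib_staircase_basis /pib_basis lt
  (ltn_eqF lt).
Qed.

Lemma pib_gt i m : is_staircase m -> (m (r i) < m (l i))%N ->
  pib i (vf m) = vf (swap_mnm i m).
Proof.
move=> /is_staircaseP[a ->]; rewrite !staircase_mnmE => lt.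
rewrite -/(staircase_basis C a) pib_staircase_basis /pib_basis (gtn_eqF lt).
by rewrite ltnNge (ltnW lt) /= coinv_act_vf.
Qed.

Lemma swap_gt_staircase i m : is_staircase m -> (m (r i) < m (l i))%N ->
  is_staircase (swap_mnm i m).
Proof. by move=> hm lt; apply: swap_staircase => //;
  apply: leq_trans (ltnW lt) (hm _). Qed.

Lemma basis_eq_linear (f g : {linear R -> R}) :
  (forall m, is_staircase m -> f (vf m) = g (vf m)) -> forall x, f x = g x.
Proof.
move=> e x; rewrite [x]coordE !raddf_sum; apply: eq_bigr => a _ /=.
by rewrite !linearZ /= e //; apply: staircase_mnmP.
Qed.

Lemma pib_quadratic i x : pib i (pib i x) = - pib i x.
Proof.
apply: (basis_eq_linear (f := pib i \o pib i) (g := -%R \o pib i)) => m hm /=.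
have [lt|gt|e] := ltngtP (m (l i)) (m (r i)).
- by rewrite !(pib_lt hm lt) linearN /= (pib_lt hm lt).
- by rewrite (pib_gt hm gt) pib_lt ?swap_l ?swap_r //; apply: swap_gt_staircase.
- by rewrite (pib_eq hm e) !linear0.
Qed.

Lemma pib_commute i j x : (i.+1 < j)%N -> pib i (pib j x) = pib j (pib i x).
Proof.
move=> ij; apply: (basis_eq_linear (f := pib i \o pib j) (g := pib j \o pib i))
  => m hm /=.
have ne (c d : 'I_n) : (c < d)%N -> c != d by move=> lt; apply/eqP => e;
  rewrite e ltnn in lt.
have ll : l i != l j by apply: ne => /=; lia.
have lr : l i != r j by apply: ne => /=; lia.
have rl : r i != l j by apply: ne.
have rr : r i != r j by apply: ne => /=; lia.
have vi m' : swap_mnm j m' (l i) = m' (l i) by rewrite swap_other.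
have vi' m' : swap_mnm j m' (r i) = m' (r i) by rewrite swap_other.
have vj m' : swap_mnm i m' (l j) = m' (l j) by rewrite swap_other // eq_sym.
have vj' m' : swap_mnm i m' (r j) = m' (r j) by rewrite swap_other // eq_sym.
have swI : swap_mnm i (swap_mnm j m) = swap_mnm j (swap_mnm i m).
  apply/mnmP=> k; have [->|k1] := eqVneq k (l i); first
    by rewrite vi !swap_l vi'.
  have [->|k2] := eqVneq k (r i); first by rewrite vi' !swap_r vi.
  have [->|k3] := eqVneq k (l j); first by rewrite vj !swap_l vj'.
  have [->|k4] := eqVneq k (r j); first by rewrite vj' !swap_r vj.
  by rewrite !swap_other.
have [lti|gti|ei] := ltngtP (m (l i)) (m (r i)); have [ltj|gtj|ej] :=
  ltngtP (m (l j)) (m (r j)).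
- by rewrite (pib_lt hm lti) (pib_lt hm ltj) !linearN /= (pib_lt hm lti)
    (pib_lt hm ltj).
- by rewrite (pib_lt hm lti) (pib_gt hm gtj) linearN /= (pib_gt hm gtj) pib_lt
    ?vi ?vi' //; apply: swap_gt_staircase.
- by rewrite (pib_lt hm lti) (pib_eq hm ej) linearN /= (pib_eq hm ej) !linear0.
- by rewrite (pib_gt hm gti) (pib_lt hm ltj) linearN /= (pib_gt hm gti) pib_lt
    ?vj ?vj' //; apply: swap_gt_staircase.
- by rewrite (pib_gt hm gti) (pib_gt hm gtj) !pib_gt ?vi ?vi' ?vj ?vj' ?swI //;
    apply: swap_gt_staircase.
- by rewrite (pib_gt hm gti) (pib_eq hm ej) linear0 pib_eq ?vj ?vj' //;
    apply: swap_gt_staircase.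
- by rewrite (pib_eq hm ei) (pib_lt hm ltj) linearN /= (pib_eq hm ei) !linear0.
- by rewrite (pib_eq hm ei) (pib_gt hm gtj) linear0 pib_eq ?vi ?vi' //;
    apply: swap_gt_staircase.
- by rewrite (pib_eq hm ei) (pib_eq hm ej) !linear0.
Qed.

(** Only the exponents at i, i + 1 and i + 2 matter. On the monomials [F a b c] the operators act as
    sorting steps: a descent is exchanged, an ascent changes the sign and equal exponents give 0. *)
Lemma pib_braid i j x : j = i.+1 :> nat ->
  pib i (pib j (pib i x)) = pib j (pib i (pib j x)).
Proof.
move=> ij; apply: (basis_eq_linear (f := pib i \o pib j \o pib i) (g :=
  pib j \o pib i \o pib j)) => m hm /=.
have lj : l j = r i by apply: val_inj; rewrite /= ij.
have ne (c d : 'I_n) : (c < d)%N -> c != d by move=> lt; apply/eqP => e;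
  rewrite e ltnn in lt.
have pq : l i != r i by apply: ne.
have pr : l i != r j by apply: ne => /=; lia.
have qr : r i != r j by apply: ne => /=; lia.
pose upd (a b c : nat) : 'X_{1..n} :=
  [multinom if k == l i then a else if k == r i then b else if k == r j then c
    else m k | k < n].
have updp (a b c : nat) : upd a b c (l i) = a by rewrite mnmE eqxx.
have updq (a b c : nat) : upd a b c (r i) = b
  by rewrite mnmE eq_sym (negPf pq) eqxx.
have updr (a b c : nat) : upd a b c (r j) = c
  by rewrite mnmE ![r j == _]eq_sym (negPf pr) (negPf qr) eqxx.
have updo (a b c : nat) k : k != l i -> k != r i -> k != r j ->
  upd a b c k = m k.
  by move=> /negPf h1 /negPf h2 /negPf h3; rewrite mnmE h1 h2 h3.
have swi (a b c : nat) : swap_mnm i (upd a b c) = upd b a c.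
  apply/mnmP=> k; have [->|kp] := eqVneq k (l i); first
    by rewrite swap_l updp updq.
  have [->|kq] := eqVneq k (r i); first by rewrite swap_r updp updq.
  rewrite swap_other //; have [->|kr] := eqVneq k (r j); first by rewrite !updr.
  by rewrite !updo.
have swj (a b c : nat) : swap_mnm j (upd a b c) = upd a c b.
  apply/mnmP=> k; have [->|kq] := eqVneq k (r i).
    by rewrite -[X in swap_mnm _ _ X]lj swap_l updr updq.
  have [->|kr] := eqVneq k (r j); first by rewrite swap_r lj updr updq.
  rewrite swap_other ?lj //; have [->|kp] := eqVneq k (l i); first
    by rewrite !updp.
  by rewrite !updo.
have st (a b c : nat) : (a <= i)%N -> (b <= i.+1)%N -> (c <= i.+2)%N ->
  is_staircase (upd a b c).
  move=> ai bi ci k; have [->|kp] := eqVneq k (l i); first by rewrite updp.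
  have [->|kq] := eqVneq k (r i); first by rewrite updq.
  have [->|kr] := eqVneq k (r j); first by rewrite updr /= ij.
  by rewrite updo.
pose F (a b c : nat) : R := vf (upd a b c).
have i0 (a b c : nat) : (a <= i)%N -> (b <= i.+1)%N -> (c <= i.+2)%N -> a = b ->
  pib i (F a b c) = 0.
  by move=> *; rewrite pib_eq ?updp ?updq //; apply: st.
have i1 (a b c : nat) : (a <= i)%N -> (b <= i.+1)%N -> (c <= i.+2)%N ->
  (a < b)%N -> pib i (F a b c) = - F a b c.
  by move=> *; rewrite pib_lt ?updp ?updq //; apply: st.
have i2 (a b c : nat) : (a <= i)%N -> (b <= i.+1)%N -> (c <= i.+2)%N ->
  (b < a)%N -> pib i (F a b c) = F b a c.
  by move=> *; rewrite pib_gt ?swi ?updp ?updq //; apply: st.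
have j0 (a b c : nat) : (a <= i)%N -> (b <= i.+1)%N -> (c <= i.+2)%N -> b = c ->
  pib j (F a b c) = 0.
  by move=> *; rewrite pib_eq ?lj ?updq ?updr //; apply: st.
have j1 (a b c : nat) : (a <= i)%N -> (b <= i.+1)%N -> (c <= i.+2)%N ->
  (b < c)%N -> pib j (F a b c) = - F a b c.
  by move=> *; rewrite pib_lt ?lj ?updq ?updr //; apply: st.
have j2 (a b c : nat) : (a <= i)%N -> (b <= i.+1)%N -> (c <= i.+2)%N ->
  (c < b)%N -> pib j (F a b c) = F a c b.
  by move=> *; rewrite pib_gt ?swj ?lj ?updq ?updr //; apply: st.
have -> : vf m = F (m (l i)) (m (r i)) (m (r j)).
  congr (vf _); apply/mnmP=> k; have [->|kp] := eqVneq k (l i); first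
    by rewrite updp.
  have [->|kq] := eqVneq k (r i); first by rewrite updq.
  have [->|kr] := eqVneq k (r j); first by rewrite updr.
  by rewrite updo.
have pN k v : pib k (- v) = - pib k v by rewrite linearN.
have p0 k : pib k 0 = 0 by rewrite linear0.
have := hm (l i); have := hm (r i); have := hm (r j); rewrite /= ij.
move: (m (l i)) (m (r i)) (m (r j)) => x1 x2 x3 h3 h2 h1.
(* All comparisons of the three exponents: [lia] discards the inconsistent ones, and in the 13 weak
   orderings the six rules compute both sides. *)
by have [?|?|?] := ltngtP x1 x2; have [?|?|?] := ltngtP x2 x3; have [?|?|?] :=
  ltngtP x1 x3;
  try (exfalso; lia);
  repeat first [rewrite p0 | rewrite pN | rewrite oppr0 | rewrite opprK
    | rewrite -> i0 by lia | rewrite -> i1 by lia | rewrite -> i2 by lia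
    | rewrite -> j0 by lia | rewrite -> j1 by lia | rewrite -> j2 by lia].
Qed.

End ZeroHecke.

(** * Leading and trailing terms: the rules for the operators *)

Section Rules.
Variables (C : numClosedFieldType) (n : nat).
Local Notation R := (coinvariant C n).
Local Notation pi := (@coinv_proj C n).
Implicit Types (i j : 'I_n.-1) (m : 'X_{1..n}) (x y : R) (a b : staircase n).
Local Notation l := (@left_pos n).
Local Notation r := (@right_pos n).
Local Notation v := (@staircase_basis C n).
Local Notation le := (@staircase_lex n).

Lemma is_ltP x k a : is_lt v le x k a <->
  [/\ coord x a = k, k != 0 & forall b, coord x b != 0 -> le b a].
Proof.
split=> [[c [xE <- ca cle]]|[<- k0 h]]; last by exists (coord x); split=> //;
  apply: coordE.
have cE := coord_unique xE; split=> // b; rewrite cE; exact: cle.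
Qed.

Lemma is_ttP x k a : is_tt v le x k a <->
  [/\ coord x a = k, k != 0 & forall b, coord x b != 0 -> le a b].
Proof.
split=> [[c [xE <- ca cle]]|[<- k0 h]]; last by exists (coord x); split=> //;
  apply: coordE.
have cE := coord_unique xE; split=> // b; rewrite cE; exact: cle.
Qed.

Lemma staircase_lex_refl a : le a a.
Proof. by have [+ _ _ _] := staircase_lex_total_order n; apply. Qed.

Lemma staircase_lex_anti a b : le a b -> le b a -> a = b.
Proof. by have [_ + _ _] := staircase_lex_total_order n => h ab ba; apply: h;
  rewrite ab. Qed.

Lemma swap_basis i a : (a (r i) <= i)%N -> exists2 b,
  coinv_act (simple_refl i) (v a) = v b & staircase_mnm b =
    swap_mnm i (staircase_mnm a).
Proof.
move=> ar; have /is_staircaseP[b bE]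
  : is_staircase (swap_mnm i (staircase_mnm a)).
  by apply: swap_staircase; [apply: staircase_mnmP | rewrite staircase_mnmE].
by exists b; rewrite // coinv_act_vf bE.
Qed.

Lemma swap_lt_lex i a b : staircase_mnm b = swap_mnm i (staircase_mnm a) ->
  (a (r i) < a (l i))%N -> le b a.
Proof.
move=> bE lt; apply: (@staircase_lex_prefix _ _ _ (l i)) => [j ji|].
  by rewrite -!staircase_mnmE bE swap_prefix.
by rewrite -!staircase_mnmE bE swap_l !staircase_mnmE.
Qed.

Lemma swap_gt_lex i a b : staircase_mnm b = swap_mnm i (staircase_mnm a) ->
  (a (l i) < a (r i))%N -> le a b.
Proof.
move=> bE lt; apply: (@staircase_lex_prefix _ _ _ (l i)) => [j ji|].
  by rewrite -!staircase_mnmE bE swap_prefix.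
by rewrite -!staircase_mnmE bE swap_l !staircase_mnmE.
Qed.

Lemma swap_neq i a b : staircase_mnm b = swap_mnm i (staircase_mnm a) ->
  a (l i) <> a (r i) :> nat -> b <> a.
Proof. by move=> bE ne e; apply: ne;
  rewrite -!staircase_mnmE -{1}e bE swap_l. Qed.

(** The case in which exchanging the exponents creates the forbidden power x_i^(i+1). The parameter
    k0 selects the monomial to single out: a_i will give back x^a, and i, the largest admissible
    exponent of x_i, the leading monomial. *)
Lemma coord_max_exchange i a (k0 : nat) : a (r i) = i.+1 :> nat ->
  (a (l i) <= k0 <= i)%N ->
  exists lead : staircase n, [/\ lead (l i) = k0 :> nat,
    lead (r i) = (a (l i) + (i.+1 - k0))%N :> nat,
   forall j : 'I_n, j != l i -> j != r i -> lead j = a j :> nat,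
   coord (coinv_act (simple_refl i) (v a)) lead = -1
   & forall b, coord (coinv_act (simple_refl i) (v a)) b != 0 -> b != lead ->
      (forall j : 'I_n, (j < i)%N -> b j = a j :> nat) /\
      (b (l i) <> k0 :> nat \/ (b (r i) < lead (r i))%N)].
Proof.
move=> ar; case/andP=> ak ki.
pose m0 := [multinom if (k == l i) || (k == r i) then 0%N else a k
  : nat | k < n].
have m0l : m0 (l i) = 0%N by rewrite mnmE eqxx.
have m0r : m0 (r i) = 0%N by rewrite mnmE eqxx orbT.
have m0s : is_staircase m0 by move=> k; rewrite mnmE; case: ifP => // _;
  rewrite -ltnS.
have m0o k : k != l i -> k != r i -> m0 k = a k by move=> /negPf h1 /negPf h2;
  rewrite mnmE h1 h2.
have m0p (k : 'I_n) : (k < i)%N -> m0 k = a k.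
  move=> ki'; apply: m0o; apply/eqP => /(congr1 (@nat_of_ord _)) /= e.
    by rewrite e ltnn in ki'.
  by rewrite e ltnNge leqnSn in ki'.
have := @max_exchange C n i m0 m0l m0r m0s (a (l i)) k0; rewrite ak ki =>
  /(_ isT).
set e := two_exp i m0 k0 _.
have /is_staircaseP[lead leadE] : is_staircase e.
  move=> k; have [->|kl] := eqVneq k (l i); first by rewrite two_exp_l.
  have [->|kr] := eqVneq k (r i); last by rewrite two_exp_other.
  by rewrite two_exp_r //= (addnBA _ (leqW ki)) leq_subLR leq_add2r.
have swE : swap_mnm i (staircase_mnm a) = two_exp i m0 i.+1 (a (l i)).
  apply/mnmP=> k; have [->|kl] := eqVneq k (l i); first
    by rewrite swap_l staircase_mnmE two_exp_l.
  have [->|kr] := eqVneq k (r i); first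
    by rewrite swap_r staircase_mnmE two_exp_r.
  by rewrite swap_other // two_exp_other // staircase_mnmE m0o.
rewrite -swE -coinv_act_vf leadE -/(v a) -/(v lead).
case/mspan_staircase=> [m []//|c cE hc].
have leadl : lead (l i) = k0 :> nat by rewrite -staircase_mnmE -leadE two_exp_l.
have leadr : lead (r i) = (a (l i) + (i.+1 - k0))%N :> nat
  by rewrite -staircase_mnmE -leadE two_exp_r.
have co b : coord (coinv_act (simple_refl i) (v a)) b = c b - (b == lead)%:R.
  have -> : coinv_act (simple_refl i) (v a) = -1 *: v lead + \sum_a c a *: v a.
    by rewrite -cE scaleN1r addrC addrK.
  by rewrite coordP coord_basis (coord_unique (c := c)) // mulN1r addrC.
exists lead; split=> // [j jl jr||b].
- by rewrite -staircase_mnmE -leadE two_exp_other ?m0o.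
- rewrite co eqxx; have [->|/hc[_ _ ]] := eqVneq (c lead) 0; first
    by rewrite sub0r.
  by rewrite !staircase_mnmE leadl leadr ltnn => -[].
rewrite co => nz /negPf bl; rewrite bl subr0 in nz.
have [_ h1 h2] := hc _ nz; split; last by rewrite !staircase_mnmE in h2;
  rewrite leadr.
by move=> j ji; rewrite -staircase_mnmE h1 ?m0p.
Qed.

Lemma pib_rulesP : pib_rules v le (@coinv_act C n) (@pib C n).
Proof.
move=> i a; rewrite pib_staircase_basis /pib_basis.
have N1 : (-1 == 1 :> C) = false.
  by rewrite eq_sym -addr_eq0 -mulr2n pnatr_eq0.
have cN1 : (-1 : C) != 0 by rewrite oppr_eq0 oner_eq0.
rewrite /pib_zero_case /pib_opp_case /pib_refl_case.
have [lt|gt|e] := ltngtP (a (l i)) (a (r i)).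
- have [ar|ar] := leqP (a (r i)) i.
    have [b vb bE] := swap_basis ar; rewrite vb.
    have ab := swap_gt_lex bE lt; have nab :=
      swap_neq bE (elimF eqP (ltn_eqF lt)).
    have nba : (a == b) = false by apply/eqP => ?; apply: nab.
    split=> //.
    + apply: Or32; left; exists 1, b; rewrite is_ltP coord_basis eqxx oner_eq0;
        split; first split=> //.
        by move=> k; rewrite coord_basis; case: (k =P b) => [-> _|];
          rewrite ?eqxx ?staircase_lex_refl.
      by rewrite ab nba.
    + by rewrite is_ttP coord_basis nba => -[/eqP]; rewrite eq_sym oner_eq0.
    + case=> j []; rewrite is_ltP coord_basis; case: (j =P b) =>
        [->|_] [/eqP e _ _]; last by rewrite eq_sym oner_eq0 in e.
      by case=> ba _; case: nab; apply: staircase_lex_anti.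
  have ari : a (r i) = i.+1 :> nat.
    by apply/eqP; rewrite eqn_leq ar andbT; have := ltn_ord (a (r i));
      rewrite ltnS.
  have ali : (a (l i) <= i)%N by have := ltn_ord (a (l i)); rewrite ltnS.
  (* With k0 = a_i the selected exponent of x_(i+1) is a_i + (i + 1 - a_i) = i + 1 = a_(i+1), so the
     selected monomial is x^a. *)
  have cv : coord (coinv_act (simple_refl i) (v a)) a = -1.
    have [|b [b1 b2 bo cb _]] := coord_max_exchange ari (k0 := a (l i)); first
      by rewrite leqnn.
    suff ab : a = b by rewrite {2}ab.
    apply/ffunP=> k; apply: val_inj; rewrite /=.
    have [->|kl] := eqVneq k (l i); first by rewrite b1.
    have [->|kr] := eqVneq k (r i); first by rewrite b2 ari subnKC // leqW.
    by rewrite bo.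
  have [|lead [l1 l2 lo cl lmax]] := coord_max_exchange ari (k0 := i); first
    by rewrite ali leqnn.
  have isl : is_lt v le (coinv_act (simple_refl i) (v a)) (-1) lead.
    apply/is_ltP; split=> // b nb; have [->|bl] := eqVneq b lead;
      first exact: staircase_lex_refl.
    have [bp hb] := lmax b nb bl.
    have [bli|bli] := eqVneq (b (l i) : nat) i.
      have {hb} hr : (b (r i) < lead (r i))%N by case: hb.
      apply: (@staircase_lex_prefix _ _ _ (r i)) => // j;
        rewrite ltnS leq_eqVlt => /orP[/eqP jE|ji].
        have -> : j = l i by apply: val_inj.
        by rewrite bli l1.
      rewrite bp // lo //; apply/eqP => jE; rewrite jE ?ltnn //= in ji.
      by rewrite ltnNge leqnSn in ji.
    apply: (@staircase_lex_prefix _ _ _ (l i)) => [j ji|].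
      rewrite bp // lo //; apply/eqP => jE; rewrite jE ?ltnn //= in ji.
      by rewrite ltnNge leqnSn in ji.
    by rewrite l1 ltn_neqAle bli -ltnS ltn_ord.
  (* The coefficient -1 at a makes lead at least a, which gives the second rule, with lead = a if
     a_i = i. It also excludes the other two: the first needs the coefficient 1 at a, the third a
     leading monomial below a. *)
  split=> //.
  + apply: Or32; have [la|nl] := eqVneq lead a;
      [by right; rewrite -{2}la | left; exists (-1), lead].
    by split=> //; split; [have [_ _ h] := (is_ltP _ _ _).1 isl; apply: h;
      rewrite cv | rewrite eq_sym].
  + by rewrite is_ttP cv => -[/eqP]; rewrite N1.
  + case=> j []; rewrite is_ltP => -[cj _ jmax] [ja nja].
    have aj : le a j by apply: jmax; rewrite cv.
    by case/eqP: nja; apply: staircase_lex_anti.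
- have ar : (a (r i) <= i)%N by apply: leq_trans (ltnW gt) _; rewrite -ltnS.
  have [b vb bE] := swap_basis ar; rewrite vb.
  have ba := swap_lt_lex bE gt; have nab :=
    swap_neq bE (elimF eqP (gtn_eqF gt)).
  have nba : (a == b) = false by apply/eqP => ?; apply: nab.
  split=> //.
  + apply: Or33; exists b; rewrite is_ltP coord_basis eqxx oner_eq0; split;
      first split=> //.
      by move=> k; rewrite coord_basis; case: (k =P b) => [-> _|];
        rewrite ?eqxx ?staircase_lex_refl.
    by rewrite ba eq_sym nba.
  + by rewrite is_ttP coord_basis nba => -[/eqP]; rewrite eq_sym oner_eq0.
  + case=> [[k [j []]]|]; rewrite is_ltP coord_basis.
      case: (j =P b) => [->|_] [/= <- + _]; last by rewrite eqxx.
      by move=> _ [ab _]; case: nab; apply: staircase_lex_anti.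
    by rewrite nba => -[/eqP]; rewrite eq_sym oppr_eq0 oner_eq0.
- have ar : (a (r i) <= i)%N by rewrite -e -ltnS.
  have [b vb bE] := swap_basis ar.
  have {bE} ba : b = a.
    apply/staircase_mnm_inj/mnmP => k; rewrite bE.
    have [->|kl] := eqVneq k (l i); first by rewrite swap_l !staircase_mnmE e.
    have [->|kr] := eqVneq k (r i); first by rewrite swap_r !staircase_mnmE e.
    by rewrite swap_other.
  rewrite vb ba; split=> //.
  + apply: Or31; rewrite is_ttP coord_basis eqxx oner_eq0; split=> // k.
    by rewrite coord_basis; case: (k =P a) => [-> _|];
      rewrite ?eqxx ?staircase_lex_refl.
  + case=> [[k [j []]]|]; rewrite is_ltP coord_basis.
      case: (j =P a) => [->|_] [/= <- + _]; last by rewrite eqxx.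
      by move=> _ [_]; rewrite eqxx.
    by rewrite eqxx => -[/eqP]; rewrite eq_sym N1.
  + case=> j []; rewrite is_ltP coord_basis; case: (j =P a) =>
      [->|_] [/eqP ej _ _].
      by case.
    by rewrite eq_sym oner_eq0 in ej.
Qed.

End Rules.

(** * The lexicographic filtration and its factors *)

Section CompositionFactors.
Variables (C : numClosedFieldType) (n : nat).
Local Notation R := (coinvariant C n).
Implicit Types (i : 'I_n.-1) (x y : R) (a b : staircase n).
Local Notation l := (@left_pos n).
Local Notation r := (@right_pos n).
Local Notation v := (@staircase_basis C n).
Local Notation le := (@staircase_lex n).

Lemma pib_zero_Hecke : zero_Hecke_module (@pib C n).
Proof.
split; [exact: pib_is_linear | exact: pib_quadratic | exact: pib_commute
  | exact: pib_braid].
Qed.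

Lemma coord_sum (c : staircase n -> C) (F : staircase n -> R) b :
  coord (\sum_a c a *: F a) b = \sum_a c a * coord (F a) b.
Proof.
apply: (coord_unique (c := fun b => \sum_a c a * coord (F a) b)).
under [RHS]eq_bigr => b' _ do rewrite scaler_suml.
rewrite exchange_big; apply: eq_bigr => a _; rewrite {1}[F a]coordE scaler_sumr.
by apply: eq_bigr => b' _; rewrite scalerA.
Qed.

Lemma coord0 a : coord (0 : R) a = 0.
Proof. by apply: (coord_unique (c := fun=> 0)); rewrite big1 // => b _;
  rewrite scale0r. Qed.

Lemma coordN x a : coord (- x) a = - coord x a.
Proof. by rewrite -scaleN1r -[_ *: _]addr0 coordP coord0 mulN1r addr0. Qed.

Lemma pib_basis_diag i a : coord (pib_basis C i a) a =
  if i \in ascents a then -1 else 0.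
Proof.
rewrite /pib_basis inE; have [lt|gt|e] := ltngtP (a (l i)) (a (r i)).
- by rewrite coordN coord_basis eqxx.
- have [b -> bE] := swap_basis C (leq_trans (ltnW gt) (ltn_ord (a (l i)))).
  by rewrite coord_basis; case: eqP => // ab;
    case: (swap_neq bE (elimF eqP (gtn_eqF gt))).
- by rewrite coord0.
Qed.

Lemma pib_basis_support i a b : coord (pib_basis C i a) b != 0 -> le b a.
Proof.
rewrite /pib_basis; have [lt|gt|e] := ltngtP (a (l i)) (a (r i)).
- by rewrite coordN coord_basis oppr_eq0; case: (b =P a) => [-> _|_];
    rewrite ?eqxx ?staircase_lex_refl.
- have [b' -> bE] := swap_basis C (leq_trans (ltnW gt) (ltn_ord (a (l i)))).
  rewrite coord_basis; case: (b =P b') => [-> _|_]; last by rewrite eqxx.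
  exact: swap_lt_lex bE gt.
- by rewrite coord0 eqxx.
Qed.

Definition lex_enum : seq (staircase n) := sort le (enum (staircase n)).

Lemma mem_lex_enum a : a \in lex_enum.
Proof. by rewrite mem_sort mem_enum. Qed.

Lemma index_lex_enum a b : le a b -> (index a lex_enum <= index b lex_enum)%N.
Proof.
have [_ anti tr tot] := staircase_lex_total_order n.
move=> ab; rewrite leqNgt; apply/negP => lt.
have ba : le b a by apply: (sorted_ltn_index tr) lt;
  rewrite ?mem_lex_enum ?sort_sorted.
by rewrite (staircase_lex_anti ab ba) ltnn in lt.
Qed.

Lemma index_lex_enum_lt a : (index a lex_enum < size lex_enum)%N.
Proof. by rewrite index_mem mem_lex_enum. Qed.

Lemma uniq_lex_enum : uniq lex_enum.
Proof. by rewrite sort_uniq enum_uniq. Qed.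

(** The span of the k lexicographically smallest basis monomials. It is stable because the operators
    are triangular, see [pib_basis_support]. *)
Definition lex_filtration (k : nat) x : Prop :=
  forall a, coord x a != 0 -> (index a lex_enum < k)%N.

Lemma lex_filtration_submodule k : submodule (@pib C n) (lex_filtration k).
Proof.
split=> [a|c x y hx hy a|i x hx a].
- by rewrite coord0 eqxx.
- rewrite coordP; have [->|/hy //] := eqVneq (coord y a) 0.
  by rewrite addr0 mulf_eq0 negb_or => /andP[_ /hx].
rewrite coord_sum => nz; apply: contrapT => no; case/eqP: nz; rewrite big1 // =>
  b _.
have [->|nb] := eqVneq (coord x b) 0; first by rewrite mul0r.
have [->|/pib_basis_support ab] := eqVneq (coord (pib_basis C i b) a) 0; first
  by rewrite mulr0.
by case: no; apply: leq_ltn_trans (index_lex_enum ab) (hx b nb).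
Qed.

(** The factor is read off by the coordinate at a0, the monomial in position k. By triangularity
    only a0 itself contributes to this coordinate of the image, with the diagonal coefficient of
    [pib_basis_diag]. *)
Lemma lex_filtration_factor k : (k < size lex_enum)%N ->
  factor_iso (@pib C n) (lex_filtration k.+1) (lex_filtration k)
    (nth set0 [seq ascents a | a <- lex_enum] k).
Proof.
move=> ks; have [a0 ak] : exists a, index a lex_enum = k.
  have x0 : staircase n := [ffun i => ord0].
  by exists (nth x0 lex_enum k); rewrite index_uniq ?uniq_lex_enum.
have -> : nth set0 [seq ascents a | a <- lex_enum] k = ascents a0.
  by rewrite (nth_map a0) // -ak nth_index ?mem_lex_enum.
exists (fun x => coord x a0); split=> [c x y _ _|c|x|i x hx].
- exact: coordP.
- exists (c *: v a0); last
    by rewrite -[_ *: _]addr0 coordP coord_basis eqxx coord0 addr0 mulr1.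
  move=> b; rewrite -[_ *: _]addr0 coordP coord0 addr0 coord_basis.
  by case: (b =P a0) => [-> _|_]; [rewrite ak | rewrite mulr0 eqxx].
- split=> [hx|[hx x0] b nb].
    split=> [b /hx h|]; first exact: leqW.
    by apply/eqP; apply: contrapT => /negP /hx; rewrite ak ltnn.
  have := hx b nb; rewrite ltnS leq_eqVlt => /orP[/eqP bk|//].
  have ba : b = a0 by rewrite -(nth_index b (mem_lex_enum b)) bk -ak nth_index
    ?mem_lex_enum.
  by rewrite ba x0 eqxx in nb.
rewrite coord_sum (bigD1 a0) //= pib_basis_diag big1 ?addr0.
  by rewrite /simple_act; case: ifP => _; rewrite ?mulr0 ?mulrN1.
move=> b nb; have [->|xb] := eqVneq (coord x b) 0; first by rewrite mul0r.
have [->|/pib_basis_support ab] := eqVneq (coord (pib_basis C i b) a0) 0; first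
  by rewrite mulr0.
have := index_lex_enum ab; rewrite ak => kb; have := hx b xb; rewrite ltnS =>
  bk.
have bk' : index b lex_enum = k by apply/eqP; rewrite eqn_leq bk kb.
by case/eqP: nb; rewrite -(nth_index b (mem_lex_enum b)) bk' -ak nth_index
  ?mem_lex_enum.
Qed.

Lemma pib_FQchar : FQchar (@pib C n) (fun N => (\sum_(z < N) 'X_z) ^+ n).
Proof.
exists [seq ascents a | a <- lex_enum]; split; last first.
  move=> N; rewrite big_map -sum_fund_qsym_ascents.
  by rewrite [RHS](perm_big (enum (staircase n))) ?big_enum //= perm_sort.
exists lex_filtration; rewrite size_map; split=> [k _|x|x a|k].
- exact: lex_filtration_submodule.
- split=> [h|-> a]; last by rewrite coord0 eqxx.
  apply: coord_inj => a; rewrite coord0; apply/eqP; apply: contrapT => /negP /h.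
  by rewrite ltn0.
- by rewrite index_lex_enum_lt.
- exact: lex_filtration_factor.
Qed.

End CompositionFactors.

(** * Specht decomposition of the coinvariant algebra *)

Section FrobeniusCharacteristic.
Variables (C : numClosedFieldType) (n : nat).
Local Notation R := (coinvariant C n).
Local Notation V := (tabloid_space C n).
Implicit Types (x y : R) (w : tabloid n) (s : 'S_n).

Lemma tabloid_act_Specht (la : {ffun 'I_n -> 'I_n.+1}) s (f : V) : partn la ->
  f \in Specht C n (seq_of_shape la) ->
  tabloid_act s f \in Specht C n (seq_of_shape la).
Proof.
move=> pla; move: f; apply: Specht_ind => [|a f g Pf Pg|T hT].
- by rewrite linear0 mem0v.
- by rewrite linearP; apply: memvD => //; apply: memvZ.
rewrite tabloid_act_polytabloid; apply: polytabloid_Specht.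
have [iT Tla] := is_tableauP T pla hT; apply/(is_tableauP _ pla);
  split=> [k k'|k].
  by rewrite !ffunE => /iT/perm_inj.
by rewrite ffunE.
Qed.

Definition ballot_words : seq (tabloid n) := enum (@ballot n n).

Definition shapes : seq (seq nat) :=
  [seq seq_of_shape (content w) | w <- ballot_words].

(** The default of [nth] is never reached, as [shapes] and [ballot_words] have the same size. *)
Definition word_at (j : 'I_(size shapes)) : tabloid n :=
  nth [ffun k => k] ballot_words j.

Lemma word_at_ballot j : ballot (word_at j).
Proof.
have : word_at j \in ballot_words
  by rewrite mem_nth // -(size_map (fun w => seq_of_shape (content w))).
by rewrite mem_enum.
Qed.

Lemma nth_shapes (j : 'I_(size shapes))
  : nth [::] shapes j = seq_of_shape (content (word_at j)).
Proof. by rewrite (nth_map [ffun k => k]) //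
  -(size_map (fun w => seq_of_shape (content w))). Qed.

Lemma word_at_surj w : ballot w -> exists j, word_at j = w.
Proof.
move=> bw; have wb : w \in ballot_words by rewrite mem_enum.
have lt : (index w ballot_words < size shapes)%N by rewrite size_map index_mem.
by exists (Ordinal lt); rewrite /word_at /= nth_index.
Qed.

Lemma word_at_inj : injective word_at.
Proof.
move=> j k /eqP; rewrite nth_uniq ?enum_uniq //; first by move/eqP/val_inj.
  by rewrite -(size_map (fun w => seq_of_shape (content w))).
by rewrite -(size_map (fun w => seq_of_shape (content w))).
Qed.

(** The components of x are obtained by inverting [theta] on the function attached to x. They exist
    by [theta_surj]; linearity and equivariance follow from their uniqueness, that is from
    [theta_inj], which concerns the values at ballot words only. *)
Lemma coinvariant_decomposition : Specht_decomposition (@coinv_act C n) shapes.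
Proof.
have [f [f_lin f_act f_inj f_surj]] := coinvariant_regular C n.
have [comp comp_Specht theta_comp] : exists2 comp : R -> tabloid n -> V,
    forall x w, ballot w -> comp x w \in shape_Specht C w & forall x s,
      theta (comp x) s = f x s.
  have /choice[comp hc] : forall x, exists u : tabloid n -> V,
      (forall w, ballot w -> u w \in shape_Specht C w) /\ forall s,
        theta u s = f x s.
    by move=> x; have [u uS fu] := theta_surj (f x); exists u; split.
  by exists comp => [x|x]; have [] := hc x.
have comp_unique x (u : tabloid n -> V) :
    (forall w, ballot w -> u w \in shape_Specht C w) ->
      (forall s, theta u s = f x s) ->
    forall w, ballot w -> comp x w = u w.
  move=> hu ux w bw; apply/eqP; rewrite -subr_eq0; apply/eqP;
    rewrite addrC -scaleN1r.
  apply: (theta_inj (v := fun w => -1 *: u w + comp x w)) bw => [w' bw'|s].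
    by apply: memvD; [apply/memvZ/hu | apply: comp_Specht].
  by rewrite thetaP ux theta_comp mulN1r addNr.
have comp_lin k x y w : ballot w -> comp (k *: x + y) w = k *: comp x w
  + comp y w.
  apply: (comp_unique _ (fun w => k *: comp x w + comp y w)) => [w' bw'|s].
    by apply: memvD; [apply: memvZ|]; apply: comp_Specht.
  by rewrite thetaP !theta_comp f_lin.
have comp_act s x w : ballot w -> comp (coinv_act s x) w =
  tabloid_act s (comp x w).
  apply: (comp_unique _ (fun w => tabloid_act s (comp x w))) => [w' bw'|t].
    by apply: tabloid_act_Specht (comp_Specht _ _ bw'); apply: ballot_partn bw'.
  by rewrite theta_act theta_comp f_act.
exists (fun x => [ffun j => comp x (word_at j)]); split.
- by move=> k x y; apply/ffunP=> j; rewrite !ffunE comp_lin ?word_at_ballot.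
- move=> x y /ffunP e; apply/eqP; rewrite -subr_eq0; apply/eqP; apply: f_inj =>
    s.
  rewrite addrC -scaleN1r f_lin mulN1r -!theta_comp addrC; apply/eqP;
    rewrite subr_eq0.
  apply/eqP/eq_bigr => w bw; have [j <-] := word_at_surj bw.
  by have := e j; rewrite !ffunE => ->.
- move=> g; split=> [[x <-] j|hg].
    by rewrite ffunE nth_shapes; apply/comp_Specht/word_at_ballot.
  pose u w : V := if [pick j | word_at j == w] is Some j then g j else 0.
  have uE j : u (word_at j) = g j.
    by rewrite /u; case: pickP => [k /eqP/word_at_inj ->//|/(_ j)];
      rewrite eqxx.
  have uS w : ballot w -> u w \in shape_Specht C w.
    by move=> /word_at_surj[j <-]; rewrite uE /shape_Specht -nth_shapes.
  have [x xE] := f_surj (theta u); exists x; apply/ffunP=> j.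
  by rewrite ffunE -uE; apply: comp_unique (word_at_ballot j).
- by move=> s x; apply/ffunP=> j; rewrite !ffunE comp_act ?word_at_ballot.
Qed.

Lemma coinvariant_Fchar : Fchar (@coinv_act C n) (fun N =>
  (\sum_(z < N) 'X_z) ^+ n).
Proof.
exists shapes; split; last 1 first.
- by move=> N; rewrite big_map big_enum -sum_ballot_schur.
- apply/allP => _ /mapP[w + ->]; rewrite mem_enum => bw.
  by rewrite -[X in is_partition X](size_contentn w);
    apply/seq_of_shape_partition/ballot_partn.
exact: coinvariant_decomposition.
Qed.

End FrobeniusCharacteristic.

Theorem theorem6 (R : realType) (n : nat) :
  WQCC (@staircase_basis R[i] n) (@staircase_lex n) (@coinv_act R[i] n).
Proof.
split; [exact: coinv_is_Sn_module | exact: staircase_is_basis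
  | exact: staircase_lex_total_order |].
exists (@pib R[i] n); split; [exact: pib_rulesP | exact: pib_zero_Hecke |].
exists (fun N => (\sum_(z < N) 'X_z) ^+ n).
by split; [apply: pib_FQchar | apply: coinvariant_Fchar].
Qed.
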